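(* Let $\alpha,\beta\in(0,1)$ be constants and, for each $n$, let $A$ be the adjacency matrix of the heterogeneous random graph $\mathcal{G}_n(\alpha,\beta,W)$. Let \[\mathcal{T}_n=\sum_{i<j<k}\frac{A_{ij}A_{jk}A_{ki}}{d_id_jd_k}\] be the sum of weighted triangles. Define $\mu_{ij}=p_nw_{ij}$, $\mu_i=\sum_j\mu_{ij}$, \[\eta_i=\sum_{j\neq k}\frac{\mu_{ij}\mu_{jk}\mu_{ki}}{\mu_i^2\mu_j\mu_k},\qquad \gamma_{ij}=\sum_{k\notin\{i,j\}}\frac{\mu_{jk}\mu_{ki}}{\mu_i\mu_j\mu_k},\] \[v_{1n}^2=\sum_{i<j<k}\frac{\mu_{ij}(1-\mu_{ij})\mu_{jk}(1-\mu_{jk})\mu_{ki}(1-\mu_{ki})}{\mu_i^2\mu_j^2\mu_k^2},\qquad v_{2n}^2=\sum_{i<j}\left(\gamma_{ij}-\frac{\eta_i+\eta_j}{2}\right)^2\mu_{ij}(1-\mu_{ij}),\] and $v_n^2=v_{1n}^2+v_{2n}^2$. Then, as $n\to\infty$, \[\frac{\mathcal{T}_n-\mathbb{E}[\mathcal{T}_n]}{v_n}\Rightarrow\mathcal{N}(0,1).\]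
   Context: Model $\mathcal{G}_n(\alpha,\beta,W)$: $\alpha,\beta\in(0,1)$ are fixed constants, $p_n=n^{-\alpha}$, and $W=(w_{ij})_{1\le i,j\le n}$ is a deterministic array (it may depend on $n$) with $w_{ij}=w_{ji}\in[\beta,1]$ for $i\neq j$ and $w_{ii}=0$. It is the random undirected graph on $[n]=\{1,\dots,n\}$ with symmetric $0/1$ adjacency matrix $A$, $A_{ii}=0$, where $A_{ij}$ ($1\le i<j\le n$) are independent with $\mathbb{P}(A_{ij}=1)=p_nw_{ij}$. The degree of node $i$ is $d_i=\sum_jA_{ij}$. In $\mathcal{T}_n$ a summand is set to zero if $d_id_jd_k=0$. Sums over $j\ne k$ are over ordered pairs of distinct indices in $[n]$. $\Rightarrow\mathcal{N}(0,1)$ denotes convergence in distribution to the standard normal law. *)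

(* Defs.v *)
From HB Require Import structures.
From mathcomp Require Import all_boot all_order all_algebra.
From mathcomp Require Import all_classical all_reals all_analysis.

Set Implicit Arguments.
Unset Strict Implicit.
Unset Printing Implicit Defensive.

Import Order.TTheory GRing.Theory Num.Theory.
Import numFieldTopology.Exports.

Local Open Scope classical_set_scope.
Local Open Scope ring_scope.

Section Probability.
Context (R : realType).

(* Mutual independence of the subfamily of X indexed by D. *)
Definition independent_RVs d d' (T : measurableType d) (T' : measurableType d')
    (P : probability T R) (I : finType) (D : {set I})
    (X : I -> {RV P >-> T'}) : Prop :=
  forall (J : {set I}) (B : I -> set T'), J \subset D ->
    (forall i, i \in J -> measurable (B i)) ->
    P (\bigcap_(i in [set` J]) (X i @^-1` B i)) =
      (\prod_(i in J) P (X i @^-1` B i))%E.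

(* The X n may live on different probability spaces. *)
Definition cvg_in_distribution (d : nat -> measure_display)
    (T : forall n, measurableType (d n)) (P : forall n, probability (T n) R)
    (X : forall n, {RV (P n) >-> R})
    (nu : probability (measurableTypeR R) R) : Prop :=
  forall x : R, {for x, continuous (fun y : R => nu `]-oo, y]%classic)} ->
    cdf (X n) x @[n --> \oo] --> nu `]-oo, x]%classic.

End Probability.

Section Statistic.
Context (R : realType) (n : nat).

Definition degree (a : 'M[bool]_n) (i : 'I_n) : nat := (\sum_(j < n) a i j)%N.

(* Since x / 0 = 0, a summand with d_i d_j d_k = 0 vanishes. *)
Definition weighted_triangles (a : 'M[bool]_n) : R :=
  \sum_(i < n) \sum_(j < n | (i < j)%N) \sum_(k < n | (j < k)%N)
    (a i j * a j k * a k i)%N%:R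
      / (degree a i * degree a j * degree a k)%N%:R.

End Statistic.

Section Moments.
Context (R : realType) (n : nat) (mu : 'M[R]_n).

Definition mu_row (i : 'I_n) : R := \sum_(j < n) mu i j.

Definition eta (i : 'I_n) : R :=
  \sum_(j < n) \sum_(k < n | k != j)
    mu i j * mu j k * mu k i / (mu_row i ^+ 2 * mu_row j * mu_row k).

Definition gamma (i j : 'I_n) : R :=
  \sum_(k < n | (k != i) && (k != j))
    mu j k * mu k i / (mu_row i * mu_row j * mu_row k).

Definition v1_sqr : R :=
  \sum_(i < n) \sum_(j < n | (i < j)%N) \sum_(k < n | (j < k)%N)
    (mu i j * (1 - mu i j)) * (mu j k * (1 - mu j k)) * (mu k i * (1 - mu k i))
      / (mu_row i ^+ 2 * mu_row j ^+ 2 * mu_row k ^+ 2).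

Definition v2_sqr : R :=
  \sum_(i < n) \sum_(j < n | (i < j)%N)
    (gamma i j - (eta i + eta j) / 2) ^+ 2 * (mu i j * (1 - mu i j)).

Definition v_norm : R := Num.sqrt (v1_sqr + v2_sqr).

End Moments.

Section Model.
Context (R : realType).

Definition weight_array (beta : R) n (W : 'M[R]_n) : Prop :=
  [/\ forall i j, W i j = W j i,
      forall i j, i != j -> beta <= W i j <= 1
    & forall i, W i i = 0].

Definition edge_prob (alpha : R) n (W : 'M[R]_n) : 'M[R]_n :=
  \matrix_(i, j) (n%:R `^ (- alpha) * W i j).

Context d (T : measurableType d) (P : probability T R) (n : nat).
Implicit Type A : 'I_n -> 'I_n -> {RV P >-> bool}.

(* A is the adjacency matrix of the random graph G_n(alpha, beta, W). *)
Definition heterogeneous_graph (alpha : R) (W : 'M[R]_n) A : Prop :=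
  [/\ forall i j w, A i j w = A j i w,
      forall i w, A i i w = false,
      forall i j : 'I_n, (i < j)%N ->
        P [set w | A i j w = true] = (edge_prob alpha W i j)%:E
    & independent_RVs [set ij : 'I_n * 'I_n | (ij.1 < ij.2)%N]%SET
        (fun ij => A ij.1 ij.2)].

Definition adjacency A (w : T) : 'M[bool]_n := \matrix_(i, j) A i j w.

Lemma measurable_adjacency A (f : 'M[bool]_n -> R) :
  measurable_fun [set: T] (f \o adjacency A).
Proof.
move=> _ B mB; rewrite setTI.
have -> : (f \o adjacency A) @^-1` B =
  \big[setU/set0]_(a : 'M[bool]_n | f a \in B)
     \big[setI/setT]_(i < n) \big[setI/setT]_(j < n) (A i j @^-1` [set a i j]).
  rewrite -bigcup_seq_cond; apply/seteqP; split => w /=.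
    move=> Bw; exists (adjacency A w) => /=.
      by rewrite mem_index_enum /=; apply/mem_set.
    rewrite -bigcap_seq => i _ /=; rewrite -bigcap_seq => j _ /=.
    by rewrite mxE.
  case=> a /= /andP[_ /set_mem Ba]; rewrite -bigcap_seq => Aw.
  suff <- : a = adjacency A w by [].
  apply/matrixP => i j; rewrite mxE.
  have := Aw i; rewrite /= mem_index_enum => /(_ isT).
  rewrite -bigcap_seq => /(_ j); rewrite /= mem_index_enum => /(_ isT).
  by [].
apply: bigsetU_measurable => a _.
apply: bigsetI_measurable => i _; apply: bigsetI_measurable => j _.
exact: measurable_funPTI.
Qed.

Definition T_stat A : T -> R := @weighted_triangles R n \o adjacency A.

Definition standardized_T_stat (alpha : R) (W : 'M[R]_n) A : T -> R :=
  fun w => (T_stat A w - fine 'E_P[T_stat A]) / v_norm (edge_prob alpha W).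

Lemma measurable_standardized_T_stat alpha W A :
  measurable_fun [set: T] (standardized_T_stat alpha W A).
Proof.
exact: (measurable_adjacency A (fun a => (weighted_triangles R a -
  fine 'E_P[T_stat A]) / v_norm (edge_prob alpha W))).
Qed.

HB.instance Definition _ alpha W A := isMeasurableFun.Build _ _ _ _
  (standardized_T_stat alpha W A) (measurable_standardized_T_stat alpha W A).

End Model.

(* Main.v *)
Require Import Defs.
From mathcomp Require Import all_boot all_order all_algebra.
From mathcomp Require Import zify ring lra.
From mathcomp Require Import all_classical all_reals all_analysis.
From mathcomp Require Import measurable_realfun.

(** Write [x_ij = A_ij - mu_ij] and [m = n p_n]. The centred statistic is compared with the polynomial
[U = sum_{i<j} b_ij x_ij + sum_{i<j<k} c_ijk x_ij x_jk x_ki], where [c_ijk = 1 / (mu_i mu_j mu_k)] and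
[b_ij = gamma_ij - (eta_i + eta_j) / 2]: the first term of [b_ij] is the mean weight of the triangles that the
edge [ij] closes, the second the loss caused by the growth of [d_i] and [d_j]. One has [E U^2 = v_n^2].

Normality of [U / v_n] follows from Stein's method: [E (U f(U))] equals [E (Q f'(U))] up to third moments of
the discrete derivatives of [U], where [Q] is a quadratic form in these derivatives with [E Q = E U^2], and
[Q] concentrates by the Efron-Stein inequality.

The remainder [T - E T - U] is also bounded by Efron-Stein. Its derivative along an edge is small when all
degrees exceed a quarter of their means, which fails with probability [O(n e^{-c m})]. As [v_n^2 >= c m^-3],
the remainder divided by [v_n] has second moment [O(1/m + p_n + n^12 e^{-c m})].

Finally, Lipschitz functions with compact support and Gaussian mean zero have a Stein solution with Lipschitz
derivative, and they suffice to recover the distribution function. *)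

Set Implicit Arguments.
Unset Strict Implicit.
Unset Printing Implicit Defensive.

Import Order.TTheory GRing.Theory Num.Theory.
Import numFieldTopology.Exports numFieldNormedType.Exports.

Local Open Scope classical_set_scope.
Local Open Scope ring_scope.

(** * Functions on a product of Bernoulli spaces *)

(** When all weights are equal the coefficients [ecoef] vanish, since created triangles and degree
    growth cancel exactly; for uneven weights and alpha < 1/2 the linear part of U can dominate.

    It needs U = sum_e x_e D_e G with D_e G free of the edge e. The choice of G is U with its cubic
    part divided by 3, that is, the inverse of the number operator applied to U.

    Absolute values are removed by |a| <= lam + a^2 / lam, so that only second and fourth moments
    occur and no square roots are needed; lam is fixed before n grows.

    The terms of T that are quadratic in the x_ij are not part of U: they show up as the linear
    errors [err2] and in [err4], and are of lower order.

    For a test function of compact support and Gaussian mean zero the Stein solution has compact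
    support too, so its bounds follow from continuity, without Gaussian tail estimates. The price is
    tightness, which the second moment supplies. *)

Section Cube.
Context (R : realFieldType) (I : finType) (p : I -> R).
Local Notation cfg := {ffun I -> bool}.
Implicit Types (F G H X : cfg -> R) (o : cfg) (e : I).

Definition upd o e b : cfg := [ffun i => if i == e then b else o i].
Definition wt o : R := \prod_e (if o e then p e else 1 - p e).
Definition Ex F : R := \sum_o wt o * F o.
(** The conditional expectation given all coordinates but [e]. *)
Definition avg e F o : R := p e * F (upd o e true) + (1 - p e) * F (upd o e false).
Definition diff e F o : R := F (upd o e true) - F (upd o e false).
Definition bvar e : R := p e * (1 - p e).
Definition cent e o : R := (o e)%:R - p e.
Definition indep e F := forall o b, F (upd o e b) = F o.

Lemma updK o e b c : upd (upd o e b) e c = upd o e c.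
Proof. by apply/ffunP => i; rewrite !ffunE; case: eqP. Qed.
Lemma upd_id o e : upd o e (o e) = o.
Proof. by apply/ffunP => i; rewrite !ffunE; case: eqP => // ->. Qed.
Lemma upd_idP o e b : o e = b -> upd o e b = o.
Proof. by move=> <-; exact: upd_id. Qed.
Lemma updC o e f b c : e != f -> upd (upd o e b) f c = upd (upd o f c) e b.
Proof.
move=> ef; apply/ffunP => i; rewrite !ffunE.
by case: (eqVneq i f) => // ->; rewrite eq_sym (negPf ef).
Qed.
Lemma upd_same o e b : upd o e b e = b.
Proof. by rewrite ffunE eqxx. Qed.
Lemma upd_other o e f b : f != e -> upd o e b f = o f.
Proof. by move=> fe; rewrite ffunE (negPf fe). Qed.

Lemma ExD F G : Ex (fun o => F o + G o) = Ex F + Ex G.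
Proof. by rewrite -big_split; apply: eq_bigr => o _; rewrite mulrDr. Qed.
Lemma ExZ (a : R) F : Ex (fun o => a * F o) = a * Ex F.
Proof. by rewrite mulr_sumr; apply: eq_bigr => o _; rewrite mulrCA. Qed.
Lemma ExZr (a : R) F : Ex (fun o => F o * a) = Ex F * a.
Proof. by rewrite mulr_suml; apply: eq_bigr => o _; rewrite mulrA. Qed.
Lemma ExN F : Ex (fun o => - F o) = - Ex F.
Proof. by rewrite -sumrN; apply: eq_bigr => o _; rewrite mulrN. Qed.
Lemma ExB F G : Ex (fun o => F o - G o) = Ex F - Ex G.
Proof. by rewrite ExD ExN. Qed.
Lemma Ex_sum (J : Type) (s : seq J) (P : pred J) (F : J -> cfg -> R) :
  Ex (fun o => \sum_(j <- s | P j) F j o) = \sum_(j <- s | P j) Ex (F j).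
Proof.
rewrite /Ex exchange_big /=; apply: eq_bigr => o _; by rewrite mulr_sumr.
Qed.
Lemma eq_Ex F G : F =1 G -> Ex F = Ex G.
Proof. by move=> FG; apply: eq_bigr => o _; rewrite FG. Qed.

Lemma sum_upd e (g : cfg -> R) :
  \sum_o g o = \sum_(o : cfg | ~~ o e) (g (upd o e true) + g (upd o e false)).
Proof.
rewrite big_split /= (bigID (fun o : cfg => o e)) /=; congr (_ + _); last first.
  by apply: eq_bigr => o /negPf oe; rewrite upd_idP.
rewrite (reindex_onto (fun o => upd o e true) (fun o => upd o e false)) /=.
  by apply: eq_bigl => o; rewrite upd_same updK /=; apply/eqP/idP => [<-|/negPf oe];
    rewrite ?upd_same// upd_idP.
by move=> o oe; rewrite updK upd_idP.
Qed.

Lemma wt_upd o e b : wt (upd o e b) =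
  (if b then p e else 1 - p e) * \prod_(f | f != e) (if o f then p f else 1 - p f).
Proof.
rewrite /wt (bigD1 e) //= upd_same; congr (_ * _).
by apply: eq_bigr => f fe; rewrite upd_other.
Qed.

Lemma Ex_avg e F : Ex (avg e F) = Ex F.
Proof.
rewrite /Ex (sum_upd e) [RHS](sum_upd e); apply: eq_bigr => o _.
rewrite /avg !updK !wt_upd; ring.
Qed.

Lemma Ex1 : Ex (fun => 1) = 1.
Proof.
rewrite /Ex; under eq_bigr do rewrite mulr1.
have := bigA_distr_bigA (fun e b => if b then p e else 1 - p e : R).
by rewrite /wt => <-; apply: big1 => e _; rewrite big_bool /=; ring.
Qed.
Lemma Ex_cst (c : R) : Ex (fun => c) = c.
Proof.
by transitivity (Ex (fun=> c * 1)); [apply: eq_Ex => o; rewrite mulr1|rewrite (ExZ c (fun=> 1)) Ex1 mulr1].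
Qed.

(** A function of one bit is affine in that bit. This splitting underlies both the variance and the
    Stein computations. *)
Lemma avg_cent e F o : F o = avg e F o + cent e o * diff e F o.
Proof.
rewrite /avg /cent /diff -{1}(upd_id o e); case: (o e) => /=; ring.
Qed.

Lemma avg_indep e F : indep e (avg e F).
Proof. by move=> o b; rewrite /avg !updK. Qed.
Lemma diff_indep e F : indep e (diff e F).
Proof. by move=> o b; rewrite /diff !updK. Qed.
Lemma diff_of_indep e F o : indep e F -> diff e F o = 0.
Proof. by move=> iF; rewrite /diff !iF subrr. Qed.
Lemma eq_diff e F G o : F =1 G -> diff e F o = diff e G o.
Proof. by move=> FG; rewrite /diff !FG. Qed.
Lemma diff0_indep e F : (forall o, diff e F o = 0) -> indep e F.
Proof.
move=> d0 o b; have /eqP := d0 o; rewrite /diff subr_eq0 => /eqP h.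
by rewrite -[in RHS](upd_id o e); case: (o e); case: b; rewrite ?h.
Qed.
Lemma indep_avg e f F : indep e F -> indep e (avg f F).
Proof.
move=> iF o b; rewrite /avg.
have [->|ef] := eqVneq f e; first by rewrite !updK.
by rewrite !(updC _ _ _ (_ : e != f)) 1?eq_sym // !iF.
Qed.
Lemma diff_avg e f F o : e != f -> diff f (avg e F) o = avg e (diff f F) o.
Proof.
by move=> ef; rewrite /diff /avg !(updC _ _ _ (_ : f != e)) 1?eq_sym //; ring.
Qed.

Lemma Ex_indep e (g : bool -> R) H : indep e H ->
  Ex (fun o => g (o e) * H o) = (p e * g true + (1 - p e) * g false) * Ex H.
Proof.
move=> iH; rewrite -(Ex_avg e) -ExZ; apply: eq_Ex => o.
by rewrite /avg !upd_same !iH; ring.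
Qed.

Lemma Ex_cent e H : indep e H -> Ex (fun o => cent e o * H o) = 0.
Proof.
move=> /(@Ex_indep e (fun b => b%:R - p e)) ->; rewrite -[RHS](mul0r (Ex H)).
by congr (_ * _); rewrite /=; ring.
Qed.
Lemma Ex_cent2 e H : indep e H -> Ex (fun o => cent e o ^+ 2 * H o) = bvar e * Ex H.
Proof.
move=> /(@Ex_indep e (fun b => (b%:R - p e) ^+ 2)) ->.
by congr (_ * _); rewrite /bvar /=; ring.
Qed.

(** Law of total variance for one coordinate: in the square of [avg_cent] the mixed term is centred
    given the other coordinates. *)
Lemma Ex_sq_avg e F : Ex (fun o => F o ^+ 2) =
  Ex (fun o => avg e F o ^+ 2) + bvar e * Ex (fun o => diff e F o ^+ 2).
Proof.
rewrite -Ex_cent2; last by move=> o b; rewrite diff_indep.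
(* The zero is turned into twice the expectation of the mixed term, after which the identity holds
   pointwise. *)
rewrite -[RHS]addr0 -[X in _ + X](mulr0 2).
rewrite -(@Ex_cent e (fun o => avg e F o * diff e F o)); last first.
  by move=> o b; rewrite diff_indep avg_indep.
rewrite -ExZ -!ExD; apply: eq_Ex => o.
rewrite {1}(avg_cent e F o); ring.
Qed.

Lemma Ex_sel e H :
  Ex (fun o => (o e)%:R * H o) = p e * Ex (fun o => H (upd o e true)).
Proof.
rewrite -(Ex_avg e) -ExZ; apply: eq_Ex => o.
by rewrite /avg !upd_same /=; ring.
Qed.

Lemma Ex_prod (s : seq I) (g : bool -> R) : uniq s ->
  Ex (fun o => \prod_(e <- s) g (o e)) =
  \prod_(e <- s) (p e * g true + (1 - p e) * g false).
Proof.
elim: s => [_|e s IH /= /andP[es us]].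
  by rewrite big_nil (eq_Ex (G := fun=> 1)) ?Ex1 // => o; rewrite big_nil.
rewrite big_cons -IH // -Ex_indep; first by apply: eq_Ex => o; rewrite big_cons.
move=> o b; apply: eq_big_seq => f fs; rewrite upd_other //.
by apply: contraNneq es => <-.
Qed.

Definition set_all (s : seq I) o : cfg := foldr (fun e o1 => upd o1 e true) o s.

(** Restricting to the event that the edges of [s] are present amounts to switching them on by
    force. This decouples them from a factor [F] that reads the same bits. *)
Lemma Ex_all (s : seq I) F : uniq s ->
  Ex (fun o => (all o s)%:R * F o) = (\prod_(e <- s) p e) * Ex (fun o => F (set_all s o)).
Proof.
elim: s F => [|e s IH] F /= => [_|/andP[es us]].
  by rewrite big_nil mul1r; apply: eq_Ex => o; rewrite mul1r.
rewrite big_cons -mulrA -(IH (fun o => F (upd o e true))) //.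
transitivity (Ex (fun o => (o e)%:R * ((all o s)%:R * F o))).
  by apply: eq_Ex => o; case: (o e); rewrite ?mul1r ?mul0r.
rewrite Ex_sel; congr (_ * _); apply: eq_Ex => o; congr (_%:R * _).
by congr nat_of_bool; apply: eq_in_all => f fs; rewrite upd_other //; apply: contraNneq es => <-.
Qed.

Hypothesis p01 : forall e, 0 <= p e <= 1.

Lemma p_ge0 e : 0 <= p e. Proof. by case/andP: (p01 e). Qed.
Lemma p_le1 e : p e <= 1. Proof. by case/andP: (p01 e). Qed.
Lemma bvar_ge0 e : 0 <= bvar e.
Proof. by rewrite mulr_ge0 ?p_ge0 // subr_ge0 p_le1. Qed.
Lemma wt_ge0 o : 0 <= wt o.
Proof. by apply: prodr_ge0 => e _; case: ifP; rewrite ?subr_ge0 ?p_ge0 ?p_le1. Qed.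

Lemma Ex_ge0 F : (forall o, 0 <= F o) -> 0 <= Ex F.
Proof. by move=> F0; apply: sumr_ge0 => o _; rewrite mulr_ge0 ?wt_ge0. Qed.
Lemma le_Ex F G : (forall o, F o <= G o) -> Ex F <= Ex G.
Proof. by move=> FG; apply: ler_sum => o _; rewrite ler_wpM2l ?wt_ge0. Qed.
Lemma norm_Ex F : `|Ex F| <= Ex (fun o => `|F o|).
Proof.
apply: le_trans (ler_norm_sum _ _ _) _; apply: ler_sum => o _.
by rewrite normrM (ger0_norm (wt_ge0 o)).
Qed.

Lemma Ex_all_le (s : seq I) F (q : R) : (forall e, p e <= q) -> (forall o, 0 <= F o) ->
  Ex (fun o => (all o s)%:R * F o) <= q ^+ size (undup s) * Ex (fun o => F (set_all (undup s) o)).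
Proof.
move=> pq F0.
rewrite (eq_Ex (G := fun o => (all o (undup s))%:R * F o)); last first.
  by move=> o; rewrite (eq_all_r (mem_undup s)).
rewrite Ex_all ?undup_uniq //; apply: ler_wpM2r; first by exact: Ex_ge0.
elim: (undup s) => [|e t IH]; first by rewrite big_nil expr0.
rewrite big_cons exprS ler_pM ?p_ge0 //.
by apply: prodr_ge0 => f _; exact: p_ge0.
Qed.

(** Averaging over [e] commutes with the derivative along another coordinate, so this is Jensen's
    inequality for the square. *)
Lemma Ex_diff_avg e f F :
  Ex (fun o => diff f (avg e F) o ^+ 2) <= Ex (fun o => diff f F o ^+ 2).
Proof.
have [->|ef] := eqVneq e f.
  by apply: le_Ex => o; rewrite (diff_of_indep _ (@avg_indep _ _)) expr0n /= sqr_ge0.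
rewrite -[leRHS](Ex_avg e); apply: le_Ex => o; rewrite diff_avg // /avg.
have := bvar_ge0 e; rewrite /bvar.
set u := diff f F _; set v := diff f F _ => pq.
rewrite -subr_ge0 (_ : _ - _ = p e * (1 - p e) * (u - v) ^+ 2); last by ring.
by rewrite mulr_ge0 ?sqr_ge0.
Qed.

(** Each averaging step loses the conditional variance of [Ex_sq_avg]; by [Ex_diff_avg] the averages
    already taken do not enlarge the later derivatives. *)
Lemma efron_stein_seq (s : seq I) F :
  Ex (fun o => F o ^+ 2) <=
  Ex (fun o => foldl (fun G e => avg e G) F s o ^+ 2)
  + \sum_(e <- s) bvar e * Ex (fun o => diff e F o ^+ 2).
Proof.
elim: s F => [F|e s IH F] /=; first by rewrite big_nil addr0.
rewrite (Ex_sq_avg e) big_cons addrCA [leLHS]addrC lerD2l.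
apply: le_trans (IH _) _; rewrite lerD2l; apply: ler_sum => f _.
by rewrite ler_wpM2l ?bvar_ge0 // Ex_diff_avg.
Qed.

Lemma foldl_avg_indep s e F :
  indep e F \/ e \in s -> indep e (foldl (fun G f => avg f G) F s).
Proof.
elim: s F => [|f s IH] F /=; first by case.
case=> [iF|]; first by apply: IH; left; exact: indep_avg.
rewrite inE => /orP[/eqP ef|es]; apply: IH; [left|by right].
by rewrite ef; exact: avg_indep.
Qed.

(** The coordinates of [o] are overwritten one by one with those of [o']. *)
Lemma indep_all F o o' : (forall e, indep e F) -> F o = F o'.
Proof.
move=> iF.
suff H (s : seq I) : F (foldr (fun e o1 => upd o1 e (o' e)) o s) = F o.
  rewrite -(H (enum I)); congr F; apply/ffunP => i.
  have : i \in enum I by rewrite mem_enum.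
  elim: (enum I) => //= f s IH; rewrite inE ffunE.
  by case: eqP => [->|_] //=; exact: IH.
by elim: s => //= e s IH; rewrite iF.
Qed.

(** After averaging over every coordinate only the constant [Ex F] is left in [efron_stein_seq]. *)
Theorem efron_stein F :
  Ex (fun o => (F o - Ex F) ^+ 2) <=
  \sum_e bvar e * Ex (fun o => diff e F o ^+ 2).
Proof.
set G := foldl (fun G e => avg e G) F (enum I).
have EG : Ex G = Ex F.
  by rewrite /G; elim: (enum I) F {G} => //= e s IH F; rewrite IH Ex_avg.
have GE o : G o = Ex F.
  rewrite -EG -[LHS](Ex_cst (G o)); apply: eq_Ex => o'; apply: indep_all => e.
  by apply: foldl_avg_indep; right; rewrite mem_enum.
have := efron_stein_seq (enum I) F; rewrite -/G big_enum /=.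
rewrite (eq_Ex (F := fun o => G o ^+ 2) (G := fun=> Ex F ^+ 2)) => [|o]; last by rewrite GE.
rewrite Ex_cst -lerBlDl; apply: le_trans.
rewrite le_eqVlt; apply/orP; left; apply/eqP.
transitivity (Ex (fun o => F o ^+ 2 + (- (2 * Ex F)) * F o + Ex F ^+ 2)).
  by apply: eq_Ex => o; ring.
by rewrite !ExD ExZ Ex_cst; ring.
Qed.

Lemma norm_cent_le e o : `|cent e o| <= 1.
Proof.
by rewrite ler_norml /cent; have := p_ge0 e; have := p_le1 e; case: (o e) => /=; lra.
Qed.

Lemma Ex_cent3_le e H : indep e H -> (forall o, 0 <= H o) ->
  Ex (fun o => `|cent e o| ^+ 3 * H o) <= bvar e * Ex H.
Proof.
move=> iH H0; rewrite -Ex_cent2 //; apply: le_Ex => o; rewrite ler_wpM2r //.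
by rewrite exprS real_normK ?num_real // ler_piMl ?sqr_ge0 // norm_cent_le.
Qed.

(** For each [e], [f (X o)] is expanded around [Y = avg e X], which is free of the bit [e]: the
    constant term is centred, and the linear term produces [bvar e] and [f' (Y o)]. The factor 2
    pays for the Taylor remainder and for replacing [f' (Y o)] by [f' (X o)]. *)
Theorem stein_cube (X G : cfg -> R) (f f' : R -> R) (K : R) :
  (forall o, X o = \sum_e cent e o * diff e G o) ->
  (forall s t, `|f s - f t - f' t * (s - t)| <= K * (s - t) ^+ 2) ->
  (forall s t, `|f' s - f' t| <= K * `|s - t|) ->
  `|Ex (fun o => X o * f (X o))
    - Ex (fun o => (\sum_e bvar e * (diff e G o * diff e X o)) * f' (X o))|
  <= 2 * K * \sum_e bvar e * Ex (fun o => `|diff e G o| * diff e X o ^+ 2).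
Proof.
move=> XE taylor lip.
have -> : Ex (fun o => X o * f (X o)) =
    \sum_e Ex (fun o => cent e o * diff e G o * f (X o)).
  by rewrite -Ex_sum; apply: eq_Ex => o; rewrite {1}XE mulr_suml.
have -> : Ex (fun o => (\sum_e bvar e * (diff e G o * diff e X o)) * f' (X o)) =
    \sum_e Ex (fun o => bvar e * (diff e G o * diff e X o) * f' (X o)).
  by rewrite -Ex_sum; apply: eq_Ex => o; rewrite mulr_suml.
rewrite -sumrB mulr_sumr; apply: le_trans (ler_norm_sum _ _ _) _.
apply: ler_sum => e _.
set g := diff e G; set D := diff e X; set Y := avg e X.
have XY o : X o = Y o + cent e o * D o by exact: avg_cent.
have ig : indep e g by exact: diff_indep.
have iD : indep e D by exact: diff_indep.
have iY : indep e Y by exact: avg_indep.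
have K0 : 0 <= K.
  by have := lip 1 0; rewrite subr0 normr1 mulr1; apply: le_trans.
have z : Ex (fun o => cent e o * (g o * f (Y o))) = 0.
  by apply: Ex_cent => o b; rewrite ig iY.
have q : Ex (fun o => cent e o ^+ 2 * (g o * D o * f' (Y o))) =
    bvar e * Ex (fun o => g o * D o * f' (Y o)).
  by apply: Ex_cent2 => o b; rewrite ig iD iY.
have -> : Ex (fun o => cent e o * g o * f (X o)) -
    Ex (fun o => bvar e * (g o * D o) * f' (X o)) =
  Ex (fun o => cent e o * g o * (f (X o) - f (Y o) - f' (Y o) * (X o - Y o)))
  - bvar e * Ex (fun o => g o * D o * (f' (X o) - f' (Y o))).
  transitivity (Ex (fun o => cent e o * g o * f (X o))
    - Ex (fun o => cent e o * (g o * f (Y o)))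
    - Ex (fun o => cent e o ^+ 2 * (g o * D o * f' (Y o)))
    - (bvar e * Ex (fun o => g o * D o * f' (X o))
       - bvar e * Ex (fun o => g o * D o * f' (Y o)))).
    rewrite z q.
    rewrite [in LHS](eq_Ex (F := fun o => bvar e * (g o * D o) * f' (X o))
      (G := fun o => bvar e * (g o * D o * f' (X o)))); last by move=> o; ring.
    by rewrite ExZ; ring.
  rewrite -mulrBr -!ExB; congr (_ - bvar e * _); apply: eq_Ex => o.
    by rewrite XY; ring.
  by ring.
have i0 : indep e (fun o => `|g o| * D o ^+ 2) by move=> o b; rewrite ig iD.
have p0 o : 0 <= `|g o| * D o ^+ 2 by rewrite mulr_ge0 ?sqr_ge0.
have A1 : `|Ex (fun o => cent e o * g o *
      (f (X o) - f (Y o) - f' (Y o) * (X o - Y o)))|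
    <= K * (bvar e * Ex (fun o => `|g o| * D o ^+ 2)).
  apply: le_trans (norm_Ex _) _.
  apply: le_trans (_ : Ex (fun o => K * (`|cent e o| ^+ 3 * (`|g o| * D o ^+ 2))) <= _).
    apply: le_Ex => o; rewrite !normrM.
    have /(ler_wpM2l (mulr_ge0 (normr_ge0 (cent e o)) (normr_ge0 (g o)))) :=
      taylor (X o) (Y o).
    move/le_trans; apply; rewrite XY [Y o + _]addrC addrK exprMn.
    by rewrite -(real_normK (num_real (cent e o))) le_eqVlt; apply/orP; left; apply/eqP; ring.
  by rewrite ExZ ler_wpM2l // Ex_cent3_le.
have A2 : `|Ex (fun o => g o * D o * (f' (X o) - f' (Y o)))|
    <= K * Ex (fun o => `|g o| * D o ^+ 2).
  apply: le_trans (norm_Ex _) _; rewrite -ExZ; apply: le_Ex => o; rewrite !normrM.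
  have /(ler_wpM2l (mulr_ge0 (normr_ge0 (g o)) (normr_ge0 (D o)))) :=
    lip (X o) (Y o).
  move/le_trans; apply; rewrite XY [Y o + _]addrC addrK normrM.
  rewrite -(real_normK (num_real (D o))).
  have := norm_cent_le e o; have := normr_ge0 (g o); have := normr_ge0 (D o).
  set c := `|cent e o|; set d := `|D o|; set h := `|g o| => d0 h0 c1.
  rewrite [leLHS](_ : _ = c * (K * (h * d ^+ 2))); last by ring.
  by rewrite ler_piMl // !mulr_ge0 ?sqr_ge0.
apply: le_trans (ler_normB _ _) _; rewrite normrM (ger0_norm (bvar_ge0 e)).
apply: le_trans (lerD A1 (ler_wpM2l (bvar_ge0 e) A2)) _.
by rewrite le_eqVlt; apply/orP; left; apply/eqP; ring.
Qed.

(** The expansion of [stein_cube] for the identity function, where both errors vanish. *)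
Lemma Ex_Q_eq (X G : cfg -> R) :
  (forall o, X o = \sum_e cent e o * diff e G o) ->
  Ex (fun o => \sum_e bvar e * (diff e G o * diff e X o)) = Ex (fun o => X o ^+ 2).
Proof.
move=> XE; transitivity (\sum_e Ex (fun o => cent e o * diff e G o * X o)); last first.
  by rewrite -Ex_sum; apply: eq_Ex => o; rewrite [RHS]expr2 [in RHS]XE mulr_suml; apply: eq_bigr => e _; rewrite -XE.
rewrite Ex_sum; apply: eq_bigr => e _.
rewrite ExZ -Ex_cent2; last by move=> o b; rewrite !diff_indep.
rewrite -[LHS]addr0 -(@Ex_cent e (fun o => diff e G o * avg e X o)); last first.
  by move=> o b; rewrite diff_indep avg_indep.
by rewrite -ExD; apply: eq_Ex => o; rewrite (avg_cent e X o); ring.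
Qed.
End Cube.

(** * Sums over edges and triangles *)

Lemma le_of_eq (R : numDomainType) (x y : R) : x = y -> x <= y.
Proof. by move=> ->. Qed.

Lemma six_orders (i j k : nat) : i != j -> j != k -> i != k ->
  (((i < j)%N && (j < k)%N) + ((i < k)%N && (k < j)%N) + ((j < i)%N && (i < k)%N)
   + ((j < k)%N && (k < i)%N) + ((k < i)%N && (i < j)%N) + ((k < j)%N && (j < i)%N) = 1)%N.
Proof.
case: (ltngtP i j) => //= ij _; case: (ltngtP j k) => //= jk _;
  case: (ltngtP i k) => //= ik _.
- by have := ltn_trans ij jk; rewrite ltnNge (ltnW ik).
- by have := ltn_trans jk ij; rewrite ltnNge (ltnW ik).
Qed.

Ltac nneg := repeat first [ match goal with H : ?P |- ?P => exact H end
  | exact: ler0n | exact: sqr_ge0 | exact: normr_ge0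
  | apply: addr_ge0 | apply: exprn_ge0 | apply: mulr_ge0 | rewrite invr_ge0
  | apply: sumr_ge0 => * | done ].

Section Sums.
Context (R : realFieldType) (n : nat).
Implicit Types (g : 'I_n -> 'I_n -> 'I_n -> R).

Definition sum3 g : R := \sum_i \sum_j \sum_k g i j k.

Lemma eq_sum3 g h : (forall i j k, g i j k = h i j k) -> sum3 g = sum3 h.
Proof.
by move=> gh; apply: eq_bigr => i _; apply: eq_bigr => j _; apply: eq_bigr => k _.
Qed.
Lemma sum3D g h : sum3 (fun i j k => g i j k + h i j k) = sum3 g + sum3 h.
Proof.
rewrite /sum3 -big_split; apply: eq_bigr => i _; rewrite -big_split.
by apply: eq_bigr => j _; rewrite -big_split.
Qed.
Lemma sum3B g h : sum3 (fun i j k => g i j k - h i j k) = sum3 g - sum3 h.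
Proof.
rewrite /sum3 -sumrB; apply: eq_bigr => i _; rewrite -sumrB.
by apply: eq_bigr => j _; rewrite -sumrB.
Qed.
Lemma sum3_swap12 g : sum3 (fun i j k => g j i k) = sum3 g.
Proof. by rewrite /sum3 exchange_big. Qed.
Lemma sum3_swap23 g : sum3 (fun i j k => g i k j) = sum3 g.
Proof. by apply: eq_bigr => i _; rewrite exchange_big. Qed.
Lemma sum3_rot g : sum3 (fun i j k => g j k i) = sum3 g.
Proof. by rewrite -[RHS]sum3_swap23 -[RHS]sum3_swap12. Qed.
Lemma sum3_rot2 g : sum3 (fun i j k => g k i j) = sum3 g.
Proof. by rewrite -[RHS]sum3_rot -[RHS]sum3_rot. Qed.
Lemma sum3_swap13 g : sum3 (fun i j k => g k j i) = sum3 g.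
Proof. by rewrite -[RHS]sum3_rot -[RHS]sum3_swap23. Qed.

Definition sym3 g := (forall i j k, g i j k = g j i k) /\ (forall i j k, g i j k = g i k j).

(** Sums over all triples can be reindexed freely, so the whole proof works with them and returns to
    ordered triples only here. Symmetry carries the vanishing on one diagonal over to the other
    two. *)
Lemma sum_lt3 g : sym3 g -> (forall i k, g i i k = 0) ->
  \sum_(i < n) \sum_(j < n | (i < j)%N) \sum_(k < n | (j < k)%N) g i j k = sum3 g / 6.
Proof.
move=> [s12 s23] g0.
pose t (i j k : 'I_n) := ((i < j) && (j < k))%N%:R * g i j k.
have g02 i k : g i k i = 0 by rewrite s23.
have g03 i k : g k i i = 0 by rewrite s12.
have -> : \sum_(i < n) \sum_(j < n | (i < j)%N) \sum_(k < n | (j < k)%N) g i j k = sum3 t.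
  apply: eq_bigr => i _; rewrite big_mkcond; apply: eq_bigr => j _.
  case: ifP => ij; last by rewrite big1 // => k _; rewrite /t ij mul0r.
  rewrite big_mkcond; apply: eq_bigr => k _; rewrite /t ij.
  by case: ifP; rewrite ?mul1r ?mul0r.
have -> : sum3 g = sum3 t * 6; last by rewrite mulfK // pnatr_eq0.
transitivity (sum3 (fun i j k => t i j k + t i k j + t j i k + t j k i + t k i j + t k j i)).
  apply: eq_sum3 => i j k; rewrite /t.
  have e1 : g i k j = g i j k by rewrite -s23.
  have e2 : g j i k = g i j k by rewrite -s12.
  have e3 : g j k i = g i j k by rewrite -s23.
  have e4 : g k i j = g i j k by rewrite s12.
  have e5 : g k j i = g i j k by rewrite s12.
  rewrite e1 e2 e3 e4 e5 -!mulrDl.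
  have [->|ij] := eqVneq i j; first by rewrite g0 !mulr0.
  have [->|jk] := eqVneq j k; first by rewrite g03 !mulr0.
  have [->|ik] := eqVneq i k; first by rewrite g02 !mulr0.
  by rewrite -!natrD six_orders ?mul1r.
rewrite !sum3D (sum3_swap23 t) (sum3_swap12 t) (sum3_rot t) (sum3_rot2 t) (sum3_swap13 t).
by ring.
Qed.

Lemma sum_lt2 (g : 'I_n -> 'I_n -> R) : (forall i j, g i j = g j i) -> (forall i, g i i = 0) ->
  \sum_(i < n) \sum_(j < n | (i < j)%N) g i j = (\sum_i \sum_j g i j) / 2.
Proof.
move=> gS g0.
pose t (i j : 'I_n) := (i < j)%N%:R * g i j.
have -> : \sum_(i < n) \sum_(j < n | (i < j)%N) g i j = \sum_i \sum_j t i j.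
  apply: eq_bigr => i _; rewrite big_mkcond; apply: eq_bigr => j _; rewrite /t.
  by case: ifP; rewrite ?mul1r ?mul0r.
suff -> : \sum_i \sum_j g i j = (\sum_i \sum_j t i j) * 2 by rewrite mulfK // pnatr_eq0.
rewrite mulr2n mulrDr mulr1 [X in _ = _ + X]exchange_big /= -big_split; apply: eq_bigr => i _.
rewrite -big_split; apply: eq_bigr => j _; rewrite /t /= (gS j i) -mulrDl.
case: (ltngtP i j) => [ij|ij|/ord_inj ->]; rewrite ?g0 /= ?add0r ?addr0 ?mul1r ?mul0r//.
Qed.

Lemma sum_pred1 (i : 'I_n) (F : 'I_n -> R) : \sum_k (if k == i then F k else 0) = F i.
Proof. by rewrite -big_mkcond big_pred1_eq. Qed.

Lemma sum_cst (a : R) : \sum_(i < n) a = n%:R * a.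
Proof. by rewrite sumr_const card_ord mulr_natl. Qed.

(** Cauchy-Schwarz against the constant vector, through the double sum of the squares of
    [F i - F j]. *)
Lemma sqr_sum_le (F : 'I_n -> R) : (\sum_i F i) ^+ 2 <= n%:R * \sum_i F i ^+ 2.
Proof.
have : 0 <= \sum_i \sum_j (F i - F j) ^+ 2.
  by apply: sumr_ge0 => i _; apply: sumr_ge0 => j _; exact: sqr_ge0.
have -> : \sum_i \sum_j (F i - F j) ^+ 2 =
   2 * (n%:R * \sum_i F i ^+ 2) - 2 * (\sum_i F i) ^+ 2.
  transitivity (\sum_i \sum_j (F i ^+ 2 + F j ^+ 2 - 2 * (F i * F j))).
    by apply: eq_bigr => i _; apply: eq_bigr => j _; ring.
  transitivity (\sum_i (n%:R * F i ^+ 2 + \sum_j F j ^+ 2 - 2 * (F i * \sum_j F j))).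
    apply: eq_bigr => i _.
    by rewrite sumrB big_split /= sumr_const card_ord -[_ *+ n]mulr_natl -!mulr_sumr.
  rewrite sumrB big_split /= sumr_const card_ord -mulr_sumr -[_ *+ n]mulr_natl.
  by rewrite -mulr_sumr -mulr_suml; ring.
by move=> h; lra.
Qed.
End Sums.

Section Edge.
Context (n : nat).
Implicit Types i j k l : 'I_n.

(** The key of an undirected edge: both orientations read the same bit. *)
Definition upair i j : 'I_n * 'I_n := if (i < j)%N then (i, j) else (j, i).

Lemma upairC i j : upair i j = upair j i.
Proof. by rewrite /upair; case: ltngtP => // /ord_inj ->. Qed.
Lemma upair_eq i j k l : (upair i j == upair k l) = ((i == k) && (j == l)) || ((i == l) && (j == k)).
Proof.
by rewrite /upair; case: ifP => ij; case: ifP => kl; rewrite xpair_eqE -!val_eqE /=; lia.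
Qed.

End Edge.

Ltac upair_simp :=
  rewrite ?upair_eq ?eqxx; repeat match goal with
  | H : is_true (?a != ?b) |- context[?a == ?b] => rewrite (negPf H)
  | H : is_true (?a != ?b) |- context[?b == ?a] => rewrite [b == a]eq_sym (negPf H)
  end; rewrite ?andbF ?orbF //=.

(** * Effect of changing one edge or one vertex weight *)

Section Tri.
Context (R : realFieldType) (n : nat).
Implicit Types (c : 'I_n -> 'I_n -> 'I_n -> R) (M : 'I_n -> 'I_n -> R) (u v i j k : 'I_n).

Definition tri c M : R := sum3 (fun i j k => c i j k * (M i j * M j k * M k i)) / 6.
Definition lin (b M : 'I_n -> 'I_n -> R) : R := (\sum_i \sum_j b i j * M i j) / 2.

Lemma sum_pair (F : 'I_n -> 'I_n -> R) u v : u != v ->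
  \sum_i \sum_j (if upair i j == upair u v then F i j else 0) = F u v + F v u.
Proof.
move=> uv.
transitivity (\sum_i ((if i == u then F i v else 0) + (if i == v then F i u else 0))).
  apply: eq_bigr => i _.
  rewrite -(sum_pred1 v (fun j => if i == u then F i j else 0)).
  rewrite -(sum_pred1 u (fun j => if i == v then F i j else 0)) -big_split.
  apply: eq_bigr => j _ /=; rewrite upair_eq.
  have [->|iu] := eqVneq i u; last first.
    by rewrite /= ; case: (i == v); case: (j == u); case: (j == v); rewrite ?addr0 ?add0r.
  rewrite (negPf uv) /= orbF.
  by case: (j == v); case: (j == u); rewrite ?addr0.
by rewrite big_split !sum_pred1.
Qed.

(** A triangle with distinct vertices contains the edge [uv] in at most one position, so its change
    is linear in the change of that entry. The three possible positions are rotations of each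
    other. *)
Lemma tri_edge c M M' u v : sym3 c -> u != v ->
  (forall i j, M i j = M j i) -> (forall i j, M' i j = M' j i) ->
  (forall i, M i i = 0) -> (forall i, M' i i = 0) ->
  (forall i j, upair i j != upair u v -> M i j = M' i j) ->
  tri c M - tri c M' = (M u v - M' u v) * \sum_k c u v k * (M u k * M k v).
Proof.
move=> [c12 c23] uv MS M'S M0 M'0 MM'.
pose E i j k := if upair i j == upair u v then
  (M u v - M' u v) * (c i j k * (M i k * M k j)) else 0.
rewrite /tri -mulrBl -sum3B.
have -> : sum3 (fun i j k => c i j k * (M i j * M j k * M k i) -
    c i j k * (M' i j * M' j k * M' k i)) =
  sum3 (fun i j k => E i j k + E j k i + E k i j).
  apply: eq_sum3 => i j k; rewrite /E.
  have [<-|ij] := eqVneq i j.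
    have /negPf -> : upair i i != upair u v.
      by rewrite upair_eq; apply/negP => /orP[] /andP[/eqP e1 /eqP e2]; move: uv; rewrite -e1 -e2 eqxx.
    by rewrite !M0 !M'0; do 2 case: ifP => _; ring.
  have [<-|jk] := eqVneq j k.
    have /negPf -> : upair j j != upair u v.
      by rewrite upair_eq; apply/negP => /orP[] /andP[/eqP e1 /eqP e2]; move: uv; rewrite -e1 -e2 eqxx.
    by rewrite !M0 !M'0; do 2 case: ifP => _; ring.
  have [<-|ik] := eqVneq i k.
    have /negPf -> : upair i i != upair u v.
      by rewrite upair_eq; apply/negP => /orP[] /andP[/eqP e1 /eqP e2]; move: uv; rewrite -e1 -e2 eqxx.
    by rewrite !M0 !M'0; do 2 case: ifP => _; ring.
  have d1 : upair i j == upair u v -> upair j k != upair u v by move=> /eqP <-; upair_simp.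
  have d2 : upair i j == upair u v -> upair k i != upair u v by move=> /eqP <-; upair_simp.
  have d3 : upair j k == upair u v -> upair k i != upair u v by move=> /eqP <-; upair_simp.
  have tcoef1 : c j k i = c i j k by rewrite c23 c12.
  have tcoef2 : c k i j = c i j k by rewrite c12 c23.
  have Muv i' j' : upair i' j' == upair u v -> M i' j' = M u v /\ M' i' j' = M' u v.
    by rewrite upair_eq => /orP[] /andP[/eqP -> /eqP ->]; [|rewrite MS M'S].
  have MMr i' j' : upair j' i' != upair u v -> M i' j' = M' j' i' by move=> h; rewrite MS MM'.
  case: ifP => e1.
    have n1 := d1 e1; have n2 := d2 e1; have [-> ->] := Muv _ _ e1.
    rewrite (negPf n1) (negPf n2) (MM' _ _ n1) (MM' _ _ n2) (MMr i k n2) (MMr k j n1).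
    by ring.
  case: ifP => e2.
    have n3 := d3 e2; have [-> ->] := Muv _ _ e2.
    rewrite (negPf n3) (MM' _ _ (negbT e1)) (MM' _ _ n3) tcoef1.
    rewrite (MMr j i (negbT e1)) (MMr i k n3).
    by ring.
  case: ifP => e3.
    have [-> ->] := Muv _ _ e3.
    rewrite (MM' _ _ (negbT e1)) (MM' _ _ (negbT e2)) tcoef2.
    rewrite (MMr k j (negbT e2)) (MMr j i (negbT e1)).
    by ring.
  by rewrite (MM' _ _ (negbT e1)) (MM' _ _ (negbT e2)) (MM' _ _ (negbT e3)); ring.
rewrite !sum3D (sum3_rot E) (sum3_rot2 E).
have -> : sum3 E = 2 * ((M u v - M' u v) * \sum_k c u v k * (M u k * M k v)).
  rewrite -[LHS]sum3_rot.
  rewrite /sum3 /E; transitivity (\sum_k (M u v - M' u v) * (2 * (c u v k * (M u k * M k v)))).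
    apply: eq_bigr => k _.
    have /= -> := sum_pair (fun i j => (M u v - M' u v) * (c i j k * (M i k * M k j))) uv.
    rewrite [c v u k]c12 (MS v k) (MS k u).
    by ring.
  by rewrite -!mulr_sumr; ring.
by field.
Qed.

Lemma lin_edge b M M' u v : u != v -> (forall i j, b i j = b j i) ->
  (forall i j, M i j = M j i) -> (forall i j, M' i j = M' j i) ->
  (forall i j, upair i j != upair u v -> M i j = M' i j) ->
  lin b M - lin b M' = (M u v - M' u v) * b u v.
Proof.
move=> uv bS MS M'S MM'; rewrite /lin -mulrBl -sumrB.
transitivity ((\sum_i \sum_j if upair i j == upair u v then b i j * (M i j - M' i j) else 0) / 2).
  congr (_ / 2); apply: eq_bigr => i _; rewrite -sumrB; apply: eq_bigr => j _.
  by case: ifP => [_|/negbT/MM' ->]; ring.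
have /= -> := sum_pair (fun i j => b i j * (M i j - M' i j)) uv.
rewrite (bS v u) (MS v u) (M'S v u).
by field.
Qed.

(** As in [tri_edge]: at most one vertex of a triangle is [u]. This measures the effect of a changed
    degree at [u]; the half appears because each triangle at [u] is met as [(k, l)] and as
    [(l, k)]. *)
Lemma tri_vertex M (r r' : 'I_n -> R) u :
  (forall i j, M i j = M j i) -> (forall i, M i i = 0) ->
  (forall i, i != u -> r i = r' i) ->
  tri (fun i j k => r i * r j * r k) M - tri (fun i j k => r' i * r' j * r' k) M =
  (r u - r' u) * ((\sum_k \sum_l M u k * M k l * M l u * (r k * r l)) / 2).
Proof.
move=> MS M0 rr'.
pose E i j k := if i == u then (r u - r' u) * (M i j * M j k * M k i * (r j * r k)) else 0.
rewrite /tri -mulrBl -sum3B.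
have -> : sum3 (fun i j k => r i * r j * r k * (M i j * M j k * M k i) -
    r' i * r' j * r' k * (M i j * M j k * M k i)) =
  sum3 (fun i j k => E i j k + E j k i + E k i j).
  apply: eq_sum3 => i j k; rewrite /E.
  have [<-|ij] := eqVneq i j; first by rewrite !M0; do 2 case: ifP => _; ring.
  have [<-|jk] := eqVneq j k; first by rewrite !M0; do 2 case: ifP => _; ring.
  have [<-|ik] := eqVneq i k; first by rewrite !M0; do 2 case: ifP => _; ring.
  case: (eqVneq i u) => [e1|iu].
    have ju : j != u by rewrite -e1 eq_sym.
    have ku : k != u by rewrite -e1 eq_sym.
    rewrite (negPf ju) (negPf ku) (rr' j) // (rr' k) // e1; ring.
  case: (eqVneq j u) => [e2|ju].
    have ku : k != u by rewrite -e2 eq_sym.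
    rewrite (negPf ku) (rr' i) // (rr' k) // e2; ring.
  case: (eqVneq k u) => [e3|ku].
    rewrite (rr' i) // (rr' j) // e3; ring.
  rewrite (rr' i) // (rr' j) // (rr' k) //; ring.
rewrite !sum3D (sum3_rot E) (sum3_rot2 E).
have -> : sum3 E = (r u - r' u) * (\sum_k \sum_l M u k * M k l * M l u * (r k * r l)).
  rewrite /sum3 mulr_sumr.
  under eq_bigr => i _.
    rewrite (_ : \sum_j \sum_k E i j k = if i == u then
      \sum_j (r u - r' u) * \sum_k M i j * M j k * M k i * (r j * r k) else 0); last first.
      rewrite /E; case: ifP => _; last by rewrite big1 // => j _; rewrite big1.
      by apply: eq_bigr => j _; rewrite mulr_sumr.
    over.
  by rewrite sum_pred1.
by field.
Qed.
End Tri.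

(** * Normal approximation of cubic edge polynomials *)

Section Model.
Context (R : realFieldType) (n : nat) (mu : 'M[R]_n).
Local Notation cfg := {ffun 'I_n * 'I_n -> bool}.
Implicit Types (o : cfg) (e : 'I_n * 'I_n) (i j k l u v s t : 'I_n).
Implicit Types (b : 'I_n -> 'I_n -> R) (c : 'I_n -> 'I_n -> 'I_n -> R).

(* A configuration has a bit for every ordered pair; only the increasing pairs are read by [adj],
   the other ones have probability 0. *)
Definition pedge e : R := if (e.1 < e.2)%N then mu e.1 e.2 else 0.
Definition adj o i j : bool := (i != j) && o (upair i j).
Definition xedge o i j : R := (adj o i j)%:R - mu i j.
Definition evar i j : R := mu i j * (1 - mu i j).
(** Weighted paths of length two from [u] to [v]: the derivative of the cubic part along the edge
    [uv]. *)
Definition wedge c o u v : R := \sum_k c u v k * (xedge o u k * xedge o k v).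
Definition Upoly b c o : R := lin b (xedge o) + tri c (xedge o).
Local Notation E := (Ex pedge).

Hypothesis muS : forall i j, mu i j = mu j i.
Hypothesis mu0 : forall i, mu i i = 0.

Lemma adjS o i j : adj o i j = adj o j i.
Proof. by rewrite /adj upairC eq_sym. Qed.
Lemma adj0 o i : adj o i i = false.
Proof. by rewrite /adj eqxx. Qed.
Lemma xedgeS o i j : xedge o i j = xedge o j i.
Proof. by rewrite /xedge adjS muS. Qed.
Lemma xedge0 o i : xedge o i i = 0.
Proof. by rewrite /xedge adj0 mu0 subrr. Qed.
Lemma evarS i j : evar i j = evar j i. Proof. by rewrite /evar muS. Qed.
Lemma evar0 i : evar i i = 0. Proof. by rewrite /evar mu0 mul0r. Qed.

Lemma upair_lt i j : i != j -> ((upair i j).1 < (upair i j).2)%N.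
Proof.
by move=> ij; rewrite /upair; case: (ltngtP i j) ij => [||/ord_inj ->] //=; rewrite eqxx.
Qed.
Lemma upair_neq_ord i j e : i != j -> ~~ (e.1 < e.2)%N -> upair i j != e.
Proof. by move=> ij he; apply: contraNneq he => <-; exact: upair_lt. Qed.
Lemma pedge_upair i j : i != j -> pedge (upair i j) = mu i j.
Proof. by move=> ij; rewrite /pedge upair_lt // /upair; case: ifP => //= _; rewrite muS. Qed.
Lemma cent_x o i j : i != j -> cent pedge (upair i j) o = xedge o i j.
Proof. by move=> ij; rewrite /cent pedge_upair // /xedge /adj ij. Qed.
Lemma bvar_upair i j : i != j -> bvar pedge (upair i j) = evar i j.
Proof. by move=> ij; rewrite /bvar pedge_upair. Qed.

Lemma adj_upd o u v (b : bool) i j : u != v ->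
  adj (upd o (upair u v) b) i j = if upair i j == upair u v then b else adj o i j.
Proof.
move=> uv; rewrite /adj ffunE; case: (eqVneq (upair i j)) => // e.
have [ij|//] := eqVneq i j.
by move/eqP: e uv; rewrite upair_eq ij => /orP[] /andP[/eqP <- /eqP <-]; rewrite eqxx.
Qed.
Lemma xedge_upd o u v (b : bool) i j : u != v ->
  xedge (upd o (upair u v) b) i j = if upair i j == upair u v then b%:R - mu u v else xedge o i j.
Proof.
move=> uv; rewrite /xedge adj_upd //; case: (eqVneq (upair i j)) => // /eqP.
by rewrite upair_eq => /orP[] /andP[/eqP -> /eqP ->] //; rewrite muS.
Qed.
Lemma adj_upd_bad o e (b : bool) i j : ~~ (e.1 < e.2)%N -> adj (upd o e b) i j = adj o i j.
Proof.
move=> he; rewrite /adj; have [//|ij] := eqVneq i j.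
by rewrite /= ffunE (negPf (upair_neq_ord ij he)).
Qed.

Lemma sum_edges (F : 'I_n * 'I_n -> R) : (forall e, ~~ (e.1 < e.2)%N -> F e = 0) ->
  \sum_e F e = (\sum_i \sum_j (if i == j then 0 else F (upair i j))) / 2.
Proof.
move=> F0; rewrite -sum_lt2; first last.
- by move=> i; rewrite eqxx.
- by move=> i j; rewrite upairC eq_sym.
rewrite (eq_bigr (fun e => F (e.1, e.2))) => [|[]//].
rewrite -(pair_bigA _ (fun i j => F (i, j))) /=; apply: eq_bigr => i _.
rewrite [RHS]big_mkcond; apply: eq_bigr => j _.
case: ifP => ij; last by rewrite F0 //= ij.
rewrite ifF; first by rewrite /upair ij.
by apply/negP => /eqP e; rewrite e ltnn in ij.
Qed.
Lemma sum_bvar (F : 'I_n * 'I_n -> R) :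
  \sum_e bvar pedge e * F e = (\sum_i \sum_j evar i j * F (upair i j)) / 2.
Proof.
rewrite sum_edges => [|e he]; last by rewrite /bvar /pedge (negPf he) !mul0r.
congr (_ / 2); apply: eq_bigr => i _; apply: eq_bigr => j _.
by have [->|ij] := eqVneq i j; rewrite ?evar0 ?mul0r // bvar_upair.
Qed.

Lemma indep_x u v i j : u != v -> upair i j != upair u v -> indep (upair u v) (fun o => xedge o i j).
Proof. by move=> uv h o b; rewrite xedge_upd // (negPf h). Qed.

Lemma diff_U b c o u v : u != v -> sym3 c -> (forall i j, b i j = b j i) ->
  diff (upair u v) (Upoly b c) o = b u v + wedge c o u v.
Proof.
move=> uv cS bS; rewrite /diff /Upoly.
set o1 := upd o _ true; set o0 := upd o _ false.
have h i j : upair i j != upair u v -> xedge o1 i j = xedge o0 i j.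
  by move=> /negPf ne; rewrite /o1 /o0 !xedge_upd // ne.
have d : xedge o1 u v - xedge o0 u v = 1 by rewrite !xedge_upd // eqxx /=; ring.
have := tri_edge cS uv (xedgeS o1) (xedgeS o0) (xedge0 o1) (xedge0 o0) h.
have := lin_edge uv bS (xedgeS o1) (xedgeS o0) h.
rewrite d !mul1r => e1 e2; rewrite opprD addrACA e1 e2; congr (_ + _).
apply: eq_bigr => k _; congr (_ * _); rewrite /o1 !xedge_upd // !upair_eq eqxx (negPf uv) /= orbF.
have [->|kv] := eqVneq k v; first by rewrite eqxx eq_sym (negPf uv) /= !xedge0 !mulr0.
have [->|ku] := eqVneq k u; first by rewrite eqxx /= !xedge0 !mul0r.
by rewrite ?andbF ?orbF /=.
Qed.

Lemma Upoly_indep_bad b c e : ~~ (e.1 < e.2)%N -> indep e (Upoly b c).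
Proof.
move=> he o t; have h i j : xedge (upd o e t) i j = xedge o i j by rewrite /xedge adj_upd_bad.
rewrite /Upoly /lin /tri; congr (_ / 2 + _ / 6).
  by apply: eq_bigr => i _; apply: eq_bigr => j _; rewrite h.
by apply: eq_sum3 => i j k; rewrite !h.
Qed.

(* Euler's identity: a triangle is counted once for each of its edges, hence [c / 3]. *)
Lemma Upoly_euler b c o : sym3 c -> (forall i j, b i j = b j i) ->
  Upoly b c o = \sum_e cent pedge e o * diff e (Upoly b (fun i j k => c i j k / 3)) o.
Proof.
move=> cS bS.
have c3 : sym3 (fun i j k => c i j k / 3).
  by case: cS => h1 h2; split => i j k; [rewrite h1|rewrite h2].
rewrite sum_edges; last first.
  by move=> e he; rewrite (diff_of_indep _ (Upoly_indep_bad _ _ he)) mulr0.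
rewrite /Upoly /lin /tri.
transitivity ((\sum_i \sum_j (xedge o i j * b i j +
    \sum_k (c i j k * (xedge o i j * xedge o j k * xedge o k i)) / 3)) / 2).
  rewrite (_ : \sum_i \sum_j (_ + _) = \sum_i \sum_j b i j * xedge o i j +
     sum3 (fun i j k => c i j k * (xedge o i j * xedge o j k * xedge o k i)) / 3); first by field.
  rewrite /sum3 mulr_suml -big_split; apply: eq_bigr => i _.
  rewrite mulr_suml -big_split; apply: eq_bigr => j _.
  by rewrite mulr_suml mulrC.
congr (_ / 2); apply: eq_bigr => i _; apply: eq_bigr => j _.
have [<-|ij] := eqVneq i j.
  by rewrite xedge0 mul0r add0r big1 // => k _; ring.
rewrite cent_x // diff_U // mulrDr; congr (_ + _).
rewrite /wedge mulr_sumr; apply: eq_bigr => k _.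
by rewrite (xedgeS o k j) (xedgeS o k i); ring.
Qed.

Context (q C : R).
Hypothesis muq : forall i j, 0 <= mu i j <= q.
Hypothesis q1 : q <= 1.

Lemma mu_ge0 i j : 0 <= mu i j. Proof. by case/andP: (muq i j). Qed.
Lemma mu_leq i j : mu i j <= q. Proof. by case/andP: (muq i j). Qed.
Lemma mu_le1 i j : mu i j <= 1. Proof. exact: le_trans (mu_leq i j) q1. Qed.
Lemma q_ge0 (i : 'I_n) : 0 <= q. Proof. exact: le_trans (mu_ge0 i i) (mu_leq i i). Qed.
Lemma evar_ge0 i j : 0 <= evar i j.
Proof. by rewrite mulr_ge0 ?mu_ge0 // subr_ge0 mu_le1. Qed.
Lemma evar_leq i j : evar i j <= q.
Proof. by apply: le_trans (mu_leq i j); rewrite ler_piMr ?mu_ge0 // gerBl mu_ge0. Qed.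
Lemma pedge01 e : 0 <= pedge e <= 1.
Proof. by rewrite /pedge; case: ifP => _; rewrite ?mu_ge0 ?mu_le1 // lexx ler01. Qed.
Lemma E_ge0 F : (forall o, 0 <= F o) -> 0 <= E F. Proof. exact: (Ex_ge0 pedge01). Qed.
Lemma leE F G : (forall o, F o <= G o) -> E F <= E G. Proof. exact: (le_Ex pedge01). Qed.
Lemma norm_xedge_le o i j : `|xedge o i j| <= 1.
Proof.
by rewrite ler_norml /xedge; have := mu_ge0 i j; have := mu_le1 i j; case: adj => /=; lra.
Qed.
Lemma xedge2_le o i j : xedge o i j ^+ 2 <= 1.
Proof. by rewrite -real_normK ?num_real // expr_le1 // norm_xedge_le. Qed.

Lemma Ex_x i j H : i != j -> indep (upair i j) H -> E (fun o => xedge o i j * H o) = 0.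
Proof.
by move=> ij iH; rewrite -(Ex_cent pedge iH); apply: eq_Ex => o; rewrite cent_x.
Qed.
Lemma Ex_x2 i j H : indep (upair i j) H -> E (fun o => xedge o i j ^+ 2 * H o) = evar i j * E H.
Proof.
move=> iH; have [->|ij] := eqVneq i j.
  by rewrite evar0 mul0r -[RHS](Ex_cst pedge 0); apply: eq_Ex => o; rewrite xedge0 expr0n mul0r.
by rewrite -bvar_upair // -Ex_cent2 //; apply: eq_Ex => o; rewrite cent_x.
Qed.
Lemma Ex_x2_1 i j : E (fun o => xedge o i j ^+ 2) = evar i j.
Proof.
rewrite -[RHS]mulr1 -(Ex1 pedge) -Ex_x2 //; apply: eq_Ex => o; by rewrite mulr1.
Qed.

(** The entries of one row read distinct bits and are independent. With [z = expR (- 1)] this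
    becomes the Laplace transform of a degree. *)
Lemma Ex_prod_adj (z : R) w :
  E (fun o => \prod_j (if adj o w j then z else 1)) = \prod_j (1 - mu w j * (1 - z)).
Proof.
pose s := [seq upair w j | j <- enum (predC1 w)].
have us : uniq s.
  rewrite map_inj_in_uniq ?enum_uniq // => i j; rewrite !mem_enum !inE => iw jw.
  move=> /eqP; rewrite upair_eq eqxx /= => /orP[/eqP //|/andP[/eqP wj /eqP iw']].
  by rewrite iw' eqxx in iw.
rewrite (bigD1 w) //= mu0 mul0r subr0 mul1r.
transitivity (E (fun o => \prod_(e <- s) (if o e then z else 1))).
  apply: eq_Ex => o; rewrite (bigD1 w) //= adj0 mul1r big_map big_enum /=.
  by apply: eq_bigr => j jw; rewrite /adj eq_sym jw.
rewrite (Ex_prod _ (fun b : bool => if b then z else 1)) // big_map big_enum /=.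
apply: eq_bigr => j jw; rewrite pedge_upair 1?eq_sym //; ring.
Qed.

Lemma Ex_S0 c u v : u != v -> E (fun o => wedge c o u v) = 0.
Proof.
move=> uv; rewrite Ex_sum big1 // => k _; rewrite ExZ.
have [->|uk] := eqVneq u k.
  by rewrite (eq_Ex _ (G := fun=> 0)) ?Ex_cst ?mulr0 // => o; rewrite xedge0 mul0r.
rewrite Ex_x ?mulr0 //; apply: indep_x => //.
by upair_simp.
Qed.

(** Paths through different middle vertices are orthogonal, since an edge of one of them does not
    occur in the other and is centred. *)
Lemma Ex_S2 c u v : u != v ->
  E (fun o => wedge c o u v ^+ 2) = \sum_k c u v k ^+ 2 * (evar u k * evar k v).
Proof.
move=> uv.
transitivity (\sum_k \sum_l E (fun o => c u v k * c u v l *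
   (xedge o u k * (xedge o k v * (xedge o u l * xedge o l v))))).
  under eq_bigr do rewrite -Ex_sum; rewrite -Ex_sum; apply: eq_Ex => o.
  rewrite expr2 /wedge mulr_suml; apply: eq_bigr => k _.
  by rewrite mulr_sumr; apply: eq_bigr => l _; ring.
apply: eq_bigr => k _; rewrite (bigD1 k) //= [X in _ + X]big1 ?addr0 => [|l lk].
  rewrite (eq_Ex _ (G := fun o => c u v k ^+ 2 * (xedge o u k ^+ 2 * (xedge o k v ^+ 2)))); last first.
    by move=> o; ring.
  rewrite ExZ; have [->|uk] := eqVneq u k.
    by rewrite evar0 mul0r (eq_Ex _ (G := fun=> 0)) ?Ex_cst // => o; rewrite xedge0 expr0n mul0r.
  rewrite Ex_x2 ?Ex_x2_1 // => o b; rewrite xedge_upd // ifF //.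
  by upair_simp.
rewrite ExZ; have [->|uk] := eqVneq u k.
  by rewrite (eq_Ex _ (G := fun=> 0)) ?Ex_cst ?mulr0 // => o; rewrite xedge0 mul0r.
have [->|ul] := eqVneq u l.
  by rewrite (eq_Ex _ (G := fun=> 0)) ?Ex_cst ?mulr0 // => o; rewrite xedge0 mul0r !mulr0.
rewrite Ex_x ?mulr0 // => o b; rewrite !xedge_upd //.
by rewrite !ifF //; upair_simp.
Qed.

(** Among the paths from [s] to [v] only the one through [t] uses the edge [st]. *)
Lemma diff_wedge c o s t v : s != t -> s != v ->
  diff (upair s t) (fun o => wedge c o s v) o = c s v t * xedge o t v.
Proof.
move=> st sv; rewrite /diff /wedge -sumrB (bigD1 t) //= [X in _ + X]big1 ?addr0 => [|k kt].
  rewrite !xedge_upd // !eqxx; have [->|tv] := eqVneq t v.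
    by rewrite !ifF ?xedge0; [ring|upair_simp..].
  by rewrite !ifF; [rewrite /=; ring|upair_simp..].
rewrite !xedge_upd //; have [->|ks] := eqVneq k s.
  by rewrite (_ : (upair s s == upair s t) = false); [rewrite xedge0; ring|upair_simp].
by rewrite !ifF; [ring|upair_simp..].
Qed.

Lemma wedge_indep c s t u v : s != t -> u != s -> u != t -> v != s -> v != t ->
  indep (upair s t) (fun o => wedge c o u v).
Proof.
move=> st us ut vs vt o b; apply: eq_bigr => k _.
by rewrite !xedge_upd // !ifF //; upair_simp.
Qed.

Lemma wedge_indep_same c u v : u != v -> indep (upair u v) (fun o => wedge c o u v).
Proof.
move=> uv o b; apply: eq_bigr => k _; rewrite !xedge_upd //.
have [->|kv] := eqVneq k v; first by rewrite [upair v v == _]eq_sym ifT ?eqxx // !ifF ?xedge0 ?mulr0 //; upair_simp.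
have [->|ku] := eqVneq k u; first by rewrite ifF ?xedge0 ?mul0r //; upair_simp.
by rewrite !ifF //; upair_simp.
Qed.

Lemma wedgeS c o u v : sym3 c -> wedge c o u v = wedge c o v u.
Proof.
move=> [c12 _]; apply: eq_bigr => k _.
by rewrite c12 (xedgeS o u k) (xedgeS o k v) [xedge o k u * _]mulrC.
Qed.

Lemma Ex_S2_le c u v : u != v -> 0 <= C -> (forall i j k, `|c i j k| <= C) ->
  E (fun o => wedge c o u v ^+ 2) <= n%:R * C ^+ 2 * q ^+ 2.
Proof.
move=> uv C0 cC; rewrite Ex_S2 //.
apply: le_trans (_ : \sum_(k < n) C ^+ 2 * q ^+ 2 <= _); last first.
  by rewrite sumr_const card_ord -[leLHS]mulr_natl mulrA.
apply: ler_sum => k _; apply: ler_pM; first exact: sqr_ge0.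
- by rewrite mulr_ge0 ?evar_ge0.
- by rewrite -real_normK ?num_real // lerXn2r ?nnegrE.
by rewrite expr2 ler_pM ?evar_ge0 ?evar_leq.
Qed.

(** Along [st] the wedge sum is affine with slope [c s v t * xedge o t v], so the derivative of the
    quadratic polynomial contains this slope as a factor. Its square contributes the factor [q]. The
    constants come from the square of a sum of three terms, one of which is [2 * b2 * A o]. *)
Lemma diff_quad_le c s t v (b0 b1 b2 : R) : sym3 c -> s != t -> s != v ->
  0 <= C -> (forall i j k, `|c i j k| <= C) ->
  E (fun o => diff (upair s t) (fun o => b0 + b1 * wedge c o s v + b2 * wedge c o s v ^+ 2) o ^+ 2)
  <= C ^+ 2 * q * (3 * b1 ^+ 2 + 12 * b2 ^+ 2 * E (fun o => wedge c o s v ^+ 2)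
                   + 3 * b2 ^+ 2 * C ^+ 2).
Proof.
move=> cS st sv C0 cC.
set S := fun o => wedge c o s v; set A := avg pedge (upair s t) S.
set g := c s v t.
have Sup o (b : bool) : S (upd o (upair s t) b) = A o + (b%:R - pedge (upair s t)) * (g * xedge o t v).
  rewrite (avg_cent pedge (upair s t) S) avg_indep /cent upd_same; congr (_ + _ * _).
  by rewrite diff_indep /S diff_wedge.
have p0 : 0 <= pedge (upair s t) <= 1 by exact: pedge01.
set pp := pedge (upair s t) in Sup p0.
have dE o : diff (upair s t) (fun o => b0 + b1 * S o + b2 * S o ^+ 2) o =
    g * xedge o t v * (b1 + b2 * (2 * A o + (1 - 2 * pp) * (g * xedge o t v))).
  by rewrite /diff !Sup /=; ring.
have g2 : g ^+ 2 <= C ^+ 2 by rewrite -real_normK ?num_real // lerXn2r ?nnegrE // cC.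
have q0 : 0 <= q by exact: q_ge0 s.
apply: (le_trans (_ : _ <= E (fun o => C ^+ 2 * (3 * b1 ^+ 2 + 3 * b2 ^+ 2 * C ^+ 2) * xedge o t v ^+ 2 +
    12 * b2 ^+ 2 * C ^+ 2 * (xedge o t v ^+ 2 * A o ^+ 2)))).
  apply: leE => o.
  rewrite -/S dE; set y := xedge o t v; have y1 : y ^+ 2 <= 1 by exact: xedge2_le.
  have h : (b1 + b2 * (2 * A o + (1 - 2 * pp) * (g * y))) ^+ 2 <=
      3 * b1 ^+ 2 + 12 * b2 ^+ 2 * A o ^+ 2 + 3 * b2 ^+ 2 * C ^+ 2.
    have h3 (z1 z2 z3 : R) : (z1 + z2 + z3) ^+ 2 <= 3 * z1 ^+ 2 + 3 * z2 ^+ 2 + 3 * z3 ^+ 2.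
      rewrite -subr_ge0 [leRHS](_ : _ = (z1 - z2) ^+ 2 + (z1 - z3) ^+ 2 + (z2 - z3) ^+ 2).
        by rewrite !addr_ge0 ?sqr_ge0.
      by ring.
    rewrite [X in X ^+ 2](_ : _ = b1 + 2 * b2 * A o + b2 * ((1 - 2 * pp) * (g * y))); last by ring.
    apply: le_trans (h3 _ _ _) _; apply: lerD; first by apply: le_of_eq; ring.
    rewrite exprMn mulrA; apply: ler_wpM2l; first by rewrite mulr_ge0 ?sqr_ge0.
    rewrite !exprMn.
    apply: le_trans (_ : 1 * (C ^+ 2 * 1) <= _); last by rewrite mulr1 mul1r.
    apply: ler_pM; first exact: sqr_ge0.
    - by rewrite mulr_ge0 ?sqr_ge0.
    - rewrite -real_normK ?num_real // expr_le1 // ler_norml; case/andP: p0 => ? ?.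
      by apply/andP; split; lra.
    by rewrite ler_pM ?sqr_ge0.
  rewrite exprMn (exprMn _ g y).
  apply: le_trans (_ : C ^+ 2 * y ^+ 2 * _ <= _).
    apply: ler_pM h; [by rewrite mulr_ge0 ?sqr_ge0|exact: sqr_ge0|].
    by apply: ler_wpM2r; first exact: sqr_ge0.
  by apply: le_of_eq; ring.
have -> : E (fun o => C ^+ 2 * (3 * b1 ^+ 2 + 3 * b2 ^+ 2 * C ^+ 2) * xedge o t v ^+ 2 +
    12 * b2 ^+ 2 * C ^+ 2 * (xedge o t v ^+ 2 * A o ^+ 2)) =
    C ^+ 2 * (evar t v * (3 * b1 ^+ 2 + 3 * b2 ^+ 2 * C ^+ 2 + 12 * b2 ^+ 2 * E (fun o => A o ^+ 2))).
  rewrite ExD !ExZ Ex_x2_1.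
  have [->|tv] := eqVneq t v.
    rewrite evar0 (eq_Ex _ (G := fun=> 0)) ?Ex_cst; first by ring.
    by move=> o; rewrite xedge0 expr0n mul0r.
  (* The derivative of [S] along [tv] is a multiple of [xedge o t s], which averages to zero over
     the edge [st]. *)
  have iA : indep (upair t v) A.
    apply: diff0_indep => o; rewrite /A diff_avg; last by upair_simp.
    have d o' : diff (upair t v) S o' = c v s t * xedge o' t s.
      by rewrite upairC -diff_wedge 1?eq_sym //; apply: eq_diff => o1; rewrite /S wedgeS.
    rewrite /avg !d (upairC s t) !xedge_upd 1?eq_sym // eqxx pedge_upair 1?eq_sym //=; ring.
  rewrite Ex_x2; first by ring.
  by move=> o b; rewrite iA.
rewrite mulrA [C ^+ 2 * q * _](_ : _ = C ^+ 2 * q * (3 * b1 ^+ 2 + 3 * b2 ^+ 2 * C ^+ 2 +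
  12 * b2 ^+ 2 * E (fun o => S o ^+ 2))); last by rewrite /S; ring.
have EA : E (fun o => A o ^+ 2) <= E (fun o => S o ^+ 2).
  rewrite (Ex_sq_avg pedge (upair s t) S) lerDl; apply: mulr_ge0.
    exact: (bvar_ge0 pedge01).
  by apply: E_ge0 => o; exact: sqr_ge0.
have EA0 : 0 <= E (fun o => A o ^+ 2) by apply: E_ge0 => o; exact: sqr_ge0.
apply: ler_pM.
- by rewrite mulr_ge0 ?sqr_ge0 ?evar_ge0.
- by nneg.
- by apply: ler_wpM2l; [nneg|exact: evar_leq].
by rewrite lerD2l; apply: ler_wpM2l => //; nneg.
Qed.

(** The summand of [Q]: the derivative of the Euler primitive, with its cubic part divided by 3,
    times the derivative of U. *)
Definition qterm b c o i j : R :=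
  (b i j + wedge c o i j / 3) * (b i j + wedge c o i j).
Definition Qf b c o : R :=
  \sum_e bvar pedge e * (diff e (Upoly b (fun i j k => c i j k / 3)) o * diff e (Upoly b c) o).

Lemma QfE b c o : sym3 c -> (forall i j, b i j = b j i) ->
  Qf b c o = (\sum_i \sum_j evar i j * qterm b c o i j) / 2.
Proof.
move=> cS bS.
have c3 : sym3 (fun i j k => c i j k / 3).
  by case: cS => h1 h2; split => i j k; [rewrite h1|rewrite h2].
rewrite /Qf sum_bvar; congr (_ / 2); apply: eq_bigr => i _; apply: eq_bigr => j _.
have [->|ij] := eqVneq i j; first by rewrite evar0 !mul0r.
rewrite !diff_U // /qterm; congr (_ * ((_ + _) * _)).
by rewrite /wedge mulr_suml; apply: eq_bigr => k _; ring.
Qed.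

Lemma Ex_Q b c : sym3 c -> (forall i j, b i j = b j i) ->
  E (Qf b c) = E (fun o => Upoly b c o ^+ 2).
Proof. by move=> cS bS; apply: Ex_Q_eq => o; exact: Upoly_euler. Qed.

Lemma Ex_qterm b c i j : i != j ->
  E (fun o => qterm b c o i j) = b i j ^+ 2 + (\sum_k c i j k ^+ 2 * (evar i k * evar k j)) / 3.
Proof.
move=> ij; rewrite -Ex_S2 //.
transitivity (E (fun o => b i j ^+ 2 + (4 / 3 * b i j) * wedge c o i j + 3^-1 * wedge c o i j ^+ 2)).
  by apply: eq_Ex => o; rewrite /qterm; field.
by rewrite !ExD !ExZ Ex_cst Ex_S0 //; field.
Qed.

(** Computed as the mean of [Q] rather than by expanding the square of U: then only the first two
    moments of a wedge sum are needed. *)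
Lemma Ex_Upoly2 b c : sym3 c -> (forall i j, b i j = b j i) ->
  E (fun o => Upoly b c o ^+ 2) = (\sum_i \sum_j b i j ^+ 2 * evar i j) / 2
   + sum3 (fun i j k => c i j k ^+ 2 * (evar i j * evar j k * evar k i)) / 6.
Proof.
move=> cS bS; rewrite -Ex_Q // (eq_Ex _ (G := fun o => (\sum_i \sum_j evar i j * qterm b c o i j) / 2)); last first.
  by move=> o; rewrite QfE.
rewrite ExZr Ex_sum.
transitivity ((\sum_i \sum_j (b i j ^+ 2 * evar i j +
   (\sum_k c i j k ^+ 2 * (evar i j * evar j k * evar k i)) / 3)) / 2).
  congr (_ / 2); apply: eq_bigr => i _; rewrite Ex_sum; apply: eq_bigr => j _.
  rewrite ExZ; have [<-|ij] := eqVneq i j.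
    by rewrite evar0 mul0r big1 => [|k _]; ring.
  rewrite Ex_qterm // mulrDr; congr (_ + _); first by rewrite mulrC.
  rewrite mulrA mulr_sumr; congr (_ / 3); apply: eq_bigr => k _.
  by rewrite (evarS k j) (evarS k i); ring.
rewrite (_ : \sum_i \sum_j (_ + _) = \sum_i \sum_j b i j ^+ 2 * evar i j +
   sum3 (fun i j k => c i j k ^+ 2 * (evar i j * evar j k * evar k i)) / 3); first by field.
rewrite /sum3 mulr_suml -big_split; apply: eq_bigr => i _.
by rewrite mulr_suml -big_split.
Qed.

(** * Concentration of [Q] and the error in Stein's identity *)

Section Bounds.
Variables (b : 'I_n -> 'I_n -> R) (c : 'I_n -> 'I_n -> 'I_n -> R) (B : R).
Hypotheses (cS : sym3 c) (bS : forall i j, b i j = b j i).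
Hypotheses (C0 : 0 <= C) (cC : forall i j k, `|c i j k| <= C).
Hypotheses (B0 : 0 <= B) (bB : forall i j, `|b i j| <= B).

Let psi (b1 b2 : R) : R :=
  C ^+ 2 * q * (3 * b1 ^+ 2 + 12 * b2 ^+ 2 * (n%:R * C ^+ 2 * q ^+ 2) + 3 * b2 ^+ 2 * C ^+ 2).

Lemma diff_quad_star s t v (b0 b1 b2 : R) : s != t -> s != v ->
  E (fun o => diff (upair s t) (fun o => b0 + b1 * wedge c o s v + b2 * wedge c o s v ^+ 2) o ^+ 2)
  <= psi b1 b2.
Proof.
move=> st sv; apply: le_trans (diff_quad_le _ _ _ cS st sv C0 cC) _.
apply: ler_wpM2l; first by apply: mulr_ge0; [nneg|exact: q_ge0 s].
rewrite lerD2r lerD2l; apply: ler_wpM2l; first by nneg.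
exact: Ex_S2_le.
Qed.

(** Only edges that meet [u] or [v] have an effect; the integer counts the incidences and is summed
    in [sum_touch]. *)
Lemma diff_quad_all u v i j (b0 b1 b2 : R) : u != v -> i != j ->
  E (fun o => diff (upair i j) (fun o => b0 + b1 * wedge c o u v + b2 * wedge c o u v ^+ 2) o ^+ 2)
  <= ((i == u) + (i == v) + (j == u) + (j == v))%N%:R * psi b1 b2.
Proof.
move=> uv ij.
have p0 : 0 <= psi b1 b2 by have := q_ge0 u; rewrite /psi => q0; nneg.
have key s t v' : s != t -> s != v' -> (forall o, wedge c o u v = wedge c o s v') ->
  E (fun o => diff (upair s t) (fun o => b0 + b1 * wedge c o u v + b2 * wedge c o u v ^+ 2) o ^+ 2)
  <= psi b1 b2.
  move=> st sv h; apply: le_trans (diff_quad_star b0 b1 b2 st sv).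
  by apply: leE => o; rewrite /diff !h.
have one m : psi b1 b2 <= m.+1%:R * psi b1 b2.
  by rewrite -{1}[psi b1 b2]mul1r ler_wpM2r // ler1n.
have [iu|iu] := eqVneq i u.
  by rewrite iu; apply: le_trans (one _); apply: (key _ _ v) => //; rewrite -iu.
have [iv|iv] := eqVneq i v.
  rewrite iv; apply: le_trans (one _); apply: (key _ _ u) => [||o].
  - by rewrite -iv.
  - by rewrite eq_sym.
  by rewrite wedgeS.
have [ju|ju] := eqVneq j u.
  by rewrite ju upairC; apply: le_trans (one _); apply: (key _ _ v) => //; rewrite -ju eq_sym.
have [jv|jv] := eqVneq j v.
  rewrite jv upairC; apply: le_trans (one _); apply: (key _ _ u) => [||o].
  - by rewrite -jv eq_sym.
  - by rewrite eq_sym.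
  by rewrite wedgeS.
rewrite mul0r (eq_Ex _ (G := fun=> 0)) ?Ex_cst // => o.
rewrite diff_of_indep ?expr0n // => o' b'.
by rewrite wedge_indep // eq_sym.
Qed.

Lemma sum_bvar_le (F : 'I_n * 'I_n -> R) (G : 'I_n -> 'I_n -> R) :
  (forall i j, i != j -> F (upair i j) <= G i j) ->
  (forall i j, 0 <= G i j) ->
  \sum_e bvar pedge e * F e <= (\sum_i \sum_j q * G i j) / 2.
Proof.
move=> FG G0; rewrite sum_bvar; apply: ler_wpM2r; first by rewrite invr_ge0.
apply: ler_sum => i _; apply: ler_sum => j _.
have q0 := q_ge0 i.
have [->|ij] := eqVneq i j; first by rewrite evar0 mul0r mulr_ge0.
apply: le_trans (ler_wpM2l (evar_ge0 i j) (FG _ _ ij)) _.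
by apply: ler_wpM2r; [exact: G0|exact: evar_leq].
Qed.

Lemma sum_touch u v (p0 : R) :
  \sum_i \sum_j ((i == u) + (i == v) + (j == u) + (j == v))%N%:R * p0 = 4 * n%:R * p0.
Proof.
have one (w : 'I_n) : \sum_i (i == w)%:R = 1 :> R.
  by rewrite -[RHS](sum_pred1 w (fun=> 1)); apply: eq_bigr => i _; case: eqP.
transitivity (\sum_i \sum_j (((i == u)%:R + (i == v)%:R) + ((j == u)%:R + (j == v)%:R)) * p0).
  by apply: eq_bigr => i _; apply: eq_bigr => j _; rewrite !natrD !addrA.
under eq_bigr do rewrite -mulr_suml big_split /= sumr_const card_ord big_split /= !one.
rewrite -mulr_suml big_split /= sumr_const card_ord sumrMnl big_split /= !one.
by rewrite -[X in X + _]mulr_natl -[X in _ + X]mulr_natl; ring.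
Qed.

(** The fourth moment is the variance of the square, bounded by Efron-Stein, plus the squared second
    moment. The former gives 24 and 6, the latter raises 24 to 25. *)
Lemma Ex_S4_le u v : u != v ->
  E (fun o => wedge c o u v ^+ 4) <= 25 * n%:R ^+ 2 * C ^+ 4 * q ^+ 4 + 6 * n%:R * C ^+ 4 * q ^+ 2.
Proof.
move=> uv; set m2 := E (fun o => wedge c o u v ^+ 2).
have q0 := q_ge0 u.
have m2le : m2 <= n%:R * C ^+ 2 * q ^+ 2 by exact: Ex_S2_le.
have m20 : 0 <= m2 by apply: E_ge0 => o; exact: sqr_ge0.
have -> : E (fun o => wedge c o u v ^+ 4) =
    E (fun o => (0 + 0 * wedge c o u v + 1 * wedge c o u v ^+ 2 - m2) ^+ 2) + m2 ^+ 2.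
  transitivity (E (fun o => (0 + 0 * wedge c o u v + 1 * wedge c o u v ^+ 2 - m2) ^+ 2 +
     2 * m2 * wedge c o u v ^+ 2 - m2 ^+ 2)).
    by apply: eq_Ex => o; ring.
  by rewrite ExB ExD ExZ Ex_cst -/m2; ring.
have mE : m2 = E (fun o => 0 + 0 * wedge c o u v + 1 * wedge c o u v ^+ 2).
  by apply: eq_Ex => o; ring.
rewrite {1}mE; apply: le_trans (lerD (efron_stein pedge01 _) (lexx _)) _.
have h := sum_bvar_le (F := fun e => E (fun o => diff e (fun o => 0 + 0 * wedge c o u v + 1 * wedge c o u v ^+ 2) o ^+ 2))
  (fun i j ij => diff_quad_all 0 0 1 uv ij).
apply: le_trans (lerD (h _) (_ : m2 ^+ 2 <= (n%:R * C ^+ 2 * q ^+ 2) ^+ 2)) _.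
- by move=> i j; rewrite /psi; nneg.
- by rewrite lerXn2r ?nnegrE //; nneg.
under eq_bigr do rewrite -mulr_sumr.
by rewrite -mulr_sumr sum_touch /psi; apply: le_of_eq; field.
Qed.

Let d s t i j o : R := evar i j * diff (upair s t) (fun o => qterm b c o i j) o.

(** Only pairs with exactly one end in [s] or [t] react: the wedge sum between [s] and [t] itself
    does not use the edge [st]. Each such pair occurs in both orders, which cancels the half in
    [QfE]. *)
Lemma diff_Q s t o : s != t ->
  diff (upair s t) (Qf b c) o = \sum_j d s t s j o + \sum_j d s t t j o.
Proof.
move=> st.
have -> : diff (upair s t) (Qf b c) o = (\sum_i \sum_j d s t i j o) / 2.
  rewrite /diff !QfE // -mulrBl -sumrB; congr (_ / 2); apply: eq_bigr => i _.
  by rewrite -sumrB; apply: eq_bigr => j _; rewrite -mulrBr.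
have dS i j : d s t i j o = d s t j i o.
  by rewrite /d evarS; congr (_ * _); apply: eq_diff => o'; rewrite /qterm bS wedgeS.
have d0 i : d s t i i o = 0 by rewrite /d evar0 mul0r.
have dst : d s t s t o = 0.
  rewrite /d diff_of_indep ?mulr0 // => o' b'.
  by rewrite /qterm wedge_indep_same.
have dts : d s t t s o = 0 by rewrite dS.
have dout i j : i != s -> i != t -> j != s -> j != t -> d s t i j o = 0.
  move=> is_ it js jt; rewrite /d diff_of_indep ?mulr0 // => o' b'.
  by rewrite /qterm wedge_indep.
transitivity ((\sum_i \sum_j (((if i == s then d s t s j o else 0) + (if i == t then d s t t j o else 0)) +
   ((if j == s then d s t i s o else 0) + (if j == t then d s t i t o else 0)))) / 2).
  congr (_ / 2); apply: eq_bigr => i _; apply: eq_bigr => j _.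
  have [->|is_] := eqVneq i s.
    rewrite (negPf st) addr0; have [->|js] := eqVneq j s.
      by rewrite (negPf st) d0 !addr0.
    by have [->|jt] := eqVneq j t; rewrite ?dst !addr0.
  have [->|it] := eqVneq i t.
    rewrite add0r; have [->|js] := eqVneq j s; first by rewrite (negPf st) dts !addr0.
    by have [->|jt] := eqVneq j t; rewrite ?d0 !addr0.
  rewrite !add0r; have [->|js] := eqVneq j s; first by rewrite (negPf st) addr0.
  by have [->|jt] := eqVneq j t; rewrite ?add0r // dout.
under eq_bigr do rewrite big_split /= !big_split /= (sum_pred1 s (fun=> _)) (sum_pred1 t (fun=> _)).
rewrite !big_split /=.
have flip w : \sum_i \sum_j (if i == w then d s t w j o else 0) = \sum_j d s t w j o.
  by rewrite exchange_big; apply: eq_bigr => j _; rewrite (sum_pred1 w (fun=> _)).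
have flip2 w : \sum_i d s t i w o = \sum_j d s t w j o by apply: eq_bigr => j _; rewrite dS.
by rewrite !flip !flip2; field.
Qed.

(** With S the wedge sum, [qterm] equals b^2 + (4/3) b S + S^2 / 3, so [diff_quad_star] bounds each
    of the 2n terms of [diff_Q]; Cauchy-Schwarz over the terms costs another factor n. *)
Lemma Ex_diff_Q s t : s != t ->
  E (fun o => diff (upair s t) (Qf b c) o ^+ 2) <=
  4 * n%:R ^+ 2 * q ^+ 3 * C ^+ 2 * (6 * B ^+ 2 + 2 * n%:R * C ^+ 2 * q ^+ 2 + C ^+ 2).
Proof.
move=> st; have q0 := q_ge0 s.
set Z := C ^+ 2 * q * (6 * B ^+ 2 + 2 * n%:R * C ^+ 2 * q ^+ 2 + C ^+ 2).
have Z0 : 0 <= Z by rewrite /Z; nneg.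
have key s' t' j : s' != t' -> E (fun o => d s' t' s' j o ^+ 2) <= q ^+ 2 * Z.
  move=> st'; have [<-|sj] := eqVneq s' j.
    rewrite (eq_Ex _ (G := fun=> 0)) ?Ex_cst; first by nneg.
    by move=> o; rewrite /d evar0 mul0r expr0n.
  rewrite (eq_Ex _ (G := fun o => evar s' j ^+ 2 * diff (upair s' t') (fun o => b s' j ^+ 2 + (4/3 * b s' j) * wedge c o s' j + 3^-1 * wedge c o s' j ^+ 2) o ^+ 2)); last first.
    move=> o; rewrite /d exprMn; congr (_ * _ ^+ 2); apply: eq_diff => o'.
    by rewrite /qterm; field.
  rewrite ExZ; apply: ler_pM; first by nneg.
  - by apply: E_ge0 => o; nneg.
  - by rewrite lerXn2r ?nnegrE ?evar_ge0 ?evar_leq.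
  apply: le_trans (diff_quad_star _ _ _ st' sj) _; rewrite /psi /Z.
  apply: ler_wpM2l; first by nneg.
  have b2 : b s' j ^+ 2 <= B ^+ 2.
    by rewrite -(real_normK (num_real (b s' j))) lerXn2r ?nnegrE.
  have := sqr_ge0 C; set C2 := C ^+ 2 => C20.
  have : 0 <= n%:R * C2 * q ^+ 2 by nneg.
  rewrite [2 * n%:R * C2 * _](_ : _ = 2 * (n%:R * C2 * q ^+ 2)); last by ring.
  set w := n%:R * C2 * _ => w0.
  rewrite (_ : 3 * (4 / 3 * b s' j) ^+ 2 = 16 / 3 * b s' j ^+ 2); last by field.
  rewrite (_ : 12 * 3^-1 ^+ 2 * w = 4/3 * w); last by field.
  rewrite (_ : 3 * 3^-1 ^+ 2 * C2 = C2 / 3); last by field.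
  by have := sqr_ge0 (b s' j); lra.
apply: (le_trans (_ : _ <= E (fun o => 2 * n%:R * (\sum_j d s t s j o ^+ 2) + 2 * n%:R * (\sum_j d s t t j o ^+ 2)))).
  apply: leE => o; rewrite diff_Q //.
  apply: le_trans (_ : 2 * (\sum_j d s t s j o) ^+ 2 + 2 * (\sum_j d s t t j o) ^+ 2 <= _).
    rewrite -subr_ge0 [leRHS](_ : _ = (\sum_j d s t s j o - \sum_j d s t t j o) ^+ 2); last by ring.
    exact: sqr_ge0.
  by apply: lerD; rewrite -mulrA; apply: ler_wpM2l => //; exact: sqr_sum_le.
rewrite ExD !ExZ !Ex_sum.
have k1 : \sum_j E (fun o => d s t s j o ^+ 2) <= n%:R * (q ^+ 2 * Z).
  rewrite mulr_natl -[in leRHS](card_ord n) -sumr_const; apply: ler_sum => j _; exact: key.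
have k2 : \sum_j E (fun o => d s t t j o ^+ 2) <= n%:R * (q ^+ 2 * Z).
  rewrite mulr_natl -[in leRHS](card_ord n) -sumr_const; apply: ler_sum => j _.
  apply: le_trans (key t s j _); last by rewrite eq_sym.
  by apply: leE => o; rewrite /d upairC.
apply: le_trans (lerD (ler_wpM2l _ k1) (ler_wpM2l _ k2)) _; [by nneg|by nneg|].
by apply: le_of_eq; rewrite /Z; ring.
Qed.

Lemma var_Q_le : E (fun o => (Qf b c o - E (Qf b c)) ^+ 2) <=
  2 * n%:R ^+ 4 * q ^+ 4 * C ^+ 2 * (6 * B ^+ 2 + 2 * n%:R * C ^+ 2 * q ^+ 2 + C ^+ 2).
Proof.
apply: le_trans (efron_stein pedge01 _) _.
apply: le_trans (sum_bvar_le (fun i j ij => Ex_diff_Q ij) _) _.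
  by move=> i _; have := q_ge0 i => q0; nneg.
by rewrite !sum_cst; apply: le_of_eq; field.
Qed.

(** With g and h the two derivatives, |g| h^2 <= lam h^2 + g^2 h^2 / lam. The first part is at most
    [3 * lam] times the summand of [E (Qf b c)], the 3 undoing the third in [qterm]; the second part
    is a fourth moment. *)
Lemma stein_err_le (lam : R) : 0 < lam ->
  \sum_e bvar pedge e * E (fun o => `|diff e (Upoly b (fun i j k => c i j k / 3)) o| * diff e (Upoly b c) o ^+ 2)
  <= 3 * lam * E (Qf b c) + lam^-1 * (8 * B ^+ 2 * E (Qf b c)
     + 100 * n%:R ^+ 4 * C ^+ 4 * q ^+ 5 + 24 * n%:R ^+ 3 * C ^+ 4 * q ^+ 3).
Proof.
move=> lam0; have l0 := ltW lam0.
have c3 : sym3 (fun i j k => c i j k / 3).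
  by case: cS => h1 h2; split => i j k; [rewrite h1|rewrite h2].
set M4 := 25 * n%:R ^+ 2 * C ^+ 4 * q ^+ 4 + 6 * n%:R * C ^+ 4 * q ^+ 2.
have QE : E (Qf b c) = (\sum_i \sum_j evar i j * E (fun o => qterm b c o i j)) / 2.
  rewrite (eq_Ex _ (G := fun o => (\sum_i \sum_j evar i j * qterm b c o i j) / 2)); last by move=> o; rewrite QfE.
  rewrite ExZr Ex_sum; congr (_ / 2); apply: eq_bigr => i _.
  by rewrite Ex_sum; apply: eq_bigr => j _; rewrite ExZ.
set ka := 3 * lam + lam^-1 * (8 * B ^+ 2).
have -> : 3 * lam * E (Qf b c) + lam^-1 * (8 * B ^+ 2 * E (Qf b c)
     + 100 * n%:R ^+ 4 * C ^+ 4 * q ^+ 5 + 24 * n%:R ^+ 3 * C ^+ 4 * q ^+ 3) =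
   (\sum_i \sum_j (ka * (evar i j * E (fun o => qterm b c o i j)) + q * (lam^-1 * (8 * M4)))) / 2.
  transitivity ((ka * (\sum_i \sum_j evar i j * E (fun o => qterm b c o i j)) +
     \sum_(i < n) \sum_(j < n) q * (lam^-1 * (8 * M4))) / 2).
    by rewrite !sum_cst QE /M4 /ka; field; exact: lt0r_neq0.
  congr (_ / 2); rewrite mulr_sumr -big_split; apply: eq_bigr => i _.
  by rewrite mulr_sumr -big_split.
rewrite sum_bvar; apply: ler_wpM2r; first by rewrite invr_ge0.
apply: ler_sum => i _; apply: ler_sum => j _.
have q0 := q_ge0 i.
have M0 : 0 <= lam^-1 * (8 * M4) by rewrite /M4; nneg.
have [<-|ij] := eqVneq i j.
  by rewrite evar0 !mul0r mulr0 add0r mulr_ge0.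
apply: le_trans (_ : evar i j * (ka * E (fun o => qterm b c o i j) + lam^-1 * (8 * M4)) <= _); last first.
  rewrite mulrDr; apply: lerD; first by apply: le_of_eq; ring.
  by apply: ler_wpM2r => //; exact: evar_leq.
apply: ler_wpM2l; first exact: evar_ge0.
set S := fun o => wedge c o i j; set y := b i j.
have m20 : 0 <= E (fun o => S o ^+ 2) by apply: E_ge0 => o; nneg.
have Eq : E (fun o => qterm b c o i j) = y ^+ 2 + E (fun o => S o ^+ 2) / 3.
  by rewrite Ex_qterm // -Ex_S2.
have EP : E (fun o => lam * (y + S o) ^+ 2 + lam^-1 * (8 * y ^+ 4 + 8 * S o ^+ 4)) =
    lam * (y ^+ 2 + E (fun o => S o ^+ 2)) + lam^-1 * (8 * y ^+ 4 + 8 * E (fun o => S o ^+ 4)).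
  rewrite ExD !ExZ ExD ExZ !Ex_cst.
  rewrite (eq_Ex _ (G := fun o => y ^+ 2 + 2 * y * S o + S o ^+ 2)); last by move=> o; ring.
  by rewrite !ExD !ExZ !Ex_cst Ex_S0 //; ring.
apply: (le_trans (_ : _ <= E (fun o => lam * (y + S o) ^+ 2 + lam^-1 * (8 * y ^+ 4 + 8 * S o ^+ 4)))).
  apply: leE => o; rewrite !diff_U //.
  rewrite (_ : wedge _ o i j = S o / 3); last by rewrite /S /wedge mulr_suml; apply: eq_bigr => k _; ring.
  rewrite -/y -/(S o); set g := y + S o / 3; set h := y + S o.
  (* Both 2 y^2 + 2 S^2 - g h and 2 y^2 + 2 S^2 + g h are sums of squares, which bounds |g h|. *)
  have gh : g ^+ 2 * h ^+ 2 <= 8 * y ^+ 4 + 8 * S o ^+ 4.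
    rewrite -exprMn -(real_normK (num_real (g * h))).
    apply: le_trans (_ : (2 * y ^+ 2 + 2 * S o ^+ 2) ^+ 2 <= _).
      rewrite lerXn2r ?nnegrE //; first by nneg.
      have e1 : 2 * y ^+ 2 + 2 * S o ^+ 2 - g * h = (y - 2 / 3 * S o) ^+ 2 + 11 / 9 * S o ^+ 2.
        by rewrite /g /h; field.
      have e2 : 2 * y ^+ 2 + 2 * S o ^+ 2 + g * h = (y + 2 / 3 * S o) ^+ 2 + 2 * y ^+ 2 + 17 / 9 * S o ^+ 2.
        by rewrite /g /h; field.
      rewrite ler_norml; apply/andP; split.
        by rewrite lerNl -subr_ge0 opprK e2; nneg.
      by rewrite -subr_ge0 e1; nneg.
    rewrite -subr_ge0 [leRHS](_ : _ = 4 * (y ^+ 2 - S o ^+ 2) ^+ 2); last by ring.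
    by nneg.
  have ag : `|g| <= lam + lam^-1 * g ^+ 2.
    have := sqr_ge0 (`|g| - lam); rewrite sqrrB real_normK ?num_real // => z.
    rewrite -(ler_pM2l lam0) mulrDr mulrA divff ?lt0r_neq0 // mul1r.
    have : 0 <= `|g| * lam by rewrite mulr_ge0.
    by move: z; rewrite -mulr_natr expr2; set w := `|g|; set z2 := g ^+ 2; lra.
  apply: le_trans (ler_wpM2r (sqr_ge0 h) ag) _; rewrite mulrDl lerD2l -mulrA.
  by apply: ler_wpM2l => //; rewrite invr_ge0.
rewrite EP Eq /ka.
have y2 : y ^+ 2 <= B ^+ 2.
  by rewrite -(real_normK (num_real y)) lerXn2r ?nnegrE // bB.
have li0 : 0 <= lam^-1 by rewrite invr_ge0.
have M4le : E (fun o => S o ^+ 4) <= M4 by exact: Ex_S4_le.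
have t1 : lam * (y ^+ 2 + E (fun o => S o ^+ 2)) <= 3 * lam * (y ^+ 2 + E (fun o => S o ^+ 2) / 3).
  rewrite [3 * lam]mulrC -[leRHS]mulrA; apply: ler_wpM2l => //.
  by have := sqr_ge0 y; lra.
have t2 : 8 * y ^+ 4 <= 8 * B ^+ 2 * (y ^+ 2 + E (fun o => S o ^+ 2) / 3).
  rewrite -[leRHS]mulrA; apply: ler_wpM2l => //.
  rewrite (_ : y ^+ 4 = y ^+ 2 * y ^+ 2); last by ring.
  by apply: ler_pM; [nneg|nneg|by []|rewrite lerDl; nneg].
have t3 : 8 * E (fun o => S o ^+ 4) <= 8 * M4 by apply: ler_wpM2l.
apply: le_trans (lerD t1 (ler_wpM2l li0 (lerD t2 t3))) _.
by apply: le_of_eq; ring.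
Qed.

Theorem stein_Upoly (f f' : R -> R) (K lam : R) : 0 < lam ->
  E (fun o => Upoly b c o ^+ 2) = 1 ->
  (forall s t : R, `|f s - f t - f' t * (s - t)| <= K * (s - t) ^+ 2) ->
  (forall s t : R, `|f' s - f' t| <= K * `|s - t|) ->
  (forall s : R, `|f' s| <= K) ->
  `|E (fun o => Upoly b c o * f (Upoly b c o)) - E (fun o => f' (Upoly b c o))| <=
  K * (8 * lam + lam^-1 * (16 * B ^+ 2
     + 200 * n%:R ^+ 4 * C ^+ 4 * q ^+ 5 + 48 * n%:R ^+ 3 * C ^+ 4 * q ^+ 3
   + 2 * n%:R ^+ 4 * q ^+ 4 * C ^+ 2 * (6 * B ^+ 2 + 2 * n%:R * C ^+ 2 * q ^+ 2 + C ^+ 2))).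
Proof.
move=> lam0 X1 taylor lip bnd; have l0 := ltW lam0.
have K0 : 0 <= K by apply: le_trans (bnd 0).
have EQ : E (Qf b c) = 1 by rewrite Ex_Q.
have h1 := stein_cube pedge01 (fun o => Upoly_euler o cS bS) taylor lip.
have := stein_err_le lam0; rewrite EQ !mulr1 => h2.
have := var_Q_le; rewrite EQ => h3.
set V := 2 * n%:R ^+ 4 * _ * _ * _ in h3 *.
have h4 : `|E (fun o => Qf b c o * f' (Upoly b c o)) - E (fun o => f' (Upoly b c o))|
    <= K * (lam + lam^-1 * V).
  rewrite -ExB; apply: le_trans (norm_Ex pedge01 _) _.
  apply: le_trans (_ : E (fun o => K * (lam + lam^-1 * (Qf b c o - 1) ^+ 2)) <= _); last first.
    rewrite ExZ ExD Ex_cst ExZ; apply: ler_wpM2l => //; rewrite lerD2l.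
    by apply: ler_wpM2l => //; rewrite invr_ge0.
  apply: leE => o; rewrite -{2}[f' _]mul1r -mulrBl normrM mulrC.
  apply: ler_pM => //; set g := Qf b c o - 1.
  have := sqr_ge0 (`|g| - lam); rewrite sqrrB real_normK ?num_real // => z.
  rewrite -(ler_pM2l lam0) mulrDr mulrA divff ?lt0r_neq0 // mul1r.
  have : 0 <= `|g| * lam by rewrite mulr_ge0.
  by move: z; rewrite -mulr_natr expr2; set w := `|g|; set z2 := g ^+ 2; lra.
apply: le_trans (ler_distD (E (fun o => Qf b c o * f' (Upoly b c o))) _ _) _.
apply: le_trans (lerD (le_trans h1 (ler_wpM2l _ h2)) h4) _; first by nneg.
(* The errors add up to [7 * lam]; the 8 in the statement leaves [K * lam] to spare. *)
rewrite -subr_ge0 [leRHS](_ : _ = K * lam); first by nneg.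
by ring.
Qed.
End Bounds.
End Model.

(** * The remainder of the weighted triangle count *)

Section Rem.
Context (R : realFieldType) (n : nat) (mu : 'M[R]_n).
Local Notation cfg := {ffun 'I_n * 'I_n -> bool}.
Implicit Types (o : cfg) (e : 'I_n * 'I_n) (i j k l u v w s t : 'I_n).

Definition edge o i j : R := (adj o i j)%:R.
Definition deg o i : R := \sum_j edge o i j.
Definition row_mu i : R := \sum_j mu i j.
Definition rinv i : R := (row_mu i)^-1.
Definition tcoef i j k : R := rinv i * rinv j * rinv k.
(* [eta] and [gamma], summed over all indices since the additional terms vanish. *)
Definition eta_sum i : R := \sum_k \sum_l mu i k * mu k l * mu l i * (rinv i ^+ 2 * rinv k * rinv l).
Definition gamma_sum i j : R := \sum_k mu i k * mu k j * tcoef i j k.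
Definition ecoef i j : R := gamma_sum i j - (eta_sum i + eta_sum j) / 2.
Definition tstat o : R := tri (fun i j k => (deg o i)^-1 * (deg o j)^-1 * (deg o k)^-1) (edge o).
Definition dev o i : R := \sum_j xedge mu o i j.
(** Triangles at [w], each counted twice and weighted without the factor for [w], since that is the
    factor which varies. *)
Definition tri_at o w : R := \sum_k \sum_l edge o w k * edge o k l * edge o l w * ((deg o k)^-1 * (deg o l)^-1).
Local Notation E := (Ex (pedge mu)).

Hypothesis muS : forall i j, mu i j = mu j i.
Hypothesis mu0 : forall i, mu i i = 0.

Lemma edgeS o i j : edge o i j = edge o j i. Proof. by rewrite /edge adjS. Qed.
Lemma edge0 o i : edge o i i = 0. Proof. by rewrite /edge adj0. Qed.
Lemma edge_upd o u v (b : bool) i j : u != v ->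
  edge (upd o (upair u v) b) i j = if upair i j == upair u v then b%:R else edge o i j.
Proof. by move=> uv; rewrite /edge adj_upd //; case: ifP. Qed.
Lemma edgeE o i j : edge o i j = mu i j + xedge mu o i j.
Proof. by rewrite /xedge addrC subrK. Qed.
Lemma degE o i : deg o i = row_mu i + dev o i.
Proof. by rewrite /deg /row_mu /dev -big_split; apply: eq_bigr => j _; rewrite edgeE. Qed.

Lemma diff_tri c u v o : u != v -> sym3 c ->
  diff (upair u v) (fun o => tri c (edge o)) o = \sum_k c u v k * (edge o u k * edge o k v).
Proof.
move=> uv cS; rewrite /diff.
set o1 := upd o _ true; set o0 := upd o _ false.
have h i j : upair i j != upair u v -> edge o1 i j = edge o0 i j.
  by move=> /negPf ne; rewrite /o1 /o0 !edge_upd // ne.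
rewrite (tri_edge cS uv (edgeS o1) (edgeS o0) (edge0 o1) (edge0 o0) h).
rewrite !edge_upd // eqxx subr0 mul1r; apply: eq_bigr => k _; congr (_ * _).
have [->|kv] := eqVneq k v; first by rewrite !edge0 !mulr0.
have [->|ku] := eqVneq k u; first by rewrite !edge0 !mul0r.
by rewrite !edge_upd // !ifF //; upair_simp.
Qed.

Lemma deg_upd o u v i : u != v -> adj o u v = false ->
  deg (upd o (upair u v) true) i = deg o i + ((i == u) + (i == v))%N%:R.
Proof.
move=> uv auv; rewrite /deg natrD.
have one (w : 'I_n) : (i == w)%:R = \sum_j (if j == w then (i == w)%:R else 0) :> R.
  by rewrite sum_pred1.
rewrite -(sum_pred1 v (fun=> (i == u)%:R)) -(sum_pred1 u (fun=> (i == v)%:R)) -!big_split.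
apply: eq_bigr => j _ /=; rewrite edge_upd // upair_eq.
have [->|iu] := eqVneq i u.
  rewrite (negPf uv); have [->|jv] := eqVneq j v.
    by rewrite /= /edge auv add0r if_same addr0.
  by rewrite /= if_same !addr0.
have [->|iv] := eqVneq i v.
  have [->|ju] := eqVneq j u.
    by rewrite /= /edge adjS auv if_same !add0r.
  by rewrite /= if_same !addr0.
by rewrite /= !if_same !addr0.
Qed.

(** The edge is inserted first with the new degrees, then the degree of [v] and last that of [u] is
    changed back. As [uv] is absent from [o], no triangle of [o] contains both ends, so the two
    degree corrections do not interact. *)
Lemma diff_T u v o : u != v -> adj o u v = false ->
  diff (upair u v) tstat o =
  (deg o u + 1)^-1 * (deg o v + 1)^-1 * (\sum_k edge o u k * edge o k v * (deg o k)^-1)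
  - ((deg o u)^-1 - (deg o u + 1)^-1) * (tri_at o u / 2)
  - ((deg o v)^-1 - (deg o v + 1)^-1) * (tri_at o v / 2).
Proof.
move=> uv auv; rewrite /diff.
have -> : upd o (upair u v) false = o.
  by apply: upd_idP; move: auv; rewrite /adj uv.
have auvR : edge o u v = 0 by rewrite /edge auv.
have avuR : edge o v u = 0 by rewrite edgeS.
set o1 := upd o _ true.
pose r i := (deg o i)^-1; pose r1 i := (deg o1 i)^-1.
(* The intermediate weights: already the old one at [v], still the new one at [u]. *)
pose r2 i := if i == v then r v else r1 i.
have rr1 i : i != u -> i != v -> r1 i = r i.
  by move=> /negPf iu /negPf iv; rewrite /r1 /o1 deg_upd // iu iv addr0.
have r1u : r1 u = (deg o u + 1)^-1 by rewrite /r1 deg_upd // eqxx (negPf uv).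
have r1v : r1 v = (deg o v + 1)^-1 by rewrite /r1 deg_upd // eqxx eq_sym (negPf uv).
have s3 (x : 'I_n -> R) : sym3 (fun i j k => x i * x j * x k) by split=> i j k; ring.
have h i j : upair i j != upair u v -> edge o1 i j = edge o i j.
  by move=> /negPf ne; rewrite /o1 edge_upd // ne.
have t1 : tstat o1 - tri (fun i j k => r1 i * r1 j * r1 k) (edge o) =
   r1 u * r1 v * \sum_k edge o u k * edge o k v * r k.
  rewrite /tstat -/r1 (tri_edge (s3 r1) uv (edgeS o1) (edgeS o) (edge0 o1) (edge0 o) h).
  rewrite edge_upd // eqxx auvR subr0 mul1r mulr_sumr; apply: eq_bigr => k _.
  have [->|kv] := eqVneq k v; first by rewrite !edge0 !(mulr0, mul0r).
  have [->|ku] := eqVneq k u; first by rewrite !edge0 !(mulr0, mul0r).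
  by rewrite !h; [rewrite (rr1 k) //; ring|upair_simp..].
have t2 : tri (fun i j k => r1 i * r1 j * r1 k) (edge o) - tri (fun i j k => r2 i * r2 j * r2 k) (edge o)
   = (r1 v - r v) * (tri_at o v / 2).
  rewrite (tri_vertex (r := r1) (r' := r2) (u := v) (edgeS o) (edge0 o)); last first.
    by move=> i /negPf iv; rewrite /r2 iv.
  rewrite {1}/r2 eqxx; congr (_ * (_ / 2)); apply: eq_bigr => k _; apply: eq_bigr => l _.
  have [->|kv] := eqVneq k v; first by rewrite edge0 !mul0r.
  have [->|ku] := eqVneq k u; first by rewrite avuR !mul0r.
  have [->|lv] := eqVneq l v; first by rewrite edge0 mulr0 !mul0r.
  have [->|lu] := eqVneq l u; first by rewrite auvR mulr0 !mul0r.
  by rewrite (rr1 k) ?(rr1 l).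
have t3 : tri (fun i j k => r2 i * r2 j * r2 k) (edge o) - tstat o
   = (r1 u - r u) * (tri_at o u / 2).
  rewrite /tstat -/r (tri_vertex (r := r2) (r' := r) (u := u) (edgeS o) (edge0 o)); last first.
    by move=> i iu; rewrite /r2; case: eqVneq => [->//|iv]; rewrite rr1.
  rewrite {1}/r2 (negPf uv); congr (_ * (_ / 2)); apply: eq_bigr => k _; apply: eq_bigr => l _.
  have [->|kv] := eqVneq k v; first by rewrite auvR !mul0r.
  have [->|ku] := eqVneq k u; first by rewrite edge0 !mul0r.
  have [->|lv] := eqVneq l v; first by rewrite avuR mulr0 !mul0r.
  have [->|lu] := eqVneq l u; first by rewrite edge0 mulr0 !mul0r.
  by rewrite /r2 (negPf kv) (negPf lv) (rr1 k) ?(rr1 l).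
rewrite -r1u -r1v -/(r u) -/(r v).
have -> : \sum_k edge o u k * edge o k v * (deg o k)^-1 = \sum_k edge o u k * edge o k v * r k by [].
by rewrite -t1 -[_ - (r u - _) * _]addrA; move: t2 t3; lra.
Qed.

Context (q L : R).
Hypothesis muq : forall i j, 0 <= mu i j <= q.
Hypothesis q1 : q <= 1.
Hypothesis row_gt0 : forall i, 0 < row_mu i.
Hypothesis riL : forall i, 4 * rinv i <= L.

(* The four errors in [diff_R_le]. Adding the edge [uv] creates triangles and raises the degrees of [u] and [v].
   For the created triangles, [err1] is the error from replacing degrees by their means and [err2] the part of
   the centred codegree that is linear in the edges; [err3] and [err4] are, for the loss at an endpoint, the
   error from replacing degrees and the fluctuation of the number of triangles at that endpoint. *)
Definition err1 o u v : R :=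
  L ^+ 4 * \sum_k edge o u k * edge o k v * (`|dev o u| + `|dev o v| + `|dev o k| + 2).
Definition err2 o u v : R :=
  \sum_k tcoef u v k * (mu u k * xedge mu o k v + xedge mu o u k * mu k v).
Definition err3 o w : R :=
  L ^+ 5 * \sum_k \sum_l edge o w k * edge o k l * edge o l w *
     (2 * `|dev o w| + `|dev o k| + `|dev o l| + 1).
Definition err4 o w : R :=
  \sum_k \sum_l rinv w ^+ 2 * rinv k * rinv l *
    (edge o w k * edge o k l * edge o l w - mu w k * mu k l * mu l w).

Lemma rinv_ge0 i : 0 <= rinv i. Proof. by rewrite invr_ge0 ltW. Qed.
Lemma rinv_le i : rinv i <= L.
Proof. by apply: le_trans (riL i); have := rinv_ge0 i; lra. Qed.
Lemma edge_ge0 o i j : 0 <= edge o i j. Proof. exact: ler0n. Qed.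

Lemma inv_diff_le (x y : R) : 0 < x -> 0 < y -> x^-1 <= L -> y^-1 <= L ->
  `|x^-1 - y^-1| <= L ^+ 2 * `|x - y|.
Proof.
move=> x0 y0 xL yL.
have -> : x^-1 - y^-1 = x^-1 * y^-1 * (y - x) by field; rewrite !gt_eqF.
have xi : 0 <= x^-1 by rewrite invr_ge0 ltW.
have yi : 0 <= y^-1 by rewrite invr_ge0 ltW.
rewrite normrM distrC ger0_norm ?mulr_ge0 //; apply: ler_wpM2r => //.
by rewrite expr2 ler_pM.
Qed.

Lemma prod_diff_le (x y x' y' A B : R) : 0 <= y -> y <= B -> 0 <= x' -> x' <= A ->
  `|x * y - x' * y'| <= B * `|x - x'| + A * `|y - y'|.
Proof.
move=> y0 yB x0 xA.
have -> : x * y - x' * y' = (x - x') * y + x' * (y - y') by ring.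
apply: le_trans (ler_normD _ _) _; rewrite !normrM (ger0_norm y0) (ger0_norm x0).
by rewrite [B * _]mulrC; apply: lerD; [apply: ler_wpM2l|apply: ler_wpM2r].
Qed.

Lemma prod3_diff_le (x y z x' y' z' : R) :
  0 <= x <= L -> 0 <= y <= L -> 0 <= z <= L ->
  0 <= x' <= L -> 0 <= y' <= L -> 0 <= z' <= L ->
  `|x * y * z - x' * y' * z'| <= L ^+ 2 * (`|x - x'| + `|y - y'| + `|z - z'|).
Proof.
move=> /andP[x0 xL] /andP[y0 yL] /andP[z0 zL] /andP[x0' xL'] /andP[y0' yL'] /andP[z0' zL'].
have L0 : 0 <= L by exact: le_trans xL.
apply: le_trans (@prod_diff_le _ _ _ _ (L ^+ 2) L _ _ _ _) _ => //.
- by rewrite mulr_ge0.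
- by rewrite expr2 ler_pM.
rewrite [leRHS](_ : _ = L * (L * `|x - x'| + L * `|y - y'|) + L ^+ 2 * `|z - z'|); last by ring.
by rewrite lerD2r; apply: ler_wpM2l => //; exact: prod_diff_le.
Qed.

Lemma prod4_diff_le (x y z t x' y' z' t' : R) :
  0 <= x <= L -> 0 <= y <= L -> 0 <= z <= L -> 0 <= t <= L ->
  0 <= x' <= L -> 0 <= y' <= L -> 0 <= z' <= L -> 0 <= t' <= L ->
  `|x * y * z * t - x' * y' * z' * t'|
  <= L ^+ 3 * (`|x - x'| + `|y - y'| + `|z - z'| + `|t - t'|).
Proof.
move=> hx hy hz /andP[t0 tL] hx' hy' hz' /andP[t0' tL'].
have L0 : 0 <= L by exact: le_trans tL.
apply: le_trans (@prod_diff_le _ _ _ _ (L ^+ 3) L _ _ _ _) _ => //.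
- case/andP: hx' => ? ?; case/andP: hy' => ? ?; case/andP: hz' => ? ?.
  by rewrite !mulr_ge0.
- case/andP: hx' => ? ?; case/andP: hy' => ? ?; case/andP: hz' => ? ?.
  by rewrite !exprS expr0 mulr1 mulrA !ler_pM ?mulr_ge0.
rewrite [leRHS](_ : _ = L * (L ^+ 2 * (`|x - x'| + `|y - y'| + `|z - z'|)) + L ^+ 3 * `|t - t'|); last by ring.
by rewrite lerD2r; apply: ler_wpM2l => //; exact: prod3_diff_le.
Qed.

(** The quarter matches the 4 in [riL]: on this event [L] bounds the inverse degrees as well as the
    inverse means. *)
Definition good o := [forall w, row_mu w / 4 <= deg o w].

Lemma good_deg o w : good o -> 0 < deg o w /\ (deg o w)^-1 <= L.
Proof.
move=> /forallP/(_ w) h; have r4 : 0 < row_mu w / 4 by rewrite divr_gt0.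
have d0 : 0 < deg o w by exact: lt_le_trans h.
split => //; apply: le_trans (riL w).
rewrite (_ : 4 * rinv w = (row_mu w / 4)^-1); last by rewrite invfM invrK mulrC.
by rewrite lef_pV2 ?posrE.
Qed.

(** In the codegree, (mu + x)(mu + x) splits into [gamma_sum], the linear part [err2] and [wedge].
    In the loss at an endpoint, 1/d - 1/(d + 1) = 1/(d (d + 1)) is close to [rinv w ^+ 2], which
    leads to [eta_sum]. *)
Lemma diff_R_le u v o : u != v -> adj o u v = false -> good o ->
  `|diff (upair u v) tstat o - ecoef u v - wedge mu tcoef o u v| <=
  err1 o u v + `|err2 o u v| + (err3 o u + err3 o v) / 2 + (`|err4 o u| + `|err4 o v|) / 2.
Proof.
move=> uv auv go; rewrite diff_T //.
set Y := _ * \sum_k _.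
have L0 : 0 <= L by apply: le_trans (rinv_ge0 u) (rinv_le u).
have HY : `|Y - gamma_sum u v - wedge mu tcoef o u v| <= err1 o u v + `|err2 o u v|.
  pose z k := (deg o u + 1)^-1 * (deg o v + 1)^-1 * (deg o k)^-1 - tcoef u v k.
  have -> : Y - gamma_sum u v - wedge mu tcoef o u v =
     \sum_k edge o u k * edge o k v * z k + err2 o u v.
    rewrite /Y /gamma_sum /wedge /err2 mulr_sumr -!sumrB -big_split; apply: eq_bigr => k _.
    by rewrite /z /tcoef !edgeE /=; ring.
  apply: le_trans (ler_normD _ _) _; rewrite lerD2r /err1 mulr_sumr.
  apply: le_trans (ler_norm_sum _ _ _) _; apply: ler_sum => k _.
  have A0 : 0 <= edge o u k * edge o k v by rewrite mulr_ge0 ?edge_ge0.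
  rewrite normrM (ger0_norm A0) mulrCA; apply: ler_wpM2l => //.
  have [du0 duL] := good_deg u go; have [dv0 dvL] := good_deg v go.
  have [dk0 dkL] := good_deg k go.
  have du1 : (deg o u + 1)^-1 <= L.
    by apply: le_trans duL; rewrite lef_pV2 ?posrE ?lerDl // addr_gt0.
  have dv1 : (deg o v + 1)^-1 <= L.
    by apply: le_trans dvL; rewrite lef_pV2 ?posrE ?lerDl // addr_gt0.
  apply: le_trans (prod3_diff_le _ _ _ _ _ _) _.
  1-6: by rewrite ?rinv_ge0 ?rinv_le ?invr_ge0 ?(ltW du0, ltW dv0, ltW dk0) ?du1 ?dv1 ?dkL ?addr_ge0 ?(ltW du0, ltW dv0).
  (* Two powers of [L] bound the reciprocals that are kept, the other two come from
     [inv_diff_le]. *)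
  rewrite (_ : L ^+ 4 = L ^+ 2 * L ^+ 2); last by ring.
  rewrite -[leRHS]mulrA; apply: ler_wpM2l; first by nneg.
  have i1 : `|(deg o u + 1)^-1 - rinv u| <= L ^+ 2 * (`|dev o u| + 1).
    apply: le_trans (inv_diff_le _ (row_gt0 u) du1 (rinv_le u)) _; first by rewrite addr_gt0.
    apply: ler_wpM2l; first by nneg.
    rewrite degE (_ : _ - _ = dev o u + 1); last by ring.
    by apply: le_trans (ler_normD _ _) _; rewrite normr1.
  have i2 : `|(deg o v + 1)^-1 - rinv v| <= L ^+ 2 * (`|dev o v| + 1).
    apply: le_trans (inv_diff_le _ (row_gt0 v) dv1 (rinv_le v)) _; first by rewrite addr_gt0.
    apply: ler_wpM2l; first by nneg.
    rewrite degE (_ : _ - _ = dev o v + 1); last by ring.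
    by apply: le_trans (ler_normD _ _) _; rewrite normr1.
  have i3 : `|(deg o k)^-1 - rinv k| <= L ^+ 2 * `|dev o k|.
    apply: le_trans (inv_diff_le dk0 (row_gt0 k) dkL (rinv_le k)) _.
    by rewrite degE (_ : _ - _ = dev o k) //; ring.
  apply: le_trans (lerD (lerD i1 i2) i3) _.
  by apply: le_of_eq; ring.
have HZ w : `|((deg o w)^-1 - (deg o w + 1)^-1) * tri_at o w - eta_sum w| <= err3 o w + `|err4 o w|.
  have [dw0 dwL] := good_deg w go.
  have dw1 : (deg o w + 1)^-1 <= L.
    by apply: le_trans dwL; rewrite lef_pV2 ?posrE ?lerDl // addr_gt0.
  pose z k l := (deg o w)^-1 * (deg o w + 1)^-1 * (deg o k)^-1 * (deg o l)^-1 - rinv w * rinv w * rinv k * rinv l.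
  have -> : ((deg o w)^-1 - (deg o w + 1)^-1) * tri_at o w - eta_sum w =
     \sum_k \sum_l edge o w k * edge o k l * edge o l w * z k l + err4 o w.
    have -> : (deg o w)^-1 - (deg o w + 1)^-1 = (deg o w)^-1 * (deg o w + 1)^-1.
      by field; rewrite !gt_eqF // addr_gt0.
    rewrite /tri_at /eta_sum /err4 mulr_sumr -sumrB -big_split; apply: eq_bigr => k _.
    rewrite mulr_sumr -sumrB -big_split; apply: eq_bigr => l _.
    by rewrite /z /=; ring.
  apply: le_trans (ler_normD _ _) _; rewrite lerD2r /err3 mulr_sumr.
  apply: le_trans (ler_norm_sum _ _ _) _; apply: ler_sum => k _.
  rewrite mulr_sumr; apply: le_trans (ler_norm_sum _ _ _) _; apply: ler_sum => l _.
  have A0 : 0 <= edge o w k * edge o k l * edge o l w by rewrite !mulr_ge0 ?edge_ge0.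
  rewrite normrM (ger0_norm A0) mulrCA; apply: ler_wpM2l => //.
  have [dk0 dkL] := good_deg k go; have [dl0 dlL] := good_deg l go.
  apply: le_trans (prod4_diff_le _ _ _ _ _ _ _ _) _.
  1-8: by rewrite ?rinv_ge0 ?rinv_le ?invr_ge0 ?(ltW dw0, ltW dk0, ltW dl0) ?dw1 ?dwL ?dlL ?dkL ?addr_ge0 ?(ltW dw0).
  rewrite (_ : L ^+ 5 = L ^+ 3 * L ^+ 2); last by ring.
  rewrite -[leRHS]mulrA; apply: ler_wpM2l; first by nneg.
  have i1 : `|(deg o w + 1)^-1 - rinv w| <= L ^+ 2 * (`|dev o w| + 1).
    apply: le_trans (inv_diff_le _ (row_gt0 w) dw1 (rinv_le w)) _; first by rewrite addr_gt0.
    apply: ler_wpM2l; first by nneg.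
    rewrite degE (_ : _ - _ = dev o w + 1); last by ring.
    by apply: le_trans (ler_normD _ _) _; rewrite normr1.
  have i3 j : 0 < deg o j -> (deg o j)^-1 <= L -> `|(deg o j)^-1 - rinv j| <= L ^+ 2 * `|dev o j|.
    move=> dj0 djL; apply: le_trans (inv_diff_le dj0 (row_gt0 j) djL (rinv_le j)) _.
    by rewrite degE (_ : _ - _ = dev o j) //; ring.
  apply: le_trans (lerD (lerD (lerD (i3 _ dw0 dwL) i1) (i3 _ dk0 dkL)) (i3 _ dl0 dlL)) _.
  by apply: le_of_eq; ring.
set a := ((deg o u)^-1 - _) * _; set a' := (_ - _) * (tri_at o v / 2).
rewrite (_ : Y - a - a' - ecoef u v - wedge mu tcoef o u v = (Y - gamma_sum u v - wedge mu tcoef o u v)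
  - (2 * a - eta_sum u) / 2 - (2 * a' - eta_sum v) / 2); last by rewrite /ecoef; field.
have two_half (x y : R) : 2 * (x * (y / 2)) = x * y by field.
have ha : `|2 * a - eta_sum u| <= err3 o u + `|err4 o u|.
  by rewrite /a two_half; exact: HZ.
have ha' : `|2 * a' - eta_sum v| <= err3 o v + `|err4 o v|.
  by rewrite /a' two_half; exact: HZ.
apply: le_trans (ler_normB _ _) _.
apply: le_trans (lerD (ler_normB _ _) (lexx _)) _.
rewrite !normrM (ger0_norm (_ : 0 <= 2^-1)) ?invr_ge0 //.
by move: HY ha ha'; lra.
Qed.

Lemma pedge_leq e : pedge mu e <= q.
Proof.
by rewrite /pedge; case: ifP => _; [case/andP: (muq e.1 e.2)|exact: (q_ge0 muq e.1)].
Qed.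

(** At most one entry in the row of [w] reads the bit [e]. *)
Lemma dev_upd o e (b : bool) w : `|dev (upd o e b) w - dev o w| <= 1.
Proof.
rewrite /dev -sumrB.
have h j : xedge mu (upd o e b) w j - xedge mu o w j =
    (adj (upd o e b) w j)%:R - (adj o w j)%:R by rewrite /xedge; ring.
under eq_bigr do rewrite h.
have [/existsP[j0 /andP[wj /eqP ej]]|none] := boolP [exists j, (w != j) && (upair w j == e)].
  rewrite (bigD1 j0) //= big1 ?addr0 => [|j jj].
    by do 2 case: adj => /=; rewrite ?subrr ?subr0 ?sub0r ?normrN ?normr1 ?normr0.
  by rewrite -ej adj_upd // ifF ?subrr //; upair_simp.
rewrite big1 ?normr0 // => j _; rewrite /adj ffunE.
move: none; rewrite negb_exists => /forallP/(_ j); rewrite negb_and negbK.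
by case: eqVneq => [->|wj] /= => [_|/negPf ->]; rewrite subrr.
Qed.

Lemma dev_set_all (r : seq ('I_n * 'I_n)) o w :
  `|dev (set_all r o) w - dev o w| <= (size r)%:R.
Proof.
elim: r => [|e r IH] /=; first by rewrite subrr normr0.
apply: le_trans (ler_distD (dev (set_all r o) w) _ _) _.
by rewrite -natr1 addrC; apply: lerD => //; exact: dev_upd.
Qed.

Lemma Ex_lin2 (al : 'I_n -> R) w :
  E (fun o => (\sum_k al k * xedge mu o w k) ^+ 2) = \sum_k al k ^+ 2 * evar mu w k.
Proof.
transitivity (\sum_k \sum_l E (fun o => al k * al l * (xedge mu o w k * xedge mu o w l))).
  under eq_bigr do rewrite -Ex_sum; rewrite -Ex_sum; apply: eq_Ex => o.
  rewrite expr2 mulr_suml; apply: eq_bigr => k _.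
  by rewrite mulr_sumr; apply: eq_bigr => l _; ring.
apply: eq_bigr => k _; rewrite (bigD1 k) //= [X in _ + X]big1 ?addr0 => [|l lk].
  by rewrite ExZ -expr2; congr (_ * _); rewrite -(Ex_x2_1 muS mu0); apply: eq_Ex => o; rewrite expr2.
rewrite ExZ; have [->|wk] := eqVneq w k.
  by rewrite (eq_Ex _ (G := fun=> 0)) ?Ex_cst ?mulr0 // => o; rewrite xedge0 // mul0r.
by rewrite (Ex_x muS) ?mulr0 //; apply: indep_x => //; upair_simp.
Qed.

Lemma Ex_dev2 w : E (fun o => dev o w ^+ 2) <= n%:R * q.
Proof.
rewrite (eq_Ex _ (G := fun o => (\sum_k 1 * xedge mu o w k) ^+ 2)); last first.
  by move=> o; congr (_ ^+ 2); apply: eq_bigr => k _; rewrite mul1r.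
rewrite Ex_lin2 -sum_cst; apply: ler_sum => k _; rewrite expr1n mul1r.
exact: (evar_leq muq).
Qed.

Let pedge01' : forall e, 0 <= pedge mu e <= 1. Proof. exact: (pedge01 muq q1). Qed.

(** Six edges are those of two triangles, the largest pattern forced below; 72 is twice the square
    of 6. *)
Lemma Ex_dev2_set (r : seq ('I_n * 'I_n)) w : (size r <= 6)%N ->
  E (fun o => dev (set_all r o) w ^+ 2) <= 2 * (n%:R * q) + 72.
Proof.
move=> r6; apply: (le_trans (_ : _ <= E (fun o => 2 * dev o w ^+ 2 + 72))).
  apply: leE muq q1 _ _ _ => o; have := dev_set_all r o w.
  set x := dev _ w; set y := dev o w => xy.
  have xy6 : `|x - y| <= 6 by apply: le_trans xy _; rewrite ler_nat.
  have : (x - y) ^+ 2 <= 36.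
    rewrite -(real_normK (num_real (x - y))) (_ : 36 = 6 ^+ 2); last by ring.
    by rewrite lerXn2r ?nnegrE.
  have := sqr_ge0 (x - 2 * y) => z1 z2.
  rewrite -subr_ge0 (_ : _ - _ = 2 * (36 - (x - y) ^+ 2) + (x - 2 * y) ^+ 2); last by ring.
  by rewrite addr_ge0 // mulr_ge0 // subr_ge0.
by rewrite ExD ExZ Ex_cst lerD2r; apply: ler_wpM2l => //; exact: Ex_dev2.
Qed.

(** Cauchy-Schwarz with weights [z], left expanded: when [z] is a product of edges, every term is a
    monomial in edges times one [H p ^+ 2]. *)
Lemma sqr_sum_weighted (P : finType) (z H : P -> R) : (forall p, 0 <= z p) ->
  (\sum_p z p * H p) ^+ 2 <= \sum_p \sum_p' z p * z p' * H p ^+ 2.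
Proof.
move=> z0.
have : 0 <= \sum_p \sum_p' z p * z p' * (H p - H p') ^+ 2.
  by apply: sumr_ge0 => p _; apply: sumr_ge0 => p' _; nneg.
have -> : \sum_p \sum_p' z p * z p' * (H p - H p') ^+ 2 =
   \sum_p \sum_p' z p * z p' * H p ^+ 2 + \sum_p \sum_p' z p * z p' * H p ^+ 2
   - 2 * (\sum_p z p * H p) ^+ 2.
  rewrite [X in _ = _ + X - _]exchange_big /= expr2 mulr_suml mulr_sumr -big_split -sumrB.
  apply: eq_bigr => p _; rewrite mulr_sumr mulr_sumr -big_split -sumrB.
  by apply: eq_bigr => p' _ /=; ring.
by move=> h; lra.
Qed.

Section Mono.
Variables (F : cfg -> R) (M : R).
Hypotheses (F0 : forall o, 0 <= F o) (M0 : 0 <= M).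
(** The bound has to survive forcing edges, because [Ex_all_le] evaluates [F] at [set_all r o]. *)
Hypothesis FM : forall r : seq ('I_n * 'I_n), (size r <= 6)%N ->
  E (fun o => F (set_all r o)) <= M.

Let Ex_mono (r : seq ('I_n * 'I_n)) m : (size r <= 6)%N -> size (undup r) = m ->
  E (fun o => (all o r)%:R * F o) <= q ^+ m * M.
Proof.
move=> r6 <-; apply: le_trans (Ex_all_le pedge01' r pedge_leq F0) _.
have [->|r0] := eqVneq (undup r) [::]; first by rewrite expr0 !mul1r; exact: FM.
have q0 : 0 <= q by case: (undup r) r0 => // e *; exact: le_trans (p_ge0 pedge01' e) (pedge_leq e).
apply: ler_wpM2l; first exact: exprn_ge0.
by apply: FM; exact: leq_trans (size_undup r) r6.
Qed.

(** Two paths of length two from [u] to [v] share either no edge or both. *)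
Lemma Ex_edge4 u v k l : u != v ->
  E (fun o => edge o u k * edge o k v * (edge o u l * edge o l v) * F o)
  <= (q ^+ 4 + (k == l)%:R * q ^+ 2) * M.
Proof.
move=> uv; have q0 := q_ge0 muq u.
have b0 : 0 <= (q ^+ 4 + (k == l)%:R * q ^+ 2) * M by nneg.
have z0 (G : cfg -> R) : (forall o, G o = 0) -> E G <= (q ^+ 4 + (k == l)%:R * q ^+ 2) * M.
  by move=> h; rewrite (eq_Ex _ (G := fun=> 0)) ?Ex_cst.
have [e|uk] := eqVneq u k; first by apply: z0 => o; rewrite -e edge0 !mul0r.
have [e|kv] := eqVneq k v; first by apply: z0 => o; rewrite e edge0 !(mulr0, mul0r).
have [e|ul] := eqVneq u l; first by apply: z0 => o; rewrite -e edge0 !(mulr0, mul0r).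
have [e|lv] := eqVneq l v; first by apply: z0 => o; rewrite e edge0 !(mulr0, mul0r).
rewrite (eq_Ex _ (G := fun o => (all o [:: upair u k; upair k v; upair u l; upair l v])%:R * F o)); last first.
  by move=> o; rewrite /edge /adj uk kv ul lv /= andbT -!natrM !mulnb !andbA.
have [e|kl] := eqVneq k l.
  apply: le_trans (Ex_mono (m := 2) _ _) _ => //.
    by rewrite e /= !inE !eqxx /=; upair_simp.
  by apply: ler_wpM2r => //; rewrite mul1r lerDr exprn_ge0.
apply: le_trans (Ex_mono (m := 4) _ _) _ => //.
  by rewrite /= !inE; upair_simp.
by apply: ler_wpM2r => //; rewrite mul0r addr0.
Qed.

(** Two triangles at [w] have six distinct edges in general, five if they share one further vertex,
    and three if they coincide. *)
Lemma Ex_edge6 w k l k' l' :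
  E (fun o => edge o w k * edge o k l * edge o l w * (edge o w k' * edge o k' l' * edge o l' w) * F o)
  <= (q ^+ 6 + ((k' == k) + (k' == l) + (l' == k) + (l' == l))%N%:R * q ^+ 5
     + ((k' == k) && (l' == l) + (k' == l) && (l' == k))%N%:R * q ^+ 3) * M.
Proof.
have q0 := q_ge0 muq w.
set c0 := (X in X * M).
have c00 : 0 <= c0 by rewrite /c0; nneg.
have b0 : 0 <= c0 * M by nneg.
have z0 (G : cfg -> R) : (forall o, G o = 0) -> E G <= c0 * M.
  by move=> h; rewrite (eq_Ex _ (G := fun=> 0)) ?Ex_cst.
have [e|wk] := eqVneq w k; first by apply: z0 => o; rewrite -e edge0 !(mulr0, mul0r).
have [e|kl] := eqVneq k l; first by apply: z0 => o; rewrite e edge0 !(mulr0, mul0r).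
have [e|lw] := eqVneq l w; first by apply: z0 => o; rewrite e edge0 !(mulr0, mul0r).
have [e|wk'] := eqVneq w k'; first by apply: z0 => o; rewrite -e edge0 !(mulr0, mul0r).
have [e|kl'] := eqVneq k' l'; first by apply: z0 => o; rewrite e edge0 !(mulr0, mul0r).
have [e|lw'] := eqVneq l' w; first by apply: z0 => o; rewrite e edge0 !(mulr0, mul0r).
rewrite (eq_Ex _ (G := fun o => (all o [:: upair w k; upair k l; upair l w; upair w k'; upair k' l'; upair l' w])%:R * F o)); last first.
  by move=> o; rewrite /edge /adj wk kl lw wk' kl' lw' /= andbT -!natrM !mulnb !andbA.
have fin m : size (undup [:: upair w k; upair k l; upair l w; upair w k'; upair k' l'; upair l' w]) = m ->
    q ^+ m <= c0 ->
  E (fun o => (all o [:: upair w k; upair k l; upair l w; upair w k'; upair k' l'; upair l' w])%:R * F o) <= c0 * M.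
  by move=> hm qm; apply: le_trans (Ex_mono _ hm) _ => //; exact: ler_wpM2r.
have q60 : 0 <= q ^+ 6 by nneg.
have q50 : 0 <= q ^+ 5 by nneg.
have q30 : 0 <= q ^+ 3 by nneg.
have [e1|k'k] := eqVneq k' k.
  have k'l : k' != l by rewrite e1.
  have [e2|l'l] := eqVneq l' l.
    apply: (fin 3); first by rewrite e1 e2 /= !inE !eqxx /=; upair_simp.
    rewrite /c0 e1 e2 !eqxx /= (negPf kl) [l == k]eq_sym (negPf kl) /=; lra.
  have l'k : l' != k by rewrite eq_sym -e1.
  apply: (fin 5); first by rewrite e1 /= !inE !eqxx /=; upair_simp.
  by rewrite /c0 e1 !eqxx /= (negPf kl) (negPf l'l) (negPf l'k) /=; lra.
have [e1|k'l] := eqVneq k' l.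
  have [e2|l'k] := eqVneq l' k.
    apply: (fin 3); first by rewrite e1 e2 /= !inE (upairC k l) (upairC l w) (upairC k w) !eqxx /=; upair_simp.
    rewrite /c0 e1 e2 !eqxx /= (negPf kl) [l == k]eq_sym (negPf kl) /=; lra.
  have l'l : l' != l by rewrite eq_sym -e1.
  apply: (fin 5); first by rewrite e1 (upairC l w) /= !inE !eqxx /=; upair_simp.
  by rewrite /c0 e1 !eqxx /= [l == k]eq_sym (negPf kl) (negPf l'l) (negPf l'k) /=; lra.
have [e2|l'k] := eqVneq l' k.
  apply: (fin 5); first by rewrite e2 (upairC w k) /= !inE !eqxx /=; upair_simp.
  by rewrite /c0 e2 !eqxx /= (negPf kl) (negPf k'k) (negPf k'l) /=; lra.
have [e2|l'l] := eqVneq l' l.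
  apply: (fin 5); first by rewrite e2 /= !inE !eqxx /=; upair_simp.
  by rewrite /c0 e2 !eqxx /= [l == k]eq_sym (negPf kl) (negPf k'k) (negPf k'l) /=; lra.
apply: (fin 6); first by rewrite /= !inE; upair_simp.
by rewrite /c0 (negPf k'k) (negPf k'l) (negPf l'k) (negPf l'l) /=; lra.
Qed.

End Mono.

(** Chosen to dominate 4 * 6 * (2 n q + 72) + 16 = 48 n q + 1744, the bound reached in
    [Ex_dev_comb]. *)
Let Mo : R := (2 * 10 ^+ 3) * (n%:R * q + 1).

Lemma sqr4_le (x y z t : R) : (x + y + z + t) ^+ 2 <= 4 * (x ^+ 2 + y ^+ 2 + z ^+ 2 + t ^+ 2).
Proof.
rewrite -subr_ge0 [leRHS](_ : _ = (x - y) ^+ 2 + (x - z) ^+ 2 + (x - t) ^+ 2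
  + (y - z) ^+ 2 + (y - t) ^+ 2 + (z - t) ^+ 2); last by ring.
by nneg.
Qed.

(** The conditions fit the coefficients (1, 1, 1; 2) of [err1] and (2, 1, 1; 1) of [err3]. The
    unreduced application has the shape of the hypothesis [FM]. *)
Lemma Ex_dev_comb (x y z t : R) i j k (r : seq ('I_n * 'I_n)) : (size r <= 6)%N ->
  x ^+ 2 + y ^+ 2 + z ^+ 2 <= 6 -> t ^+ 2 <= 4 ->
  E (fun o => (fun o => (x * `|dev o i| + y * `|dev o j| + z * `|dev o k| + t) ^+ 2) (set_all r o)) <= Mo.
Proof.
move=> r6 xyz t4.
apply: (le_trans (_ : _ <= E (fun o => 4 * x ^+ 2 * dev (set_all r o) i ^+ 2 +
  4 * y ^+ 2 * dev (set_all r o) j ^+ 2 + 4 * z ^+ 2 * dev (set_all r o) k ^+ 2 + 16))).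
  apply: leE muq q1 _ _ _ => o; apply: le_trans (sqr4_le _ _ _ _) _.
  by rewrite !exprMn !real_normK ?num_real //; lra.
rewrite !ExD !ExZ Ex_cst.
have q0 := q_ge0 muq i.
have m0 : 0 <= n%:R * q by rewrite mulr_ge0.
have hi := Ex_dev2_set i r6; have hj := Ex_dev2_set j r6; have hk := Ex_dev2_set k r6.
have x2 : 0 <= 4 * x ^+ 2 by nneg.
have y2 : 0 <= 4 * y ^+ 2 by nneg.
have z2 : 0 <= 4 * z ^+ 2 by nneg.
apply: le_trans (lerD (lerD (lerD (ler_wpM2l x2 hi) (ler_wpM2l y2 hj)) (ler_wpM2l z2 hk)) (lexx _)) _.
rewrite -!mulrDl -!mulrDr.
apply: le_trans (_ : 4 * 6 * (2 * (n%:R * q) + 72) + 16 <= _); last by rewrite /Mo; lra.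
by rewrite lerD2r; apply: ler_wpM2r; [lra|apply: ler_wpM2l].
Qed.

Lemma Mo_ge0 i : 0 <= Mo.
Proof. by have q0 := q_ge0 muq i; rewrite /Mo; nneg. Qed.

Lemma L_ge0 i : 0 <= L.
Proof. exact: le_trans (rinv_ge0 i) (rinv_le i). Qed.

Lemma Ex_codegree2 u v : u != v ->
  E (fun o => (\sum_k edge o u k * edge o k v) ^+ 2) <= n%:R ^+ 2 * q ^+ 4 + n%:R * q ^+ 2.
Proof.
move=> uv.
rewrite (eq_Ex _ (G := fun o => \sum_k \sum_l edge o u k * edge o k v * (edge o u l * edge o l v) * 1)); last first.
  move=> o; rewrite expr2 mulr_suml; apply: eq_bigr => k _.
  by rewrite mulr_sumr; apply: eq_bigr => l _; rewrite mulr1.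
rewrite Ex_sum; under eq_bigr do rewrite Ex_sum.
apply: (le_trans (_ : _ <= \sum_(k < n) \sum_(l < n) (q ^+ 4 + (k == l)%:R * q ^+ 2) * 1)).
  apply: ler_sum => k _; apply: ler_sum => l _; apply: (Ex_edge4 (F := fun=> 1)) => // r _.
  by rewrite Ex_cst.
under eq_bigr => k _.
  under eq_bigr => l _ do rewrite mulr1.
  rewrite big_split /= sum_cst -mulr_suml.
  rewrite (_ : \sum_(l < n) (k == l)%:R = 1); last first.
    by rewrite -[RHS](sum_pred1 k (fun=> 1)); apply: eq_bigr => l _; rewrite eq_sym; case: eqP.
  over.
by rewrite sum_cst; apply: le_of_eq; ring.
Qed.

(** The weighted Cauchy-Schwarz inequality leaves pairs of paths times one squared deviation, to
    which [Ex_edge4] applies. *)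
Lemma Ex_err1 u v : u != v ->
  E (fun o => err1 o u v ^+ 2) <= L ^+ 8 * ((n%:R ^+ 2 * q ^+ 4 + n%:R * q ^+ 2) * Mo).
Proof.
move=> uv.
have L0 := L_ge0 u; have M0 := Mo_ge0 u.
pose H k o := (1 * `|dev o u| + 1 * `|dev o v| + 1 * `|dev o k| + 2) ^+ 2.
apply: (le_trans (_ : _ <= E (fun o => L ^+ 8 * \sum_k \sum_l edge o u k * edge o k v * (edge o u l * edge o l v) * H k o))).
  apply: leE muq q1 _ _ _ => o; rewrite /err1 exprMn -exprM; apply: ler_wpM2l; first by nneg.
  have h := @sqr_sum_weighted _ (fun k => edge o u k * edge o k v) (fun k => `|dev o u| + `|dev o v| + `|dev o k| + 2) _.
  apply: le_trans (h _) _ => [k|]; first by rewrite mulr_ge0 ?edge_ge0.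
  by apply: le_of_eq; apply: eq_bigr => k _; apply: eq_bigr => l _; rewrite /H !mul1r.
rewrite ExZ; apply: ler_wpM2l; first by nneg.
rewrite Ex_sum; under eq_bigr do rewrite Ex_sum.
apply: (le_trans (_ : _ <= \sum_(k < n) \sum_(l < n) (q ^+ 4 + (k == l)%:R * q ^+ 2) * Mo)).
  apply: ler_sum => k _; apply: ler_sum => l _; apply: Ex_edge4 => //; [move=> o|move=> r r6]; first by rewrite /H; nneg.
  by apply: Ex_dev_comb; rewrite // ?expr1n; lra.
under eq_bigr => k _.
  rewrite -mulr_suml big_split /= sum_cst -mulr_suml.
  rewrite (_ : \sum_(l < n) (k == l)%:R = 1); last first.
    by rewrite -[RHS](sum_pred1 k (fun=> 1)); apply: eq_bigr => l _; rewrite eq_sym; case: eqP.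
  over.
by rewrite sum_cst; apply: le_of_eq; ring.
Qed.

Lemma tcoef_le i j k : 0 <= tcoef i j k <= L ^+ 3.
Proof.
have h x : 0 <= rinv x <= L by rewrite rinv_ge0 rinv_le.
case/andP: (h i) => ? ?; case/andP: (h j) => ? ?; case/andP: (h k) => ? ?.
by rewrite /tcoef !mulr_ge0 //= !exprS expr0 mulr1 mulrA !ler_pM ?mulr_ge0.
Qed.

(** A sum of two linear forms, in the rows of [v] and of [u]; within a row the edges are
    orthogonal. *)
Lemma Ex_err2 u v : E (fun o => err2 o u v ^+ 2) <= 4 * n%:R * L ^+ 6 * q ^+ 3.
Proof.
have q0 := q_ge0 muq u; have L0 := L_ge0 u.
have lin w (z : 'I_n -> R) : (forall k, 0 <= z k <= L ^+ 3 * q) ->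
   E (fun o => (\sum_k z k * xedge mu o w k) ^+ 2) <= n%:R * (L ^+ 6 * q ^+ 3).
  move=> hz; rewrite Ex_lin2 -sum_cst; apply: ler_sum => k _.
  case/andP: (hz k) => z0 zL.
  rewrite (_ : L ^+ 6 * q ^+ 3 = (L ^+ 3 * q) ^+ 2 * q); last by ring.
  apply: ler_pM; rewrite ?sqr_ge0 ?(evar_ge0 muq q1) ?(evar_leq muq) //.
  by rewrite lerXn2r ?nnegrE //; nneg.
have zz w k : 0 <= tcoef u v k * mu w k <= L ^+ 3 * q.
  case/andP: (tcoef_le u v k) => c0 c1; case/andP: (muq w k) => m0 m1.
  by rewrite mulr_ge0 //= ler_pM.
apply: (le_trans (_ : _ <= E (fun o => 2 * (\sum_k (tcoef u v k * mu u k) * xedge mu o v k) ^+ 2 +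
   2 * (\sum_k (tcoef u v k * mu v k) * xedge mu o u k) ^+ 2))).
  apply: leE muq q1 _ _ _ => o.
  have -> : err2 o u v = \sum_k (tcoef u v k * mu u k) * xedge mu o v k + \sum_k (tcoef u v k * mu v k) * xedge mu o u k.
    rewrite /err2 -big_split; apply: eq_bigr => k _ /=.
    by rewrite (xedgeS muS o k v) (muS k v); ring.
  set x := \sum_k _; set y := \sum_k _.
  rewrite -subr_ge0 [leRHS](_ : _ = (x - y) ^+ 2); last by ring.
  by nneg.
rewrite ExD !ExZ.
apply: le_trans (lerD (ler_wpM2l _ (lin v _ (zz u))) (ler_wpM2l _ (lin u _ (zz v)))) _ => //.
by apply: le_of_eq; ring.
Qed.

(** The argument for [err1] with pairs of triangles at [w] in place of pairs of paths. *)
Lemma Ex_err3 w : E (fun o => err3 o w ^+ 2) <=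
  L ^+ 10 * ((n%:R ^+ 4 * q ^+ 6 + 4 * n%:R ^+ 3 * q ^+ 5 + 2 * n%:R ^+ 2 * q ^+ 3) * Mo).
Proof.
have L0 := L_ge0 w; have M0 := Mo_ge0 w.
pose H k l o := (2 * `|dev o w| + 1 * `|dev o k| + 1 * `|dev o l| + 1) ^+ 2.
apply: (le_trans (_ : _ <= E (fun o => L ^+ 10 * \sum_k \sum_l \sum_k' \sum_l'
   edge o w k * edge o k l * edge o l w * (edge o w k' * edge o k' l' * edge o l' w) * H k l o))).
  apply: leE muq q1 _ _ _ => o; rewrite /err3 exprMn -exprM; apply: ler_wpM2l; first by nneg.
  rewrite pair_bigA /=.
  have h := @sqr_sum_weighted _ (fun p : 'I_n * 'I_n => edge o w p.1 * edge o p.1 p.2 * edge o p.2 w)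
     (fun p => 2 * `|dev o w| + `|dev o p.1| + `|dev o p.2| + 1) _.
  apply: le_trans (h _) _ => [p|]; first by rewrite !mulr_ge0 ?edge_ge0.
  rewrite [leRHS]pair_bigA /=; apply: ler_sum => p _; rewrite pair_bigA /=.
  by apply: ler_sum => p' _; rewrite /H !mul1r.
rewrite ExZ; apply: ler_wpM2l; first by nneg.
apply: (le_trans (_ : _ <= \sum_(k < n) \sum_(l < n) \sum_(k' < n) \sum_(l' < n)
  (q ^+ 6 + ((k' == k) + (k' == l) + (l' == k) + (l' == l))%N%:R * q ^+ 5
     + ((k' == k) && (l' == l) + (k' == l) && (l' == k))%N%:R * q ^+ 3) * Mo)).
  rewrite Ex_sum; apply: ler_sum => k _; rewrite Ex_sum; apply: ler_sum => l _.
  rewrite Ex_sum; apply: ler_sum => k' _; rewrite Ex_sum; apply: ler_sum => l' _.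
  apply: Ex_edge6 => //; [move=> o|move=> r r6]; first by rewrite /H; nneg.
  by apply: Ex_dev_comb; rewrite // ?expr1n; lra.
have in2 k l : \sum_(k' < n) \sum_(l' < n)
  (q ^+ 6 + ((k' == k) + (k' == l) + (l' == k) + (l' == l))%N%:R * q ^+ 5
     + ((k' == k) && (l' == l) + (k' == l) && (l' == k))%N%:R * q ^+ 3) * Mo =
   (n%:R ^+ 2 * q ^+ 6 + 4 * n%:R * q ^+ 5 + 2 * q ^+ 3) * Mo.
  have both x y : \sum_(k' < n) \sum_(l' < n) ((k' == x) && (l' == y))%:R = 1 :> R.
    rewrite -[RHS](sum_pred1 x (fun=> 1)); apply: eq_bigr => i _.
    case: eqP => _ /=; last by rewrite big1.
    by rewrite -[RHS](sum_pred1 y (fun=> 1)); apply: eq_bigr => j _; case: eqP.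
  transitivity ((\sum_(k' < n) \sum_(l' < n) q ^+ 6
     + \sum_(k' < n) \sum_(l' < n) ((k' == k) + (k' == l) + (l' == k) + (l' == l))%N%:R * q ^+ 5
     + (\sum_(k' < n) \sum_(l' < n) ((k' == k) && (l' == l))%:R + \sum_(k' < n) \sum_(l' < n) ((k' == l) && (l' == k))%:R) * q ^+ 3) * Mo).
    rewrite -!big_split mulr_suml -!big_split mulr_suml; apply: eq_bigr => i _ /=.
    rewrite -!big_split mulr_suml -!big_split mulr_suml; apply: eq_bigr => j _ /=.
    by rewrite -natrD.
  by rewrite !sum_cst sum_touch !both; ring.
under eq_bigr do under eq_bigr do rewrite in2.
by rewrite !sum_cst; apply: le_of_eq; ring.
Qed.

Lemma Ex_aaa w k l : E (fun o => edge o w k * edge o k l * edge o l w) = mu w k * mu k l * mu l w.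
Proof.
have z0 (G : cfg -> R) : (forall o, G o = 0) -> E G = 0.
  by move=> h; rewrite (eq_Ex _ (G := fun=> 0)) ?Ex_cst.
have [<-|wk] := eqVneq w k; first by rewrite mu0 !mul0r; apply: z0 => o; rewrite edge0 !mul0r.
have [<-|kl] := eqVneq k l; first by rewrite mu0 !(mul0r, mulr0); apply: z0 => o; rewrite edge0 !(mul0r, mulr0).
have [<-|lw] := eqVneq l w; first by rewrite mu0 !mulr0; apply: z0 => o; rewrite edge0 !mulr0.
rewrite (eq_Ex _ (G := fun o => (all o [:: upair w k; upair k l; upair l w])%:R * 1)); last first.
  by move=> o; rewrite /edge /adj wk kl lw /= andbT mulr1 -!natrM !mulnb !andbA.
rewrite Ex_all; last by rewrite /= !inE; upair_simp.
by rewrite Ex_cst mulr1 !big_cons big_nil mulr1 !(pedge_upair muS) // mulrA.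
Qed.

(** This is the variance of a weighted triangle count at [w], bounded by Efron-Stein. An edge at [w]
    acts through a codegree, of second moment [N2]; any other edge acts through a single path. *)
Lemma Ex_err4 w : E (fun o => err4 o w ^+ 2) <= L ^+ 8 * (6 * (n%:R ^+ 3 * q ^+ 5 + n%:R ^+ 2 * q ^+ 3)).
Proof.
have L0 := L_ge0 w; have q0 := q_ge0 muq w.
have n1 : 1 <= n%:R :> R by rewrite ler1n; case: n w => [[]|].
pose ka k l := rinv w ^+ 2 * rinv k * rinv l.
(* The weight of the triangles at [w] made symmetric in all three vertices, so that [diff_tri]
   applies. *)
pose c i j k := (if i == w then ka j k else 0) + (if j == w then ka i k else 0) + (if k == w then ka i j else 0).
have kaS k l : ka k l = ka l k by rewrite /ka; ring.
have cS : sym3 c.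
  by split=> i j k; rewrite /c; [rewrite (kaS j i)|rewrite (kaS k j)]; ring.
have kaL k l : 0 <= ka k l <= L ^+ 4.
  have h x : 0 <= rinv x <= L by rewrite rinv_ge0 rinv_le.
  case/andP: (h w) => ? ?; case/andP: (h k) => ? ?; case/andP: (h l) => ? ?.
  rewrite /ka expr2 !mulr_ge0 //= (_ : L ^+ 4 = L * L * L * L); last by ring.
  by rewrite !ler_pM ?mulr_ge0.
pose Z o := \sum_k \sum_l ka k l * (edge o w k * edge o k l * edge o l w).
have ZE o : Z o = 2 * tri c (edge o).
  pose g i j k := if i == w then ka j k * (edge o i j * edge o j k * edge o k i) else 0.
  have -> : tri c (edge o) = sum3 (fun i j k => g i j k + g j k i + g k i j) / 6.
    rewrite /tri; congr (_ / 6); apply: eq_sum3 => i j k; rewrite /c /g (kaS k i).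
    by do 3 case: ifP => _; ring.
  rewrite !sum3D (sum3_rot g) (sum3_rot2 g).
  have -> : sum3 g = Z o; last by field.
  rewrite /sum3 -[RHS](sum_pred1 w (fun=> Z o)); apply: eq_bigr => i _; rewrite /g.
  by case: eqP => [->//|_]; rewrite big1 // => j _; rewrite big1.
have e4E o : err4 o w = Z o - eta_sum w.
  rewrite /err4 /Z /eta_sum -sumrB; apply: eq_bigr => k _; rewrite -sumrB.
  by apply: eq_bigr => l _; rewrite /ka; ring.
have EZ : E Z = eta_sum w.
  rewrite Ex_sum; apply: eq_bigr => k _; rewrite Ex_sum; apply: eq_bigr => l _.
  by rewrite ExZ Ex_aaa mulrC.
rewrite (eq_Ex _ (G := fun o => (Z o - E Z) ^+ 2)); last by move=> o; rewrite e4E EZ.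
apply: le_trans (efron_stein pedge01' _) _.
set N2 := n%:R ^+ 2 * q ^+ 4 + n%:R * q ^+ 2.
have N20 : 0 <= N2 by rewrite /N2; nneg.
pose G s t := 4 * L ^+ 8 * (((s == w) + (t == w))%N%:R * N2 + (q ^+ 4 + q ^+ 2)).
have hG s t : s != t -> E (fun o => diff (upair s t) Z o ^+ 2) <= G s t.
  move=> st.
  have dZ o : diff (upair s t) Z o = 2 * \sum_k c s t k * (edge o s k * edge o k t).
    by rewrite -diff_tri // /diff !ZE mulrBr.
  have star s' t' : s' != t' -> s' = w ->
     E (fun o => (2 * \sum_k c s' t' k * (edge o s' k * edge o k t')) ^+ 2) <= 4 * L ^+ 8 * N2.
    move=> st' sw.
    apply: (le_trans (_ : _ <= E (fun o => 4 * L ^+ 8 * (\sum_k edge o s' k * edge o k t') ^+ 2))).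
      apply: leE muq q1 _ _ _ => o.
      rewrite exprMn (_ : 2 ^+ 2 = 4); last by ring.
      rewrite -mulrA; apply: ler_wpM2l => //.
      rewrite (_ : L ^+ 8 = (L ^+ 4) ^+ 2); last by ring.
      have h k : 0 <= c s' t' k * (edge o s' k * edge o k t') <= L ^+ 4 * (edge o s' k * edge o k t').
        rewrite /c sw eqxx eq_sym -sw (negPf st') addr0.
        have [->|ks] := eqVneq k s'; first by rewrite edge0 mul0r !mulr0 lexx.
        rewrite addr0; case/andP: (kaL t' k) => k0 k1.
        have A0 : 0 <= edge o s' k * edge o k t' by rewrite mulr_ge0 ?edge_ge0.
        by rewrite mulr_ge0 //=; apply: ler_wpM2r.
      rewrite -exprMn; apply: lerXn2r; rewrite ?nnegrE.
      - by apply: sumr_ge0 => k _; case/andP: (h k).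
      - by rewrite mulr_sumr; apply: sumr_ge0 => k _; case/andP: (h k); exact: le_trans.
      by rewrite mulr_sumr; apply: ler_sum => k _; case/andP: (h k).
    by rewrite ExZ; apply: ler_wpM2l; [nneg|exact: Ex_codegree2].
  have up (x : R) : 0 <= x -> 0 <= 4 * L ^+ 8 * x by move=> x0; nneg.
  rewrite (eq_Ex _ (G := fun o => (2 * \sum_k c s t k * (edge o s k * edge o k t)) ^+ 2)); last first.
    by move=> o; rewrite dZ.
  have qq : 0 <= q ^+ 4 + q ^+ 2 by nneg.
  have [sw|sw] := eqVneq s w.
    apply: le_trans (star s t st sw) _; rewrite /G sw eqxx.
    apply: ler_wpM2l; first by nneg.
    have : 0 <= (t == w)%:R * N2 by nneg.
    by rewrite natrD mulrDl mul1r; lra.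
  have [tw|tw] := eqVneq t w.
    apply: le_trans (_ : 4 * L ^+ 8 * N2 <= _).
      apply: le_trans (star t s _ tw); last by rewrite eq_sym.
      apply: leE muq q1 _ _ _ => o; apply: le_of_eq; congr ((_ * _) ^+ 2).
      by apply: eq_bigr => k _; case: cS => cS1 _; rewrite cS1 (edgeS o t k) (edgeS o k s) [edge o k t * _]mulrC.
    rewrite /G tw eqxx (negPf sw) add0n mul1r.
    by apply: ler_wpM2l; [nneg|lra].
  (* An edge [st] away from [w] closes only the triangle through the path [s w t]. *)
  have -> : E (fun o => (2 * \sum_k c s t k * (edge o s k * edge o k t)) ^+ 2) =
      4 * ka s t ^+ 2 * E (fun o => edge o s w * edge o w t * (edge o s w * edge o w t) * 1).
    rewrite -ExZ; apply: eq_Ex => o.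
    rewrite (bigD1 w) //= big1 ?addr0 => [|k kw].
      by rewrite /c (negPf sw) (negPf tw) eqxx; ring.
    by rewrite /c (negPf sw) (negPf tw) (negPf kw); ring.
  rewrite /G (negPf sw) (negPf tw) mul0r add0r.
  have f1 (r : seq ('I_n * 'I_n)) : (size r <= 6)%N -> E (fun o => (fun=> 1) (set_all r o)) <= 1.
    by rewrite Ex_cst.
  have := Ex_edge4 (F := fun=> 1) (fun=> ler01) ler01 f1 w w st.
  rewrite eqxx mulr1 mul1r => h4; apply: ler_pM h4; first by nneg.
  - apply: (Ex_ge0 pedge01') => o; rewrite mulr1; nneg; exact: edge_ge0.
  - apply: ler_wpM2l => //; case/andP: (kaL s t) => k0 k1.
    by rewrite (_ : L ^+ 8 = (L ^+ 4) ^+ 2); [rewrite lerXn2r ?nnegrE //; nneg|ring].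
apply: le_trans (sum_bvar_le muS mu0 muq q1 hG _) _ => [s t|]; first by rewrite /G; nneg.
have one : \sum_(s < n) (s == w)%:R = 1 :> R.
  by rewrite -[RHS](sum_pred1 w (fun=> 1)); apply: eq_bigr => s _; case: eqP.
have -> : \sum_s \sum_t q * G s t = q * (4 * L ^+ 8) * (2 * n%:R * N2 + n%:R ^+ 2 * (q ^+ 4 + q ^+ 2)).
  transitivity (\sum_(s < n) (q * (4 * L ^+ 8)) * (n%:R * (s == w)%:R * N2 + N2 + n%:R * (q ^+ 4 + q ^+ 2))).
    apply: eq_bigr => s _.
    transitivity ((q * (4 * L ^+ 8)) * \sum_(t < n) (((s == w)%:R * N2 + (q ^+ 4 + q ^+ 2)) + (t == w)%:R * N2)).
      by rewrite mulr_sumr; apply: eq_bigr => t _; rewrite /G natrD; ring.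
    by rewrite big_split /= sum_cst -mulr_suml one; ring.
  rewrite -mulr_sumr 2!big_split /= !sum_cst -mulr_suml -mulr_sumr one; ring.
rewrite -subr_ge0 [leRHS](_ : _ = L ^+ 8 * (2 * n%:R ^+ 2 * q ^+ 5 * (n%:R - 1))); last first.
  by rewrite /N2; field.
have n10 : 0 <= n%:R - 1 :> R by rewrite subr_ge0.
by nneg.
Qed.

Definition rest o : R := tstat o - Upoly mu ecoef tcoef o.

Lemma ecoefS i j : ecoef i j = ecoef j i.
Proof.
rewrite /ecoef /gamma_sum; congr (_ - _ / 2); last by rewrite addrC.
by apply: eq_bigr => k _; rewrite /tcoef (muS i k) (muS k j) [mu k i * _]mulrC [rinv i * _]mulrC.
Qed.
Lemma tcoefS : sym3 tcoef.
Proof. by split=> i j k; rewrite /tcoef; ring. Qed.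

Lemma tstat_ge0 o : 0 <= tstat o.
Proof.
rewrite /tstat /tri /sum3; nneg; rewrite ?invr_ge0; try exact: edge_ge0.
all: by apply: sumr_ge0 => j _; exact: edge_ge0.
Qed.

Lemma tstat_le o : tstat o <= n%:R ^+ 3.
Proof.
have a1 i j : 0 <= edge o i j <= 1 by rewrite edge_ge0 /= lern1 leq_b1.
have d1 i : 0 <= (deg o i)^-1 <= 1.
  (* The inverse degree of an isolated vertex is 0, any other is at most 1. *)
  rewrite /deg /edge -natr_sum; case: (\sum_j _)%N => [|m]; first by rewrite invr0 lexx ler01.
  by rewrite invr_ge0 ler0n /= invf_le1 ?ltr0n // ler1n.
have m1 (x y : R) : 0 <= x <= 1 -> 0 <= y <= 1 -> 0 <= x * y <= 1.
  by move=> /andP[x0 x1] /andP[y0 y1]; rewrite mulr_ge0 //= mulr_ile1.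
rewrite /tstat /tri ler_pdivrMr //.
apply: le_trans (_ : \sum_(i < n) \sum_(j < n) \sum_(k < n) 1 <= _).
  apply: ler_sum => i _; apply: ler_sum => j _; apply: ler_sum => k _.
  by case/andP: (m1 _ _ (m1 _ _ (m1 _ _ (d1 i) (d1 j)) (d1 k)) (m1 _ _ (m1 _ _ (a1 i j) (a1 j k)) (a1 k i))).
rewrite !sum_cst (_ : _ * _ = n%:R ^+ 3); last by ring.
by rewrite ler_peMr ?exprn_ge0 // ler1n.
Qed.

(** * Variance of the remainder *)

Section Total.
Variables (B dl : R).
Hypothesis bB : forall i j, `|ecoef i j| <= B.
Hypothesis bad_le : E (fun o => (~~ good o)%:R) <= dl.
Hypothesis q2 : q <= 1 / 2.

(** Crude bound for the squared derivative where a degree is small: n^3 for the statistic, [B] for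
    the linear coefficient, [n L^3] for the wedge sum. *)
Let Mb : R := (n%:R ^+ 3 + B + n%:R * L ^+ 3) ^+ 2.
Let N2 : R := n%:R ^+ 2 * q ^+ 4 + n%:R * q ^+ 2.

Definition rem_bound : R :=
  12 * (L ^+ 8 * (N2 * Mo) + 4 * n%:R * L ^+ 6 * q ^+ 3
  + 2 * (L ^+ 10 * ((n%:R ^+ 4 * q ^+ 6 + 4 * n%:R ^+ 3 * q ^+ 5 + 2 * n%:R ^+ 2 * q ^+ 3) * Mo))
  + 2 * (L ^+ 8 * (6 * (n%:R ^+ 3 * q ^+ 5 + n%:R ^+ 2 * q ^+ 3))))
  + 2 * Mb * dl.

Lemma diff_R_bound u v o : u != v -> adj o u v = false ->
  diff (upair u v) rest o ^+ 2 <=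
  6 * (err1 o u v ^+ 2 + err2 o u v ^+ 2 + err3 o u ^+ 2 + err3 o v ^+ 2 + err4 o u ^+ 2 + err4 o v ^+ 2)
  + Mb * (~~ good o)%:R.
Proof.
move=> uv auv; have L0 := L_ge0 u.
have Mb0 : 0 <= Mb by rewrite /Mb; nneg.
have dR : diff (upair u v) rest o = diff (upair u v) tstat o - ecoef u v - wedge mu tcoef o u v.
  rewrite -addrA -opprD -(diff_U muS mu0 o uv tcoefS ecoefS) /diff /rest.
  by move: (tstat _) (tstat _) (Upoly _ _ _ _) (Upoly _ _ _ _) => *; ring.
rewrite dR; have [go|bo] := boolP (good o).
  rewrite mulr0 addr0; have := diff_R_le uv auv go.
  set x := _ - _ - wedge _ _ _ _ _; move: (err1 o u v) (err2 o u v) (err3 o u) (err3 o v) (err4 o u) (err4 o v) => a b c d f g h.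
  rewrite -(real_normK (num_real x)).
  apply: le_trans (_ : (a + `|b| + (c + d) / 2 + (`|f| + `|g|) / 2) ^+ 2 <= _).
    by rewrite lerXn2r ?nnegrE // (le_trans (normr_ge0 x)).
  apply: le_trans (sqr4_le _ _ _ _) _.
  have s2 (y z : R) : ((y + z) / 2) ^+ 2 <= (y ^+ 2 + z ^+ 2) / 2.
    rewrite -subr_ge0 [leRHS](_ : _ = ((y - z) / 2) ^+ 2); last by field.
    exact: sqr_ge0.
  have := s2 c d; have := s2 `|f| `|g|; rewrite !real_normK ?num_real //.
  have := sqr_ge0 a; have := sqr_ge0 b; have := sqr_ge0 c; have := sqr_ge0 d.
  have := sqr_ge0 f; have := sqr_ge0 g.
  by move: (_ ^+ 2) ((_ / 2) ^+ 2) => *; lra.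
rewrite mulr1 -[leLHS]add0r; apply: lerD; first by nneg.
rewrite -(real_normK (num_real (_ - _ - _))) lerXn2r ?nnegrE //.
  by rewrite !addr_ge0 ?mulr_ge0 ?exprn_ge0 // (le_trans (normr_ge0 (ecoef u v))).
have sS : `|wedge mu tcoef o u v| <= n%:R * L ^+ 3.
  apply: le_trans (ler_norm_sum _ _ _) _; rewrite -sum_cst; apply: ler_sum => k _.
  case/andP: (tcoef_le u v k) => c0 c1.
  rewrite normrM (ger0_norm c0) normrM -[leRHS]mulr1; apply: ler_pM; [|by rewrite mulr_ge0| |] => //.
  by rewrite mulr_ile1 // (norm_xedge_le muq q1).
have sT : `|diff (upair u v) tstat o| <= n%:R ^+ 3.
  rewrite /diff ler_norml; have := tstat_ge0 (upd o (upair u v) true); have := tstat_ge0 (upd o (upair u v) false).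
  have := tstat_le (upd o (upair u v) true); have := tstat_le (upd o (upair u v) false).
  by move: (tstat _) (tstat _) => *; apply/andP; split; lra.
apply: le_trans (ler_normB _ _) _; apply: lerD => //.
by apply: le_trans (ler_normB _ _) _; apply: lerD.
Qed.

(* The derivative does not depend on the edge [uv] itself, so assuming it absent costs a factor [1 / (1 - mu u v)]. *)
Lemma Ex_diff_R u v : u != v -> E (fun o => diff (upair u v) rest o ^+ 2) <= rem_bound.
Proof.
move=> uv; have L0 := L_ge0 u.
have Mb0 : 0 <= Mb by rewrite /Mb; nneg.
set X := E _.
have X0 : 0 <= X by apply: (Ex_ge0 pedge01') => o; nneg.
have h1 : E (fun o => (1 - edge o u v) * diff (upair u v) rest o ^+ 2) = (1 - mu u v) * X.
  rewrite (eq_Ex _ (G := fun o => (fun b : bool => 1 - b%:R) (o (upair u v)) * diff (upair u v) rest o ^+ 2)); last first.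
    by move=> o; rewrite /edge /adj uv.
  rewrite (@Ex_indep _ _ (pedge mu) (upair u v) (fun b : bool => 1 - b%:R)); last by move=> o b; rewrite diff_indep.
  by rewrite (pedge_upair muS) //=; congr (_ * _); ring.
have h2 : E (fun o => (1 - edge o u v) * diff (upair u v) rest o ^+ 2) <=
  E (fun o => 6 * (err1 o u v ^+ 2 + err2 o u v ^+ 2 + err3 o u ^+ 2 + err3 o v ^+ 2 + err4 o u ^+ 2 + err4 o v ^+ 2)
  + Mb * (~~ good o)%:R).
  apply: (le_Ex pedge01') => o; rewrite /edge.
  have [auv|auv] := boolP (adj o u v).
    by rewrite subrr mul0r; nneg.
  by rewrite subr0 mul1r; apply: diff_R_bound => //; exact: negbTE.
have h3 : E (fun o => 6 * (err1 o u v ^+ 2 + err2 o u v ^+ 2 + err3 o u ^+ 2 + err3 o v ^+ 2 + err4 o u ^+ 2 + err4 o v ^+ 2)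
  + Mb * (~~ good o)%:R) <= rem_bound / 2.
  rewrite ExD !ExZ !ExD.
  have := Ex_err1 uv; have := Ex_err2 u v; have := Ex_err3 u; have := Ex_err3 v.
  have := Ex_err4 u; have := Ex_err4 v; have := ler_wpM2l Mb0 bad_le.
  by rewrite /rem_bound /N2; lra.
have m2 : 1 / 2 <= 1 - mu u v by case/andP: (muq u v) => _ mq; have := q2; lra.
have := ler_wpM2r X0 m2; move: h1 h2 h3; lra.
Qed.

Theorem var_R : E (fun o => (rest o - E rest) ^+ 2) <= n%:R ^+ 2 * q * rem_bound / 2.
Proof.
apply: le_trans (efron_stein pedge01' _) _.
(* The signs of [q] and [L] are obtained from a vertex, so the empty graph is treated apart. *)
have [n0|/card_gt0P[w _]] := posnP #|'I_n|.
  rewrite big1 => [|[i j] _]; last by have := card0_eq n0 i.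
  by move: n0; rewrite card_ord => ->; rewrite expr0n !mul0r.
have L0 := L_ge0 w; have q0 := q_ge0 muq w; have M0 := Mo_ge0 w.
have rb0 : 0 <= rem_bound.
  have dl0 : 0 <= dl by apply: le_trans bad_le; apply: (Ex_ge0 pedge01') => o; nneg.
  by rewrite /rem_bound /N2 /Mb; nneg.
apply: le_trans (sum_bvar_le muS mu0 muq q1 Ex_diff_R (fun _ _ => rb0)) _.
by rewrite !sum_cst; apply: le_of_eq; ring.
Qed.

End Total.
End Rem.

(** * Rates *)

Section Algebra.
Context (R : realFieldType).

(* To be used with [x = 1 / (n p)], [y = p] and [N = n]. *)
Lemma stein_rate (x y N D D2 b2 c2 : R) : 0 < x <= 1 -> 0 < y <= 1 -> N = (x * y)^-1 ->
  0 <= b2 <= D2 * (x * y ^+ 2) -> 0 <= c2 <= D * x ^+ 3 -> 0 <= D -> 0 <= D2 ->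
  16 * b2 + 200 * N ^+ 4 * c2 ^+ 2 * y ^+ 5 + 48 * N ^+ 3 * c2 ^+ 2 * y ^+ 3
   + 2 * N ^+ 4 * y ^+ 4 * c2 * (6 * b2 + 2 * N * c2 * y ^+ 2 + c2)
  <= (16 * D2 + 254 * D ^+ 2 + 12 * D * D2) * (x + y).
Proof.
move=> /andP[x0 x1] /andP[y0 y1] NE /andP[b0 bD] /andP[c20 cD] D0 D20.
have x0' := ltW x0; have y0' := ltW y0.
have N0 : 0 <= N by rewrite NE invr_ge0 mulr_ge0.
have xn : x != 0 by rewrite gt_eqF.
have yn : y != 0 by rewrite gt_eqF.
have tcoef : c2 ^+ 2 <= (D * x ^+ 3) ^+ 2 by rewrite lerXn2r ?nnegrE // mulr_ge0 // exprn_ge0.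
apply: le_trans (_ : 16 * (D2 * (x * y ^+ 2)) + 200 * N ^+ 4 * (D * x ^+ 3) ^+ 2 * y ^+ 5
  + 48 * N ^+ 3 * (D * x ^+ 3) ^+ 2 * y ^+ 3
  + 2 * N ^+ 4 * y ^+ 4 * (D * x ^+ 3) * (6 * (D2 * (x * y ^+ 2)) + 2 * N * (D * x ^+ 3) * y ^+ 2 + D * x ^+ 3) <= _).
  apply: lerD; first apply: lerD; first apply: lerD.
  - exact: ler_wpM2l.
  - by apply: ler_wpM2r; [nneg|apply: ler_wpM2l => //; nneg].
  - by apply: ler_wpM2r; [nneg|apply: ler_wpM2l => //; nneg].
  apply: ler_pM; [nneg|nneg|by apply: ler_wpM2l => //; nneg|].
  apply: lerD => //; apply: lerD; first exact: ler_wpM2l.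
  by apply: ler_wpM2r; [nneg|apply: ler_wpM2l => //; nneg].
(* Substituting [N = (x * y)^-1] leaves monomials in [x] and [y] with nonnegative exponents, each at
   most [x] or [y]. *)
rewrite [leLHS](_ : _ = 16 * D2 * (x * y ^+ 2) + 200 * D ^+ 2 * (x ^+ 2 * y) + 48 * D ^+ 2 * x ^+ 3
  + (12 * D * D2 * y ^+ 2 + 4 * D ^+ 2 * (x * y) + 2 * D ^+ 2 * x ^+ 2)); last first.
  by rewrite NE; field; rewrite xn yn.
have h1 : x * y ^+ 2 <= x by rewrite ler_piMr // exprn_ile1.
have h2 : x ^+ 2 * y <= x by rewrite expr2 -mulrA ler_piMr // mulr_ile1 // mulr_ge0.
have h3 : x ^+ 3 <= x by rewrite exprS ler_piMr // exprn_ile1.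
have h4 : y ^+ 2 <= y by rewrite expr2 ler_piMr.
have h5 : x * y <= x by rewrite ler_piMr.
have h6 : x ^+ 2 <= x by rewrite expr2 ler_piMr.
have DD : 0 <= D ^+ 2 by nneg.
have k1 := ler_wpM2l (_ : 0 <= 16 * D2) h1.
have k2 := ler_wpM2l (_ : 0 <= 200 * D ^+ 2) h2.
have k3 := ler_wpM2l (_ : 0 <= 48 * D ^+ 2) h3.
have k4 := ler_wpM2l (_ : 0 <= 12 * D * D2) h4.
have k5 := ler_wpM2l (_ : 0 <= 4 * D ^+ 2) h5.
have k6 := ler_wpM2l (_ : 0 <= 2 * D ^+ 2) h6.
apply: le_trans (_ : 16 * D2 * x + 200 * D ^+ 2 * x + 48 * D ^+ 2 * x +
  (12 * D * D2 * y + 4 * D ^+ 2 * x + 2 * D ^+ 2 * x) <= _).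
  by apply: lerD; [apply: lerD; [apply: lerD|]|apply: lerD; [apply: lerD|]];
    [apply: k1|apply: k2|apply: k3|apply: k4|apply: k5|apply: k6]; nneg.
rewrite -subr_ge0 [leRHS](_ : _ = 16 * D2 * y + 254 * D ^+ 2 * y + 12 * D * D2 * x); last by ring.
by nneg.
Qed.

(** The factor [x ^+ 3] is split off because division by v_n^2 >= c x^3 consumes it. *)
Lemma remainder_rate (x y N ell eps : R) : 0 < x <= 1 -> 0 < y <= 1 -> N = (x * y)^-1 ->
  0 <= ell -> 0 <= eps ->
  let L := ell * x in let B := (ell ^+ 3 + ell ^+ 4) * (x ^+ 2 * y) in
  let Mo := 2 * 10 ^+ 3 * (N * y + 1) in
  N ^+ 2 * y * (12 * (L ^+ 8 * ((N ^+ 2 * y ^+ 4 + N * y ^+ 2) * Mo) + 4 * N * L ^+ 6 * y ^+ 3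
  + 2 * (L ^+ 10 * ((N ^+ 4 * y ^+ 6 + 4 * N ^+ 3 * y ^+ 5 + 2 * N ^+ 2 * y ^+ 3) * Mo))
  + 2 * (L ^+ 8 * (6 * (N ^+ 3 * y ^+ 5 + N ^+ 2 * y ^+ 3))))
  + 2 * (N ^+ 3 + B + N * L ^+ 3) ^+ 2 * (N * eps)) / 2
  <= (3 * 10 ^+ 4 * (ell ^+ 8 + ell ^+ 6) + 5 * 10 ^+ 5 * ell ^+ 10 + 2 * (1 + 2 * ell ^+ 3 + ell ^+ 4) ^+ 2)
   * x ^+ 3 * (x + y + N ^+ 12 * eps).
Proof.
move=> /andP[x0 x1] /andP[y0 y1] NE l0 e0 /=.
have x0' := ltW x0; have y0' := ltW y0.
have xn : x != 0 by rewrite gt_eqF.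
have yn : y != 0 by rewrite gt_eqF.
have N1 : 1 <= N by rewrite NE invf_ge1 ?mulr_gt0 // mulr_ile1.
have N0 : 0 <= N by exact: le_trans N1.
set B := (ell ^+ 3 + ell ^+ 4) * _.
set Mo := 2 * 10 ^+ 3 * (_ + 1).
set L := ell * x.
have L0 : 0 <= L by rewrite mulr_ge0.
have MoE : Mo <= 4 * 10 ^+ 3 / x.
  rewrite /Mo (_ : N * y = x^-1); last by rewrite NE; field; rewrite xn yn.
  by have : 1 <= x^-1 by [rewrite invf_ge1]; lra.
have Mb : (N ^+ 3 + B + N * L ^+ 3) ^+ 2 <= ((1 + 2 * ell ^+ 3 + ell ^+ 4) * N ^+ 3) ^+ 2.
  have N3 : 1 <= N ^+ 3 by rewrite exprn_ege1.
  have NN3 : N <= N ^+ 3 by rewrite exprS ler_peMr // exprn_ege1.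
  rewrite lerXn2r ?nnegrE; rewrite ?/B; [|nneg|nneg|].
    by [].
  have b1 : (ell ^+ 3 + ell ^+ 4) * (x ^+ 2 * y) <= (ell ^+ 3 + ell ^+ 4) * N ^+ 3.
    apply: ler_wpM2l; first by nneg.
    by apply: le_trans N3; rewrite mulr_ile1 ?exprn_ile1 // exprn_ge0.
  have b2 : N * L ^+ 3 <= N ^+ 3 * ell ^+ 3.
    apply: ler_pM => //; first by nneg.
    by rewrite /L exprMn ler_piMr ?exprn_ge0 // exprn_ile1.
  rewrite [leRHS](_ : _ = N ^+ 3 + (ell ^+ 3 + ell ^+ 4) * N ^+ 3 + N ^+ 3 * ell ^+ 3); last by ring.
  by apply: lerD => //; apply: lerD.
apply: le_trans (_ : N ^+ 2 * y * (12 * (L ^+ 8 * ((N ^+ 2 * y ^+ 4 + N * y ^+ 2) * (4 * 10 ^+ 3 / x)) + 4 * N * L ^+ 6 * y ^+ 3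
  + 2 * (L ^+ 10 * ((N ^+ 4 * y ^+ 6 + 4 * N ^+ 3 * y ^+ 5 + 2 * N ^+ 2 * y ^+ 3) * (4 * 10 ^+ 3 / x)))
  + 2 * (L ^+ 8 * (6 * (N ^+ 3 * y ^+ 5 + N ^+ 2 * y ^+ 3))))
  + 2 * ((1 + 2 * ell ^+ 3 + ell ^+ 4) * N ^+ 3) ^+ 2 * (N * eps)) / 2 <= _).
  apply: ler_wpM2r; first by rewrite invr_ge0.
  apply: ler_wpM2l; first by nneg.
  apply: lerD; last first.
    by apply: ler_wpM2r; [nneg|apply: ler_wpM2l].
  apply: ler_wpM2l => //; rewrite lerD2r; apply: lerD.
    by rewrite lerD2r; apply: ler_wpM2l; [nneg|apply: ler_wpM2l => //; nneg].
  by apply: ler_wpM2l => //; apply: ler_wpM2l; [nneg|apply: ler_wpM2l => //; nneg].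
set S := (1 + 2 * ell ^+ 3 + ell ^+ 4) ^+ 2.
have S0 : 0 <= S by rewrite /S; nneg.
rewrite [leLHS](_ : _ = x ^+ 3 * (6 * (4 * 10 ^+ 3 * ell ^+ 8 * (x + y) + 4 * ell ^+ 6 * y
   + 8 * 10 ^+ 3 * ell ^+ 10 * (y + 4 * (x * y) + 2 * x ^+ 2) + 12 * ell ^+ 8 * (x + y)))
   + S * (y * N ^+ 9 * eps)); last first.
  by rewrite /S /L NE; field; rewrite xn yn.
have h5 : x * y <= y by rewrite ler_piMl.
have h6 : x ^+ 2 <= x by rewrite expr2 ler_piMr.
(* Origin of n^12: the sum over edges gives N^2, the crude bound N^6 and the union bound N, together
   N^9; dividing by x^3 costs at most another N^3. *)
have t5 : y * N ^+ 9 * eps <= x ^+ 3 * (N ^+ 12 * eps).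
  rewrite mulrA; apply: ler_wpM2r => //.
  rewrite (_ : x ^+ 3 * N ^+ 12 = y^-1 ^+ 3 * N ^+ 9); last by rewrite NE; field; rewrite xn yn.
  apply: ler_wpM2r; first by nneg.
  by apply: (le_trans y1); apply: exprn_ege1; rewrite invf_ge1.
apply: le_trans (lerD (lexx _) (ler_wpM2l S0 t5)) _.
have l8 : 0 <= ell ^+ 8 by nneg.
have l6 : 0 <= ell ^+ 6 by nneg.
have l10 : 0 <= ell ^+ 10 by nneg.
have Ne : 0 <= N ^+ 12 * eps by nneg.
rewrite [leRHS](_ : _ = x ^+ 3 * ((3 * 10 ^+ 4 * (ell ^+ 8 + ell ^+ 6) + 5 * 10 ^+ 5 * ell ^+ 10) * (x + y + N ^+ 12 * eps)
   + 2 * S * (x + y + N ^+ 12 * eps))); last by ring.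
rewrite [leLHS](_ : _ = x ^+ 3 * (6 * (4 * 10 ^+ 3 * ell ^+ 8 * (x + y) + 4 * ell ^+ 6 * y
   + 8 * 10 ^+ 3 * ell ^+ 10 * (y + 4 * (x * y) + 2 * x ^+ 2) + 12 * ell ^+ 8 * (x + y)) + S * (N ^+ 12 * eps))); last by ring.
apply: ler_wpM2l; first by nneg.
apply: lerD; last first.
  rewrite -subr_ge0 [leRHS](_ : _ = S * (2 * x + 2 * y + N ^+ 12 * eps)); last by ring.
  by nneg.
apply: le_trans (_ : 6 * (4 * 10 ^+ 3 * ell ^+ 8 * (x + y) + 4 * ell ^+ 6 * y
   + 8 * 10 ^+ 3 * ell ^+ 10 * (y + 4 * y + 2 * x) + 12 * ell ^+ 8 * (x + y)) <= _).
  apply: ler_wpM2l => //; rewrite lerD2r lerD2l; apply: ler_wpM2l; first by nneg.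
  by apply: lerD; [rewrite lerD2l|]; apply: ler_wpM2l.
rewrite -subr_ge0 [leRHS](_ : _ = ell ^+ 8 * ((592 * 10 + 8) * (x + y)) + ell ^+ 6 * (3 * 10 ^+ 4 * x + (29 * 10 ^+ 3 + 976) * y)
   + ell ^+ 10 * (404 * 10 ^+ 3 * x + 26 * 10 ^+ 4 * y) + (3 * 10 ^+ 4 * (ell ^+ 8 + ell ^+ 6) + 5 * 10 ^+ 5 * ell ^+ 10) * (N ^+ 12 * eps)); last by ring.
by nneg.
Qed.

End Algebra.

(** * Explicit bounds when all edge probabilities are comparable to p *)

Section Rates.
Context (R : realFieldType) (n : nat) (mu : 'M[R]_n) (beta p : R).
Local Notation cfg := {ffun 'I_n * 'I_n -> bool}.
Implicit Types (o : cfg) (i j k l : 'I_n).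
Local Notation E := (Ex (pedge mu)).
Local Notation N := (n%:R : R).

Hypothesis muS : forall i j, mu i j = mu j i.
Hypothesis mu0 : forall i, mu i i = 0.
Hypothesis mu_bnd : forall i j, i != j -> beta * p <= mu i j <= p.
Hypothesis beta01 : 0 < beta < 1.
Hypothesis p_bnd : 0 < p <= 1 / 2.
Hypothesis n4 : (4 <= n)%N.
Hypothesis np1 : 1 <= N * p.

Let x : R := (N * p)^-1.
(** By [row_lower] an inverse mean degree is at most 2 x / beta, and [riL] asks for four times
    that. *)
Let ell : R := 8 / beta.
Let L : R := ell * x.
Let B : R := (ell ^+ 3 + ell ^+ 4) * (x ^+ 2 * p).
Let c0 : R := beta ^+ 3 / 192.

Let b0 : 0 < beta. Proof. by case/andP: beta01. Qed.
Let p0 : 0 < p. Proof. by case/andP: p_bnd. Qed.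
Let p1 : p <= 1. Proof. by case/andP: p_bnd => _; lra. Qed.
Let N0 : 0 < N. Proof. by rewrite ltr0n (leq_trans _ n4). Qed.
Let Np0 : 0 < N * p. Proof. exact: mulr_gt0. Qed.
Let x0 : 0 < x. Proof. by rewrite invr_gt0. Qed.
Let x1 : x <= 1. Proof. by rewrite invf_le1. Qed.
Let pn : p != 0. Proof. by rewrite gt_eqF. Qed.
Let Nn : N != 0. Proof. by rewrite gt_eqF. Qed.
Let bn : beta != 0. Proof. by rewrite gt_eqF. Qed.
Let NE : N = (x * p)^-1. Proof. by rewrite /x; field; rewrite pn Nn. Qed.
Let ell0 : 0 <= ell. Proof. by rewrite /ell divr_ge0 // ltW. Qed.
Let L0 : 0 <= L. Proof. by rewrite mulr_ge0 // ltW. Qed.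
Let B0 : 0 <= B. Proof. by have := ltW x0; have := ltW p0 => *; rewrite /B; nneg. Qed.
Let c00 : 0 < c0. Proof. by rewrite /c0 divr_gt0 // exprn_gt0. Qed.

Lemma mu_range i j : 0 <= mu i j <= p.
Proof.
have [->|/mu_bnd/andP[h ->]] := eqVneq i j; first by rewrite mu0 lexx ltW.
by rewrite andbT (le_trans _ h) // mulr_ge0 // ltW.
Qed.

Lemma row_lower i : beta * (N * p) / 2 <= row_mu mu i.
Proof.
have h j : beta * p - (if j == i then beta * p else 0) <= mu i j.
  by have [->|ji] := eqVneq j i; [rewrite mu0 subrr|rewrite subr0; case/andP: (mu_bnd (i := i) (j := j) (ltac:(by rewrite eq_sym)))].
rewrite /row_mu; apply: le_trans (ler_sum _ (fun j _ => h j)).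
rewrite sumrB sum_cst (sum_pred1 i (fun=> beta * p)).
have bp : 0 < beta * p by rewrite mulr_gt0.
have N4 : 4 <= N by rewrite (ler_nat R 4 n).
have := ler_wpM2r (ltW bp) N4; lra.
Qed.

Lemma row_upper i : row_mu mu i <= N * p.
Proof.
by rewrite /row_mu -sum_cst; apply: ler_sum => j _; case/andP: (mu_range i j).
Qed.

Lemma row_gt0 i : 0 < row_mu mu i.
Proof. by apply: lt_le_trans (row_lower i); rewrite divr_gt0 // mulr_gt0. Qed.

Lemma rinv_lower i : x <= rinv mu i.
Proof. by rewrite /rinv /x lef_pV2 ?posrE ?row_gt0 // row_upper. Qed.

Lemma rinv_upper i : 4 * rinv mu i <= L.
Proof.
have h : rinv mu i <= (beta * (N * p) / 2)^-1.
  by rewrite /rinv lef_pV2 ?posrE ?row_gt0 ?row_lower // divr_gt0 // mulr_gt0.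
rewrite (_ : L = 4 * (beta * (N * p) / 2)^-1); first by rewrite ler_wpM2l.
by rewrite /L /ell /x; field; rewrite pn Nn bn.
Qed.

Lemma rinv_L i : 0 <= rinv mu i <= L.
Proof.
have h := rinv_ge0 row_gt0 i; rewrite h /=.
by apply: le_trans (rinv_upper i); lra.
Qed.

Lemma gamma_sum_bound i j : 0 <= gamma_sum mu i j <= ell ^+ 3 * (x ^+ 2 * p).
Proof.
have cb := tcoef_le row_gt0 rinv_upper.
apply/andP; split.
  apply: sumr_ge0 => k _; case/andP: (cb i j k) => c _.
  by case/andP: (mu_range i k) => m1 _; case/andP: (mu_range k j) => m2 _; nneg.
rewrite (_ : ell ^+ 3 * _ = N * (p * p * L ^+ 3)); last by rewrite /L NE; field; rewrite pn gt_eqF.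
rewrite -sum_cst; apply: ler_sum => k _.
case/andP: (cb i j k) => c c'.
case/andP: (mu_range i k) => m1 m1'; case/andP: (mu_range k j) => m2 m2'.
by apply: ler_pM => //; [rewrite mulr_ge0|apply: ler_pM].
Qed.

Lemma eta_sum_bound i : 0 <= eta_sum mu i <= ell ^+ 4 * (x ^+ 2 * p).
Proof.
apply/andP; split.
  apply: sumr_ge0 => k _; apply: sumr_ge0 => l _.
  have := rinv_ge0 row_gt0 k; have := rinv_ge0 row_gt0 l => rl rk.
  case/andP: (mu_range i k) => m1 _; case/andP: (mu_range k l) => m2 _.
  by case/andP: (mu_range l i) => m3 _; nneg.
rewrite (_ : ell ^+ 4 * _ = N * (N * (p * p * p * (L ^+ 2 * L * L)))); last first.
  by rewrite /L NE; field; rewrite pn gt_eqF.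
rewrite -sum_cst; apply: ler_sum => k _; rewrite -sum_cst; apply: ler_sum => l _.
case/andP: (rinv_L i) => r1 r1'; case/andP: (rinv_L k) => r2 r2'; case/andP: (rinv_L l) => r3 r3'.
case/andP: (mu_range i k) => m1 m1'; case/andP: (mu_range k l) => m2 m2'.
case/andP: (mu_range l i) => m3 m3'.
have r2L : rinv mu i ^+ 2 <= L ^+ 2 by rewrite lerXn2r ?nnegrE.
by apply: ler_pM; [nneg|nneg|apply: ler_pM => //; [nneg|apply: ler_pM]|
  apply: ler_pM => //; [nneg|apply: ler_pM => //; nneg]].
Qed.

Lemma ecoef_bound i j : `|ecoef mu i j| <= B.
Proof.
case/andP: (gamma_sum_bound i j) => g0 g1; case/andP: (eta_sum_bound i) => e0 e1.
case/andP: (eta_sum_bound j) => e2 e3.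
have h : 0 <= ell ^+ 3 * (x ^+ 2 * p) by apply: le_trans g1.
have h' : 0 <= ell ^+ 4 * (x ^+ 2 * p) by apply: le_trans e1.
by rewrite ler_norml /ecoef /B mulrDl; apply/andP; split; lra.
Qed.

Lemma evar_bound i j : i != j -> beta * p / 2 <= evar mu i j.
Proof.
move=> ij; case/andP: (mu_bnd ij) => h1 h2; rewrite /evar.
have m2 : 1 / 2 <= 1 - mu i j by case/andP: p_bnd => _; lra.
have bp : 0 <= beta * p by rewrite mulr_ge0 // ltW.
rewrite [leLHS](_ : _ = beta * p * (1 / 2)); last by rewrite mul1r.
by apply: ler_pM => //; lra.
Qed.

(** Coinciding indices are discarded, and (n - 1)(n - 2) >= n^2 / 4 holds for n >= 4. *)
Lemma sum3_distinct (F : 'I_n -> 'I_n -> 'I_n -> R) (a : R) : 0 <= a ->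
  (forall i j k, 0 <= F i j k) ->
  (forall i j k, i != j -> j != k -> k != i -> a <= F i j k) ->
  N ^+ 3 / 4 * a <= sum3 F.
Proof.
move=> a0 F0 Fa.
have Nsub : 0 <= N - 2 by rewrite subr_ge0 (ler_nat R 2 n) (leq_trans _ n4).
have N4 : 4 <= N by rewrite (ler_nat R 4 n).
have h i j : (N - 2) * a - (if j == i then (N - 2) * a else 0) <= \sum_k F i j k.
  have [->|ji] := eqVneq j i; first by rewrite subrr sumr_ge0.
  rewrite subr0.
  have h k : a - (if k == i then a else 0) - (if k == j then a else 0) <= F i j k.
    have [->|ki] := eqVneq k i; first by rewrite subrr sub0r (le_trans _ (F0 _ _ _)) // oppr_le0; case: ifP.
    have [->|kj] := eqVneq k j; first by rewrite subr0 subrr.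
    by rewrite !subr0 Fa // eq_sym.
  apply: le_trans (ler_sum _ (fun k _ => h k)).
  rewrite !sumrB sum_cst (sum_pred1 i (fun=> a)) (sum_pred1 j (fun=> a)).
  by apply: le_of_eq; ring.
have h1 i : (N - 1) * ((N - 2) * a) <= \sum_j \sum_k F i j k.
  apply: le_trans (ler_sum _ (fun j _ => h i j)).
  rewrite sumrB sum_cst (sum_pred1 i (fun=> (N - 2) * a)).
  by apply: le_of_eq; ring.
apply: le_trans (ler_sum _ (fun i _ => h1 i)).
rewrite sum_cst -subr_ge0 [leRHS](_ : _ = N * a * ((N - 4) * (3 * N) / 4 + 2)); last by field.
have N4' : 0 <= N - 4 by lra.
by rewrite !mulr_ge0 ?addr_ge0 ?divr_ge0 ?mulr_ge0 // ltW.
Qed.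

(* Only the triangles contribute; [c0] collects [mu (1 - mu) >= beta p / 2] and [n (n - 1) (n - 2) >= n^3 / 4]. *)
Lemma variance_lower :
  c0 * x ^+ 3 <= E (fun o => Upoly mu (ecoef mu) (tcoef mu) o ^+ 2).
Proof.
rewrite (Ex_Upoly2 muS mu0 (tcoefS mu) (ecoefS muS)).
apply: ler_wpDl.
  by rewrite divr_ge0 // !sumr_ge0 // => i _; rewrite sumr_ge0 // => j _; rewrite mulr_ge0 ?sqr_ge0 ?(evar_ge0 mu_range p1).
pose a : R := (x * x * x) ^+ 2 * (beta * p / 2 * (beta * p / 2) * (beta * p / 2)).
have bp : 0 <= beta * p / 2 by rewrite divr_ge0 // mulr_ge0 // ltW.
have xx := ltW x0.
rewrite [leLHS](_ : _ = N ^+ 3 / 4 * a / 6); last first.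
  by rewrite /a /c0 NE; field; rewrite pn gt_eqF.
apply: ler_wpM2r; first (by rewrite invr_ge0); apply: sum3_distinct => [|i j k|i j k ij jk ki].
- by rewrite /a; nneg.
- have s1 := evar_ge0 mu_range p1 i j; have s2 := evar_ge0 mu_range p1 j k; have s3 := evar_ge0 mu_range p1 k i; nneg.
have s1 := evar_bound ij; have s2 := evar_bound jk; have s3 := evar_bound ki.
have r1 := rinv_lower i; have r2 := rinv_lower j; have r3 := rinv_lower k.
rewrite /a; apply: ler_pM; [nneg|nneg| |].
  rewrite lerXn2r ?nnegrE; [|nneg| |].
  - by [].
  - by case/andP: (tcoef_le row_gt0 rinv_upper i j k).
  by apply: ler_pM => //; [nneg|apply: ler_pM].
by apply: ler_pM => //; [nneg|apply: ler_pM].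
Qed.

Section Normalised.
Context (v : R).
Hypothesis v0 : 0 < v.
Hypothesis vE : v ^+ 2 = E (fun o => Upoly mu (ecoef mu) (tcoef mu) o ^+ 2).

Definition Xlead o : R := Upoly mu (ecoef mu) (tcoef mu) o / v.
Definition Xfull o : R := (tstat R o - E (tstat R (n:=n))) / v.

(** [D2] and [D] are the constants in B^2 / v^2 <= D2 x p^2 and L^6 / v^2 <= D x^3, both from
    [variance_lower]. *)
Let D2 : R := (ell ^+ 3 + ell ^+ 4) ^+ 2 / c0.
Let D : R := ell ^+ 6 / c0.
Definition stein_const : R := 16 * D2 + 254 * D ^+ 2 + 12 * D * D2.
Definition rem_const : R :=
  (3 * 10 ^+ 4 * (ell ^+ 8 + ell ^+ 6) + 5 * 10 ^+ 5 * ell ^+ 10 + 2 * (1 + 2 * ell ^+ 3 + ell ^+ 4) ^+ 2) / c0.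

Lemma v2_inv a : 0 <= a -> a / v ^+ 2 <= a / (c0 * x ^+ 3).
Proof.
move=> a0; apply: ler_wpM2l => //; rewrite lef_pV2 ?posrE; [|exact: exprn_gt0|].
  by rewrite vE variance_lower.
by apply: mulr_gt0 => //; apply: exprn_gt0.
Qed.

(** The norming is absorbed into the coefficients, as [stein_Upoly] asks for a polynomial of unit
    variance. *)
Lemma Xlead_Upoly o : Xlead o = Upoly mu (fun i j => ecoef mu i j / v) (fun i j k => tcoef mu i j k / v) o.
Proof.
rewrite /Xlead /Upoly /lin /tri mulrDl; congr (_ + _).
  rewrite mulrAC; congr (_ / _); rewrite mulr_suml; apply: eq_bigr => i _.
  by rewrite mulr_suml; apply: eq_bigr => j _; rewrite mulrAC.
rewrite mulrAC; congr (_ / _); rewrite mulr_suml; apply: eq_bigr => i _.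
rewrite mulr_suml; apply: eq_bigr => j _; rewrite mulr_suml; apply: eq_bigr => k _.
by rewrite mulrAC.
Qed.

Lemma Xlead2 : E (fun o => Xlead o ^+ 2) = 1.
Proof.
rewrite (eq_Ex _ (G := fun o => Upoly mu (ecoef mu) (tcoef mu) o ^+ 2 * (v ^+ 2)^-1)); last first.
  by move=> o; rewrite /Xlead exprMn exprVn.
by rewrite ExZr -vE divff // expf_neq0 // gt_eqF.
Qed.

Lemma Xlead_stein (f f' : R -> R) (K lam : R) : 0 < lam ->
  (forall s t, `|f s - f t - f' t * (s - t)| <= K * (s - t) ^+ 2) ->
  (forall s t, `|f' s - f' t| <= K * `|s - t|) -> (forall s, `|f' s| <= K) ->
  `|E (fun o => Xlead o * f (Xlead o)) - E (fun o => f' (Xlead o))|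
    <= K * (8 * lam + lam^-1 * (stein_const * (x + p))).
Proof.
move=> lam0 tay lip bnd.
have K0 : 0 <= K by apply: le_trans (bnd 0).
rewrite (eq_Ex _ (F := fun o => Xlead o * _) (G := fun o =>
  Upoly mu (fun i j => ecoef mu i j / v) (fun i j k => tcoef mu i j k / v) o *
  f (Upoly mu (fun i j => ecoef mu i j / v) (fun i j k => tcoef mu i j k / v) o))); last by move=> o; rewrite Xlead_Upoly.
rewrite (eq_Ex _ (F := fun o => f' _) (G := fun o =>
  f' (Upoly mu (fun i j => ecoef mu i j / v) (fun i j k => tcoef mu i j k / v) o))); last by move=> o; rewrite Xlead_Upoly.
have vn : `|v^-1| = v^-1 by rewrite ger0_norm // invr_ge0 ltW.
have vi0 : 0 <= v^-1 by rewrite invr_ge0 ltW.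
apply: le_trans (stein_Upoly muS mu0 (q := p) (C := L ^+ 3 / v) mu_range p1 (B := B / v) _ _ _ _ _ _ lam0 _ tay lip bnd) _.
- by split=> i j k; [rewrite (tcoefS mu).1|rewrite (tcoefS mu).2].
- by move=> i j; rewrite (ecoefS muS).
- by nneg.
- move=> i j k; rewrite normrM vn ler_wpM2r //.
  by case/andP: (tcoef_le row_gt0 rinv_upper i j k) => c c'; rewrite ger0_norm.
- by nneg.
- by move=> i j; rewrite normrM vn ler_wpM2r // ecoef_bound.
- by rewrite -[RHS]Xlead2; apply: eq_Ex => o; rewrite Xlead_Upoly.
apply: ler_wpM2l => //; rewrite lerD2l; apply: ler_wpM2l; first by rewrite invr_ge0 ltW.
have xx := ltW x0; have pp := ltW p0.
have D0 : 0 <= D by rewrite divr_ge0 ?(ltW c00) //; nneg.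
have D20 : 0 <= D2 by rewrite divr_ge0 ?(ltW c00) //; nneg.
have b2 : 0 <= (B / v) ^+ 2 <= D2 * (x * p ^+ 2).
  rewrite sqr_ge0 /= exprMn exprVn; apply: le_trans (v2_inv _) _; first by nneg.
  by apply: le_of_eq; rewrite /D2 /B; field; rewrite !gt_eqF.
have c2 : 0 <= (L ^+ 3 / v) ^+ 2 <= D * x ^+ 3.
  rewrite sqr_ge0 /= exprMn exprVn; apply: le_trans (v2_inv _) _; first by nneg.
  by apply: le_of_eq; rewrite /D /L; field; rewrite !gt_eqF.
have x01 : 0 < x <= 1 by rewrite x0.
have y01 : 0 < p <= 1 by rewrite p0.
rewrite (_ : (L ^+ 3 / v) ^+ 4 = ((L ^+ 3 / v) ^+ 2) ^+ 2); last by rewrite -[RHS]exprM.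
exact: (stein_rate x01 y01 NE b2 c2 D0 D20).
Qed.

Lemma Xlead_mean : E Xlead = 0.
Proof.
rewrite (eq_Ex _ (G := fun o => Upoly mu (ecoef mu) (tcoef mu) o * v^-1)) // ExZr.
rewrite (eq_Ex _ (G := fun o => \sum_e cent (pedge mu) e o *
   diff e (Upoly mu (ecoef mu) (fun i j k => tcoef mu i j k / 3)) o)); last first.
  by move=> o; exact: (Upoly_euler muS mu0 o (tcoefS mu) (ecoefS muS)).
rewrite Ex_sum big1 ?mul0r // => e _; apply: Ex_cent => o b.
exact: diff_indep.
Qed.

Lemma Xfull_lead (eps : R) :
  E (fun o => (~~ good mu o)%:R) <= N * eps ->
  E (fun o => (Xfull o - Xlead o) ^+ 2) <= rem_const * (x + p + N ^+ 12 * eps).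
Proof.
move=> bad.
have eps0 : 0 <= eps.
  rewrite -(pmulr_rge0 _ N0); apply: le_trans bad.
  by apply: (Ex_ge0 (pedge01 mu_range p1)) => o; nneg.
have p2 : p <= 1 / 2 by case/andP: p_bnd.
have vn : v != 0 by rewrite gt_eqF.
have EU : E (Upoly mu (ecoef mu) (tcoef mu)) = 0.
  have := Xlead_mean; rewrite /Xlead ExZr => /eqP.
  by rewrite mulf_eq0 invr_eq0 (negPf vn) orbF => /eqP.
have ER : E (rest mu) = E (tstat R (n:=n)) by rewrite /rest ExB EU subr0.
rewrite (eq_Ex _ (G := fun o => (rest mu o - E (rest mu)) ^+ 2 * (v ^+ 2)^-1)); last first.
  by move=> o; rewrite ER /Xfull /Xlead /rest -mulrBl exprMn exprVn; congr (_ ^+ 2 * _); ring.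
rewrite ExZr.
have V := var_R muS mu0 mu_range p1 row_gt0 rinv_upper ecoef_bound bad p2.
have x01 : 0 < x <= 1 by rewrite x0.
have y01 : 0 < p <= 1 by rewrite p0.
have RR := remainder_rate x01 y01 NE ell0 eps0.
have W := le_trans V RR.
apply: le_trans (ler_wpM2r _ W) _; first by rewrite invr_ge0 sqr_ge0.
apply: le_trans (v2_inv _) _.
  by apply: le_trans W; apply: (Ex_ge0 (pedge01 mu_range p1)) => o; nneg.
by apply: le_of_eq; rewrite /rem_const; field; rewrite !gt_eqF.
Qed.

End Normalised.
End Rates.

Lemma stein_const_ge0 (R : realFieldType) (beta : R) : 0 < beta -> 0 <= stein_const beta.
Proof.
move=> /ltW b0; rewrite /stein_const.
have e0 : 0 <= 8 / beta by rewrite divr_ge0 ?ler0n.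
have c0 : 0 <= beta ^+ 3 / 192 by rewrite divr_ge0 ?ler0n ?exprn_ge0.
set D2 : R := (_ + _) ^+ 2 / _; set D : R := _ ^+ 6 / _.
have D20 : 0 <= D2 by rewrite divr_ge0 ?sqr_ge0.
have D0 : 0 <= D by rewrite divr_ge0 ?exprn_ge0.
by move: D2 D D20 D0 => a b a0 b0'; nneg.
Qed.

(** * Lower tails of the degrees *)

Section Chernoff.
Context (R : realType) (n : nat) (mu : 'M[R]_n) (q : R).
Hypothesis muS : forall i j, mu i j = mu j i.
Hypothesis mu0 : forall i, mu i i = 0.
Hypothesis muq : forall i j, 0 <= mu i j <= q.
Hypothesis q1 : q <= 1.
Local Notation E := (Ex (pedge mu)).

Lemma expRN1_le : expR (- 1) <= 1 / 2 :> R.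
Proof.
rewrite expRN -[1 / 2]/(1 * 2^-1) mul1r lef_pV2 ?posrE ?expR_gt0 //.
by have := expR_ge1Dx (1 : R); lra.
Qed.

(** Each factor satisfies 1 - mu (1 - 1/e) <= 1 - mu / 2 <= exp(- mu / 2). *)
Lemma degree_laplace w : E (fun o => expR (- deg R o w)) <= expR (- (row_mu mu w / 2)).
Proof.
rewrite (eq_Ex _ (G := fun o => \prod_j (if adj o w j then expR (- 1) else 1))); last first.
  move=> o; rewrite /deg -sumrN expR_sum; apply: eq_bigr => j _.
  by rewrite /edge; case: adj; rewrite ?oppr0 ?expR0.
rewrite (Ex_prod_adj muS mu0) /row_mu mulr_suml -sumrN expR_sum.
apply: ler_prod => j _; case/andP: (muq w j) => m0 mq.
have e0 := expR_ge0 (- 1 : R); have e1 := expRN1_le.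
have m1 : mu w j <= 1 by apply: le_trans q1.
have h1 : mu w j * (1 - expR (- 1)) <= 1 * 1 by apply: ler_pM => //; lra.
have h2 : mu w j * (1 / 2) <= mu w j * (1 - expR (- 1)) by apply: ler_wpM2l => //; lra.
have h3 := expR_ge1Dx (- (mu w j / 2)).
by apply/andP; split; lra.
Qed.

(** Union bound and Markov's inequality for exp(- d_w): the threshold at a quarter of the mean costs
    exp(mu_w / 4) against the gain exp(- mu_w / 2). *)
Lemma bad_prob r0 : (forall i, r0 <= row_mu mu i) ->
  E (fun o => (~~ good mu o)%:R) <= n%:R * expR (- (r0 / 4)).
Proof.
move=> hr.
apply: le_trans (_ : E (fun o => \sum_w expR (row_mu mu w / 4) * expR (- deg R o w)) <= _).
  apply: (leE muq q1) => o; have [_ /=|] := boolP (good mu o).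
    by rewrite sumr_ge0 // => w _; rewrite mulr_ge0 ?expR_ge0.
  rewrite /good negb_forall => /existsP[w]; rewrite -ltNge => hw; rewrite (bigD1 w) //= ler_wpDr //.
    by rewrite sumr_ge0 // => i _; rewrite mulr_ge0 ?expR_ge0.
  by rewrite -expRD -[leLHS]expR0 ler_expR; lra.
rewrite Ex_sum -sum_cst; apply: ler_sum => w _; rewrite ExZ.
apply: le_trans (ler_wpM2l (expR_ge0 _) (degree_laplace w)) _.
by rewrite -expRD ler_expR; have := hr w; lra.
Qed.
End Chernoff.

(** * Stein's equation and convergence of distribution functions *)

Section SteinEquation.
Context (R : realType).
Implicit Types (u f g h : R -> R) (K M : R).
Local Notation leb := (@lebesgue_measure R).
Local Notation phi := (@normal_pdf R 0 1).

Definition gmean u : R := \int[leb]_x (u x * phi x).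

Lemma phi_gt0 x : 0 < phi x.
Proof.
by rewrite normal_pdfE ?oner_eq0 // mulr_gt0 ?expR_gt0 // normal_peak_gt0 // oner_eq0.
Qed.

Lemma is_derive_half_sqr (x : R) : is_derive x 1 (fun y : R => - (y ^+ 2 / 2)) (- x).
Proof.
have -> : (fun y : R => - (y ^+ 2 / 2)) = (fun y => (- 2^-1) *: (y ^+ 2 : R)).
  by apply/funext => y; rewrite /GRing.scale /= mulNr mulrC.
by apply: is_derive_eq; rewrite /GRing.scale /=; field.
Qed.

Lemma is_derive_phi (x : R) : is_derive x 1 phi (- x * phi x).
Proof.
have -> : phi = normal_peak 1 \*: (expR \o (fun y => - (y ^+ 2 / 2))).
  apply/funext => y; rewrite normal_pdfE ?oner_eq0 // /normal_fun subr0.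
  by congr (_ * expR _); rewrite expr1n mulr2n mulNr.
have h := is_derive1_comp (g := fun y => - (y ^+ 2 / 2))
  (is_derive_expR (- (x ^+ 2 / 2))) (is_derive_half_sqr x).
apply: (is_derive_eq (is_deriveZ (normal_peak 1) h)).
by rewrite /= /GRing.scale /=; ring.
Qed.

Definition lipschitz u K := forall x y, `|u x - u y| <= K * `|x - y|.

Lemma lipschitz_ge0 u K : lipschitz u K -> 0 <= K.
Proof.
by move=> h; have := le_trans (normr_ge0 _) (h 1 0); rewrite subr0 normr1 mulr1.
Qed.

Lemma lipschitz_continuous u K : lipschitz u K -> continuous u.
Proof.
move=> lu x; have K0 := lipschitz_ge0 lu.
apply/cvgrPdist_le => e e0; near=> t.
apply: le_trans (lu _ _) _.
apply: le_trans (_ : K * (e / (K + 1)) <= _).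
  apply: ler_wpM2l => //; near: t.
  by apply: cvgr_dist_le; [exact: cvg_id|rewrite divr_gt0 // ltr_wpDl].
rewrite mulrCA -[leRHS]mulr1 ler_pM2l // ler_pdivrMr ?ltr_wpDl // mul1r lerDl //.
Unshelve. all: by end_near. Qed.

Lemma gmean_integrable u K (A : set R) : measurable A -> continuous u -> (forall x, `|u x| <= K) ->
  leb.-integrable A (EFin \o (fun x => u x * phi x)).
Proof.
move=> mA cu bu.
have -> : EFin \o (fun x => u x * phi x) = ((EFin \o u) \* (fun x => (phi x)%:E))%E.
  by apply/funext => x /=; rewrite EFinM.
apply: integrableMr => //.
- exact: measurable_funTS (continuous_measurable_fun cu).
- by exists K; split; [exact: num_real|move=> y Ky x _; apply: le_trans (bu x) (ltW Ky)].
- exact: integrableS (integrable_normal_pdf 0 1).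
Qed.

Section Solve.
Variables (u : R -> R) (K0 M : R).
Hypotheses (lu : lipschitz u K0) (M0 : 0 < M) (uM : forall x, M <= `|x| -> u x = 0).
Hypothesis gmean0 : gmean u = 0.

Let K1 := K0 * (2 * M).

Let u_le x : `|u x| <= K1.
Proof.
have K00 := lipschitz_ge0 lu.
have [Mx|xM] := leP M `|x|.
  by rewrite uM // normr0 /K1 !mulr_ge0 // ltW.
have := lu x M; rewrite (uM (_ : M <= `|M|)) ?subr0; last by rewrite ler_norm.
move/le_trans; apply; rewrite /K1; apply: ler_wpM2l => //.
by apply: le_trans (ler_normB _ _) _; rewrite (gtr0_norm M0) mulr2n mulrDl mul1r lerD2r ltW.
Qed.
Let uc : continuous u. Proof. exact: lipschitz_continuous lu. Qed.

Definition gprim x : R := \int[leb]_(t in `]-oo, x]) (u t * phi t).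

Let phic : continuous phi. Proof. by apply: continuous_normal_pdf; rewrite oner_eq0. Qed.

Let gprim_derive (x : R) : is_derive x 1 gprim (u x * phi x).
Proof.
have cf : {for x, continuous (fun t => u t * phi t)}.
  by apply: cvgM; [exact: uc|exact: phic].
have xu : x < x + 1 by rewrite ltrDl.
have fi : leb.-integrable [set` `]-oo, x + 1]] (EFin \o (fun t => u t * phi t)).
  by apply: (gmean_integrable (K := K1)) => //; exact: measurable_itv.
have [|df f'] := continuous_FTC1 xu fi _ cf; first by rewrite ltNyr.
by apply: DeriveDef; [exact: df|rewrite -derive1E; exact: f'].
Qed.

(** To the left the integrand vanishes; to the right the primitive is the full Gaussian mean. This
    is where [gmean0] is needed. *)
Let gprim_out x : M <= `|x| -> gprim x = 0.
Proof.
rewrite ler_normr => /orP[Mx|xM]; rewrite /gprim Rintegral_mkcond.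
  rewrite -[RHS]gmean0 /gmean; congr (Rintegral _ _ _); apply/funext => t.
  rewrite /patch; case: ifPn => // /negP xt.
  rewrite uM ?mul0r //; apply: le_trans Mx _; apply: le_trans (ler_norm _).
  rewrite leNgt; apply/negP => tx; apply: xt; rewrite inE /= in_itv /=; exact: ltW.
transitivity (Rintegral leb setT (fun=> 0 : R)); last first.
  by rewrite Rintegral_cst // mul0r.
congr (Rintegral _ _ _); apply/funext => t.
rewrite /patch; case: ifPn => //; rewrite inE /= in_itv /= => tx.
rewrite uM ?mul0r // ler_normr; apply/orP; right.
by apply: le_trans xM _; rewrite lerN2.
Qed.

Definition sol x : R := gprim x / phi x.

Let sol_derive (x : R) : is_derive x 1 sol (u x + x * sol x).
Proof.
have p0 : phi x != 0 by rewrite gt_eqF // phi_gt0.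
have -> : sol = gprim * (fun y => (phi y)^-1) by [].
apply: (is_derive_eq (is_deriveM (gprim_derive x) (is_deriveV p0 (is_derive_phi x)))).
have e : (gprim * (fun y => (phi y)^-1)) x = gprim x / phi x by [].
rewrite /= /GRing.scale /= e; move: (gprim x) (u x) p0 => F U; move: (phi x) => p p0.
by field.
Qed.

Let sol_cont : continuous sol.
Proof.
move=> x; apply: differentiable_continuous; apply/derivable1_diffP.
by have [] := sol_derive x.
Qed.

Let sol_out x : M <= `|x| -> sol x = 0.
Proof. by move=> Mx; rewrite /sol gprim_out // mul0r. Qed.

(** A continuous function vanishing outside a compact interval; no estimate of Gaussian tails
    enters. *)
Lemma sol_bounded : exists K, forall x, `|sol x| <= K.
Proof.
have MM : - M <= M by have := M0; lra.
have cn : {within `[- M, M], continuous (fun x => `|sol x|)}.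
  apply: continuous_subspaceT => x; apply: continuous_comp; first exact: sol_cont.
  exact: norm_continuous.
have [c _ hc] := EVT_max MM cn.
exists `|sol c| => x; have [Mx|xM] := leP M `|x|.
  by rewrite sol_out // normr0.
by apply: hc; rewrite in_itv /= -ler_norml ltW.
Qed.

(** The derivative is u(x) + x sol(x). Its Lipschitz bound rests on [sol] vanishing for |x| >= M,
    which keeps the factor x bounded; the Taylor bound then follows from the mean value theorem. *)
Lemma stein_equation : exists f f' K,
  [/\ forall x, u x = f' x - x * f x,
      forall s t, `|f s - f t - f' t * (s - t)| <= K * (s - t) ^+ 2,
      forall s t, `|f' s - f' t| <= K * `|s - t|
    & forall s, `|f' s| <= K].
Proof.
have [Ks hs] := sol_bounded.
have Ks0 : 0 <= Ks by apply: le_trans (hs 0).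
have K00 := lipschitz_ge0 lu.
have K10 : 0 <= K1 by rewrite /K1 !mulr_ge0 // ltW.
pose f' x := u x + x * sol x.
have xs x : `|x * sol x| <= M * Ks.
  have [Mx|xM] := leP M `|x|.
    by rewrite sol_out // mulr0 normr0 mulr_ge0 // ltW.
  by rewrite normrM ler_pM // ltW.
have f'b x : `|f' x| <= K1 + M * Ks.
  by apply: le_trans (ler_normD _ _) _; apply: lerD.
have mvt s t : exists2 c, `|c - t| <= `|s - t| & sol s - sol t = f' c * (s - t).
  have [st|ts|->] := ltgtP s t; last by exists t; rewrite !subrr ?mulr0.
    have [|c ct e] := @MVT R sol f' s t st (fun x _ => sol_derive x).
      by apply: continuous_subspaceT.
    exists c; last by rewrite -[LHS]opprB e; ring.
    by move: ct; rewrite in_itv /= => /andP[sc ct]; rewrite !ltr0_norm ?subr_lt0 // !opprB; lra.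
  have [|c ct e] := @MVT R sol f' t s ts (fun x _ => sol_derive x).
    by apply: continuous_subspaceT.
  exists c => //.
  by move: ct; rewrite in_itv /= => /andP[sc ct]; rewrite !gtr0_norm ?subr_gt0 //; lra.
have sl s t : `|sol s - sol t| <= (K1 + M * Ks) * `|s - t|.
  by have [c _ ->] := mvt s t; rewrite normrM; apply: ler_wpM2r.
pose K2 := K0 + M * (K1 + M * Ks) + Ks.
have f'l s t : `|f' s - f' t| <= K2 * `|s - t|.
  (* Only one of the two points has to lie inside the interval; if both are outside, the difference
     is zero. *)
  have key x y : `|x| < M -> `|x * sol x - y * sol y| <= (M * (K1 + M * Ks) + Ks) * `|x - y|.
    move=> xM.
    rewrite (_ : _ - _ = x * (sol x - sol y) + (x - y) * sol y); last by ring.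
    apply: le_trans (ler_normD _ _) _; rewrite (normrM x) (normrM (x - y)) mulrDl; apply: lerD.
      rewrite -mulrA; apply: ler_pM => //; exact: ltW.
    by rewrite [leLHS]mulrC; apply: ler_wpM2r.
  have h : `|s * sol s - t * sol t| <= (M * (K1 + M * Ks) + Ks) * `|s - t|.
    have [Ms|sM] := leP M `|s|; last exact: key.
    have [Mt|tM] := leP M `|t|; last by rewrite distrC [`|s - t|]distrC; exact: key.
    rewrite !sol_out // !mulr0 subrr normr0.
    by have M0' := ltW M0; nneg.
  rewrite (_ : f' s - f' t = (u s - u t) + (s * sol s - t * sol t)); last by rewrite /f'; ring.
  apply: le_trans (ler_normD _ _) _.
  apply: le_trans (lerD (lu s t) h) _.
  by rewrite /K2 -!mulrDl addrA.
have K20 : 0 <= K2 by exact: lipschitz_ge0 f'l.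
exists sol, f', (K2 + (K1 + M * Ks)).
have b0 : 0 <= K1 + M * Ks by apply: le_trans (f'b 0).
split=> [x|s t|s t|s].
- by rewrite /f' addrK.
- have [c cst ->] := mvt s t.
  rewrite -mulrBl normrM.
  apply: le_trans (_ : K2 * `|s - t| * `|s - t| <= _).
    apply: ler_wpM2r => //; apply: le_trans (f'l _ _) _; exact: ler_wpM2l.
  rewrite -mulrA -expr2 real_normK ?num_real //; apply: ler_wpM2r; first exact: sqr_ge0.
  by rewrite lerDl.
- by apply: le_trans (f'l s t) _; apply: ler_wpM2r => //; rewrite lerDl.
by apply: le_trans (f'b s) _; rewrite lerDr.
Qed.

End Solve.
End SteinEquation.

(** * From test functions to distribution functions *)

Section Cdf.
Context (R : realType).
Implicit Types (u g h : R -> R) (x y b c dl M : R).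
Local Notation leb := (@lebesgue_measure R).
Local Notation phi := (@normal_pdf R 0 1).
Local Notation nu := (@normal_prob R 0 1).

Definition clamp x : R := Num.max 0 (Num.min 1 x).

Lemma clampE x : clamp x = if x <= 0 then 0 else if x <= 1 then x else 1.
Proof.
rewrite /clamp; case: (leP x 0) => x0.
  by rewrite (min_r (_ : x <= 1)) ?max_l //; lra.
case: (leP x 1) => x1; first by rewrite ?(min_r x1) max_r // ltW.
by rewrite max_r.
Qed.
Lemma clamp_ge0 x : 0 <= clamp x.
Proof. by rewrite /clamp le_max lexx. Qed.
Lemma clamp_le1 x : clamp x <= 1.
Proof. by rewrite /clamp ge_max ler01 /= ge_min lexx. Qed.
Lemma clamp_le x y : x <= y -> clamp x <= clamp y.
Proof.
rewrite !clampE => xy.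
have [x0|x0] := leP x 0; have [y0|y0] := leP y 0; have [x1|x1] := leP x 1;
  have [y1|y1] := leP y 1; rewrite /=; lra.
Qed.
Lemma clamp_lip x y : `|clamp x - clamp y| <= `|x - y|.
Proof.
wlog xy : x y / x <= y.
  by move=> h; case: (leP x y) => [/h//|/ltW/h]; rewrite distrC [`|y - x|]distrC.
rewrite [leRHS]distrC (ger0_norm (_ : 0 <= y - x)) ?subr_ge0 // !clampE.
have [x0|x0] := leP x 0; have [y0|y0] := leP y 0; have [x1|x1] := leP x 1;
  have [y1|y1] := leP y 1; rewrite /= ler_norml; apply/andP; split; lra.
Qed.

(** A Lipschitz cutoff, equal to 1 on [-M, M] and 0 outside [-M - 1, M + 1]; [ramp] falls from 1 at
    b to 0 at b + dl. *)
Definition chi M x : R := clamp (M + 1 - `|x|).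
Definition ramp b dl x : R := clamp ((b + dl - x) / dl).

Lemma chi_lip M : lipschitz (chi M) 1.
Proof.
move=> x y; apply: le_trans (clamp_lip _ _) _; rewrite mul1r.
rewrite (_ : _ - _ = `|y| - `|x|); last by ring.
by rewrite [leRHS]distrC; exact: ler_dist_dist.
Qed.
Lemma ramp_lip b dl : 0 < dl -> lipschitz (ramp b dl) dl^-1.
Proof.
move=> d0 x y; apply: le_trans (clamp_lip _ _) _.
rewrite (_ : _ - _ = dl^-1 * (y - x)); last by ring.
by rewrite normrM distrC ger0_norm // invr_ge0 ltW.
Qed.
Lemma chi_vanish M x : M + 1 <= `|x| -> chi M x = 0.
Proof. by move=> h; rewrite /chi clampE ifT // subr_le0. Qed.
Lemma chi_tail M x : 0 < M -> 1 - chi M x <= x ^+ 2 / M ^+ 2.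
Proof.
move=> M0; have [xM|Mx] := leP `|x| M.
  have -> : chi M x = 1.
    rewrite /chi clampE; case: ifPn => h; first by lra.
    by case: ifPn => h' //; lra.
  by rewrite subrr divr_ge0 ?sqr_ge0.
apply: le_trans (_ : 1 <= _); first by rewrite gerBl clamp_ge0.
rewrite ler_pdivlMr ?exprn_gt0 // mul1r -(real_normK (num_real x)).
by have M0' := ltW M0; have Mx' := ltW Mx; rewrite lerXn2r ?nnegrE.
Qed.
Lemma chi_in M x : `|x| <= M -> chi M x = 1.
Proof.
move=> xM; rewrite /chi clampE; case: ifPn => h; first by lra.
by case: ifPn => h' //; lra.
Qed.
Lemma ramp_le b dl x : 0 < dl -> (x <= b)%R%:R <= ramp b dl x.
Proof.
move=> d0; have [xb|xb] := leP x b; last exact: clamp_ge0.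
rewrite /ramp clampE; have h : 1 <= (b + dl - x) / dl by rewrite ler_pdivlMr //; lra.
by case: ifPn => h1; [lra|case: ifPn => // h2; lra].
Qed.
Lemma ramp_ge b dl x : 0 < dl -> ramp b dl x <= (x <= b + dl)%R%:R.
Proof.
move=> d0; have [xb|xb] := leP x (b + dl); first exact: clamp_le1.
rewrite /ramp clampE ifT // -oppr_ge0 -mulNr divr_ge0 ?ltW //; lra.
Qed.

Lemma lip_int u K K' (A : set R) : measurable A -> lipschitz u K -> (forall x, `|u x| <= K') ->
  leb.-integrable A (EFin \o (fun x => u x * phi x)).
Proof. by move=> mA lu; apply: gmean_integrable => //; exact: lipschitz_continuous lu. Qed.

Lemma int_sub (f g : R -> R) (A : set R) : measurable A -> leb.-integrable A (EFin \o f) ->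
  leb.-integrable A (EFin \o g) -> leb.-integrable A (EFin \o (fun x => f x - g x)).
Proof.
move=> mA iF iG.
have h : leb.-integrable A ((EFin \o f) \- (EFin \o g))%E by apply: integrableB.
exact: h.
Qed.
Lemma int_scale c (f : R -> R) (A : set R) : measurable A -> leb.-integrable A (EFin \o f) ->
  leb.-integrable A (EFin \o (fun x => c * f x)).
Proof.
move=> mA iF.
have h : leb.-integrable A (fun x => c%:E * (EFin \o f) x)%E by apply: integrableZl.
exact: h.
Qed.

Definition gmass (A : set R) : R := \int[leb]_(x in A) phi x.

Lemma gmass_nu A : gmass A = fine (nu A). Proof. by []. Qed.

Lemma phi_int (A : set R) : measurable A -> leb.-integrable A (EFin \o phi).
Proof. by move=> mA; exact: integrableS (integrable_normal_pdf 0 1). Qed.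

Lemma gmean_le_gmass u K (A : set R) : measurable A -> lipschitz u K -> (forall x, 0 <= u x <= 1) ->
  (forall x, ~ A x -> u x = 0) -> gmean u <= gmass A.
Proof.
move=> mA lu u01 uA; rewrite /gmean /gmass [leRHS]Rintegral_mkcond.
have bu x : `|u x| <= 1 by case/andP: (u01 x) => ? ?; rewrite ger0_norm.
apply: le_Rintegral => //.
- exact: lip_int lu bu.
- by rewrite -restrict_EFin; exact: ((integrable_mkcond (mu := leb) (EFin \o phi) mA).1 (phi_int mA)).
move=> x _; rewrite /patch; case: ifPn => [_|/negP].
  by rewrite ler_piMl ?(ltW (phi_gt0 x)) //; case/andP: (u01 x).
by rewrite inE => /uA ->; rewrite mul0r.
Qed.

Lemma gmass_le_gmean u K (A : set R) : measurable A -> lipschitz u K -> (forall x, 0 <= u x <= 1) ->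
  (forall x, A x -> u x = 1) -> gmass A <= gmean u.
Proof.
move=> mA lu u01 uA; rewrite /gmean /gmass [leLHS]Rintegral_mkcond.
have bu x : `|u x| <= 1 by case/andP: (u01 x) => ? ?; rewrite ger0_norm.
apply: le_Rintegral => //.
- by rewrite -restrict_EFin; exact: ((integrable_mkcond (mu := leb) (EFin \o phi) mA).1 (phi_int mA)).
- exact: lip_int lu bu.
move=> x _; rewrite /patch; case: ifPn => [|/negP _].
  by rewrite inE => /uA ->; rewrite mul1r.
by rewrite mulr_ge0 ?(ltW (phi_gt0 x)) //; case/andP: (u01 x).
Qed.

Lemma gmean1 : gmean (fun _ : R => 1 : R) = 1.
Proof.
have -> : gmean (fun _ : R => 1 : R) = gmass setT.
  by apply: eq_Rintegral => x _; rewrite mul1r.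
by rewrite gmass_nu (@probability_setT _ _ _ nu).
Qed.

Lemma gmean_chi_cvg (e : R) : 0 < e -> exists2 M, 1 <= M & 1 - e <= gmean (chi M).
Proof.
move=> e0.
pose F (N : nat) : set R := `[- N%:R, N%:R]%classic.
have mF N : measurable (F N) by exact: measurable_itv.
have UF : \bigcup_N F N = setT.
  apply/seteqP; split=> // x _; exists (Num.bound `|x|) => //.
  rewrite /F /= in_itv /= -ler_norml ltW //; exact: archi_boundP.
have homF : {homo F : n m / (n <= m)%N >-> (n <= m)%O}.
  move=> n m nm; apply/subsetPset => x; rewrite /F /= !in_itv /= => /andP[a b].
  have h : n%:R <= m%:R :> R by rewrite ler_nat.
  by apply/andP; split; lra.
have nT : nu (\bigcup_N F N) = 1%:E by rewrite UF; exact: probability_setT.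
have cv : (nu \o F) N @[N --> \oo] --> 1%:E.
  by rewrite -nT; apply: nondecreasing_cvg_mu => //; rewrite UF.
have cv' : (fine \o (nu \o F)) N @[N --> \oo] --> (1 : R) by apply: fine_cvg.
move/cvgrPdist_le: cv' => /(_ _ e0) [N _ hN].
exists N.+1%:R; first by rewrite ler1n.
have := hN N.+1 (leqnSn N); rewrite /= => h.
apply: le_trans (_ : gmass (F N.+1) <= _).
  rewrite gmass_nu; move: h; rewrite ler_norml => /andP[_]; lra.
apply: (gmass_le_gmean (K := 1)) => //; first exact: chi_lip.
  by move=> x; rewrite clamp_ge0 clamp_le1.
by move=> x; rewrite /F /= in_itv /= -ler_norml; exact: chi_in.
Qed.

Section Limit.
Variables (I : nat -> finType) (w X : forall n, I n -> R) (C : R).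
Let mean n g := \sum_o w (n:=n) o * g (X (n:=n) o).
Hypotheses (w0 : forall n (o : I n), 0 <= w o) (w1 : forall n, \sum_(o : I n) w o = 1).
Hypothesis X2 : \forall n \near \oo, \sum_(o : I n) w o * X o ^+ 2 <= C.
Hypothesis HX : forall u K M, 0 < M -> lipschitz u K -> (forall x, M <= `|x| -> u x = 0) ->
  gmean u = 0 -> mean n u @[n --> \oo] --> 0.

Let mean_le n g h : (forall x, g x <= h x) -> mean n g <= mean n h.
Proof. by move=> gh; apply: ler_sum => o _; apply: ler_wpM2l. Qed.
Let mean_cst n c : mean n (fun=> c) = c.
Proof. by rewrite /mean -mulr_suml w1 mul1r. Qed.
Let mean_lin n g h c : mean n (fun x => g x + c * h x) = mean n g + c * mean n h.
Proof.
rewrite /mean mulr_sumr -big_split; apply: eq_bigr => o _ /=; ring.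
Qed.

(** The test function [chi M * g - c * chi M] has compact support, and [c] is chosen to give it
    Gaussian mean zero. Its mean tends to 0 by [HX], and both cutoffs are almost 1 in mean, so the
    means of [g] under both laws are close to [c]. *)
Lemma mean_cvg g K (e : R) : lipschitz g K -> (forall x, 0 <= g x <= 1) -> 0 < e ->
  \forall n \near \oo, `|mean n g - gmean g| <= e.
Proof.
move=> lg g01 e0.
have K0 := lipschitz_ge0 lg.
(* Four errors of size [e1] are added at the end; the bound 1/2 keeps [gmean (chi M)] positive. *)
pose e1 := Num.min (e / 4) (1 / 2).
have e10 : 0 < e1 by rewrite lt_min; apply/andP; split; lra.
have e1e : e1 <= e / 4 by rewrite ge_min lexx.
have e1h : e1 <= 1 / 2 by rewrite ge_min lexx orbT.
have [M1 M11 hM1] := gmean_chi_cvg e10.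
(* chi is monotone in its width, hence a single M serves both tails *)
pose M := M1 + `|C| / e1.
have CM : 0 <= `|C| / e1 by rewrite divr_ge0 // ltW.
have MM1 : M1 <= M by rewrite lerDl.
have M0 : 0 < M by lra.
have chi01 x : 0 <= chi M x <= 1 by rewrite clamp_ge0 clamp_le1.
have lc := chi_lip M.
have cle x : chi M1 x <= chi M x.
  by apply: clamp_le; rewrite lerD2r lerD2r.
have bnd (v : R -> R) : (forall x, 0 <= v x <= 1) -> forall x, `|v x| <= 1.
  by move=> v01 x; case/andP: (v01 x) => ? ?; rewrite ger0_norm.
have cgl : lipschitz (fun x => chi M x * g x) (1 + K).
  move=> x y; rewrite (_ : _ - _ = (chi M x - chi M y) * g x + chi M y * (g x - g y)); last by ring.
  apply: le_trans (ler_normD _ _) _; rewrite (normrM (chi M x - _)) (normrM (chi M y)) mulrDl.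
  apply: lerD.
    by rewrite -[leRHS]mulr1; apply: ler_pM => //; exact: bnd.
  by rewrite -[leRHS]mul1r; apply: ler_pM => //; exact: bnd.
have cg01 x : 0 <= chi M x * g x <= 1.
  by case/andP: (g01 x) => ? ?; case/andP: (chi01 x) => ? ?; rewrite mulr_ge0 //= mulr_ile1.
have ic := lip_int measurableT lc (bnd _ chi01).
have icg := lip_int measurableT cgl (bnd _ cg01).
have ig := lip_int measurableT lg (bnd _ g01).
have tail : 1 - e1 <= gmean (chi M).
  apply: le_trans hM1 _; apply: le_Rintegral => //.
    by apply: (lip_int measurableT (chi_lip M1) (K' := 1)); apply: bnd => x; rewrite clamp_ge0 clamp_le1.
  by move=> x _; rewrite ler_wpM2r // ltW // phi_gt0.
have Nc0 : 0 < gmean (chi M) by lra.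
pose c := gmean (fun x => chi M x * g x) / gmean (chi M).
have Ncg_ge0 : 0 <= gmean (fun x => chi M x * g x).
  by apply: Rintegral_ge0 => x _; rewrite mulr_ge0 ?(ltW (phi_gt0 x)) //; case/andP: (cg01 x).
have Ncg_le : gmean (fun x => chi M x * g x) <= gmean (chi M).
  apply: le_Rintegral => // x _; apply: ler_wpM2r; first exact: ltW (phi_gt0 x).
  by case/andP: (chi01 x) => ? ?; case/andP: (g01 x) => ? ?; rewrite ler_piMr.
have c0 : 0 <= c by rewrite divr_ge0 // ltW.
have c1 : c <= 1 by rewrite ler_pdivrMr // mul1r.
have Ng_cg : `|gmean g - gmean (fun x => chi M x * g x)| <= e1.
  rewrite -RintegralB //.
  have one_lip : lipschitz (fun _ : R => 1 : R) 0 by move=> x y; rewrite subrr normr0 mul0r.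
  have one01 : forall x : R, 0 <= (fun _ : R => 1 : R) x <= 1 by move=> x; rewrite ler01 lexx.
  have {}i1 := lip_int measurableT one_lip (bnd _ one01).
  have -> : e1 = 1 - (1 - e1) by ring.
  have up : \int[leb]_x (g x * phi x - chi M x * g x * phi x) <= gmean (fun _ : R => 1 : R) - gmean (chi M).
    rewrite /gmean -RintegralB //; apply: le_Rintegral => //.
    - exact: int_sub.
    - exact: int_sub.
    move=> x _; rewrite -!mulrBl; apply: ler_wpM2r; first exact: ltW (phi_gt0 x).
    have -> : g x - chi M x * g x = (1 - chi M x) * g x by ring.
    by rewrite ler_piMr ?subr_ge0 //; [case/andP: (chi01 x)|case/andP: (g01 x)].
  rewrite ger0_norm; first by apply: le_trans up _; rewrite gmean1 lerD2l lerN2.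
  apply: Rintegral_ge0 => x _; rewrite -mulrBl mulr_ge0 ?(ltW (phi_gt0 x)) // subr_ge0.
  by rewrite ler_piMl //; [case/andP: (g01 x)|case/andP: (chi01 x)].
pose u x := chi M x * g x + - c * chi M x.
have lu : lipschitz u (1 + K + c).
  move=> x y; rewrite (_ : u x - u y = (chi M x * g x - chi M y * g y) + (- c) * (chi M x - chi M y)); last by rewrite /u; ring.
  apply: le_trans (ler_normD _ _) _; rewrite mulrDl; apply: lerD => //.
  by rewrite normrM normrN (ger0_norm c0); apply: ler_wpM2l => //; have := lc x y; rewrite mul1r.
have uM x : M + 1 <= `|x| -> u x = 0.
  by move=> h; rewrite /u chi_vanish // mul0r mulr0 addr0.
have gmean0 : gmean u = 0.
  have -> : gmean u = gmean (fun x => chi M x * g x) - c * gmean (chi M).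
    rewrite /gmean -RintegralZl // -RintegralB //.
      by apply: eq_Rintegral => x _; rewrite /u; ring.
    exact: int_scale.
  by rewrite /c divfK ?subrr // gt_eqF.
have M10 : 0 < M + 1 by lra.
have /cvgrPdist_le/(_ _ e10) hu := HX M10 lu uM gmean0.
near=> n.
have hun : `|mean n u| <= e1.
  have : `|0 - mean n u| <= e1 by near: n; exact: hu.
  by rewrite sub0r normrN.
have h2 : mean n (fun x => x ^+ 2) <= C by near: n.
have tl : 1 - mean n (chi M) <= e1.
  apply: le_trans (_ : C / M ^+ 2 <= _).
    apply: le_trans (_ : mean n (fun x => 1 + (-1) * chi M x) <= _); first by rewrite mean_lin mean_cst; lra.
    apply: le_trans (_ : mean n (fun x => x ^+ 2 / M ^+ 2) <= _).
      by apply: mean_le => x; rewrite mulN1r; exact: chi_tail.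
    have -> : mean n (fun x => x ^+ 2 / M ^+ 2) = mean n (fun x => x ^+ 2) / M ^+ 2.
      by rewrite /mean mulr_suml; apply: eq_bigr => o _; rewrite mulrA.
    by apply: ler_wpM2r => //; rewrite invr_ge0 exprn_ge0 // ltW.
  rewrite ler_pdivrMr ?exprn_gt0 //; apply: le_trans (ler_norm C) _.
  rewrite -ler_pdivrMl // mulrC; apply: le_trans (_ : M <= _).
    by rewrite /M lerDr; lra.
  by rewrite expr2 ler_peMr ?(ltW M0) //; lra.
have EEle1 : mean n (chi M) <= 1.
  by rewrite -[leRHS](mean_cst n 1); apply: mean_le => x; case/andP: (chi01 x).
have EEu : mean n u = mean n (fun x => chi M x * g x) - c * mean n (chi M).
  by rewrite mean_lin mulNr.
have d1 : mean n g - mean n (fun x => chi M x * g x) <= 1 - mean n (chi M).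
  have -> : mean n g - mean n (fun x => chi M x * g x) = mean n (fun x => g x + (-1) * (chi M x * g x)).
    by rewrite (mean_lin n g (fun x => chi M x * g x)); ring.
  have -> : 1 - mean n (chi M) = mean n (fun x => 1 + (-1) * chi M x) by rewrite mean_lin mean_cst; ring.
  apply: mean_le => x; have -> : g x + (-1) * (chi M x * g x) = (1 - chi M x) * g x by ring.
  by rewrite mulN1r ler_piMr ?subr_ge0 //; [case/andP: (chi01 x)|case/andP: (g01 x)].
have d2 : 0 <= mean n g - mean n (fun x => chi M x * g x).
  rewrite subr_ge0; apply: mean_le => x.
  by rewrite ler_piMl //; [case/andP: (g01 x)|case/andP: (chi01 x)].
have cN : c * gmean (chi M) = gmean (fun x => chi M x * g x) by rewrite /c divfK // gt_eqF.
have cE : 0 <= c * (1 - mean n (chi M)) <= e1.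
  by rewrite mulr_ge0 ?subr_ge0 //=; apply: le_trans tl; rewrite ler_piMl ?subr_ge0.
have cN2 : 0 <= c * (1 - gmean (chi M)) <= e1.
  have h : gmean (chi M) <= 1.
    rewrite -gmean1; apply: le_Rintegral => //.
      apply: (lip_int measurableT (K := 0) (K' := 1)) => x; last by rewrite normr1.
      by move=> y; rewrite subrr normr0 mul0r.
    by move=> x _; apply: ler_wpM2r; [exact: ltW (phi_gt0 x)|case/andP: (chi01 x)].
  rewrite mulr_ge0 ?subr_ge0 //=; apply: le_trans (_ : 1 - gmean (chi M) <= _); last by lra.
  by rewrite ler_piMl ?subr_ge0.
case/andP: cE => cE1 cE2; case/andP: cN2 => cN1 cN2'.
move: hun Ng_cg; rewrite EEu !ler_norml => /andP[u1 u2] /andP[v1 v2].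
by apply/andP; split; lra.
Unshelve. all: by end_near. Qed.

(** The indicator of the half line lies between two ramps, and continuity of the limit at [x] makes
    their Gaussian means close. *)
Theorem cdf_of_stein x : {for x, continuous (fun y => nu `]-oo, y])} ->
  (\sum_(o : I n) w o * (X o <= x)%R%:R)%:E @[n --> \oo] --> nu `]-oo, x].
Proof.
move=> cx.
have nuE y : nu `]-oo, y] = (gmass `]-oo, y])%:E.
  by rewrite gmass_nu fineK // fin_num_measure.
rewrite nuE; apply: cvg_EFin; first by near=> n.
apply/cvgrPdist_le => e e0.
have cf : gmass `]-oo, y] @[y --> x] --> gmass `]-oo, x].
  apply: fine_cvg; rewrite -nuE; exact: cx.
have e30 : 0 < e / 3 by lra.
have /cvgrPdist_le/(_ _ e30)/nbhs_ballP[dl0 /= dl0p hb] := cf.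
pose dl := dl0 / 2.
have dlp : 0 < dl by rewrite /dl divr_gt0.
have hp : `|gmass `]-oo, x] - gmass `]-oo, x + dl]| <= e / 3.
  by apply: hb; rewrite /ball /= opprD addNKr normrN gtr0_norm // /dl; lra.
have hm : `|gmass `]-oo, x] - gmass `]-oo, x - dl]| <= e / 3.
  by apply: hb; rewrite /ball /= opprB addrC subrK gtr0_norm // /dl; lra.
have r01 b y : 0 <= ramp b dl y <= 1 by rewrite clamp_ge0 clamp_le1.
have N1 : gmean (ramp x dl) <= gmass `]-oo, x + dl].
  apply: gmean_le_gmass (ramp_lip x dlp) (r01 _) _ => // y /=.
  rewrite in_itv /= => /negP yx; apply/eqP; rewrite eq_le clamp_ge0 andbT.
  by apply: le_trans (ramp_ge _ _ dlp) _; rewrite (negPf yx).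
have N2 : gmass `]-oo, x - dl] <= gmean (ramp (x - dl) dl).
  apply: gmass_le_gmean (ramp_lip (x - dl) dlp) (r01 _) _ => // y /=.
  rewrite in_itv /= => yx; apply/eqP; rewrite eq_le clamp_le1 /=.
  by apply: le_trans (ramp_le _ _ dlp); rewrite yx.
have c1 := mean_cvg (ramp_lip x dlp) (r01 _) e30.
have c2 := mean_cvg (ramp_lip (x - dl) dlp) (r01 _) e30.
near=> n.
have a1 : `|mean n (ramp x dl) - gmean (ramp x dl)| <= e / 3 by near: n.
have a2 : `|mean n (ramp (x - dl) dl) - gmean (ramp (x - dl) dl)| <= e / 3 by near: n.
have b1 : mean n (fun y => (y <= x)%R%:R) <= mean n (ramp x dl).
  by apply: mean_le => y; exact: ramp_le.
have b2 : mean n (ramp (x - dl) dl) <= mean n (fun y => (y <= x)%R%:R).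
  by apply: mean_le => y; apply: le_trans (ramp_ge _ _ dlp) _; rewrite subrK.
have -> : \sum_(o : I n) w o * (X o <= x)%R%:R = mean n (fun y => (y <= x)%R%:R) by [].
move: a1 a2 hp hm; rewrite !ler_norml => /andP[? ?] /andP[? ?] /andP[? ?] /andP[? ?].
by apply/andP; split; lra.
Unshelve. all: by end_near. Qed.

End Limit.
End Cdf.

(** * Reduction to finite sums *)

Section Finite.
Context (R : realType) d (T : measurableType d) (P : probability T R).
Context (F : finType) (g : T -> F) (w : F -> R).
Hypothesis mg : forall o, measurable (g @^-1` [set o]).
Hypothesis Pg : forall o, P (g @^-1` [set o]) = (w o)%:E.

Lemma measurable_finite (h : F -> R) : measurable_fun setT (h \o g).
Proof.
move=> _ B mB; rewrite setTI.
have -> : (h \o g) @^-1` B = \big[setU/set0]_(o : F | h o \in B) g @^-1` [set o].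
  rewrite -bigcup_seq_cond; apply/seteqP; split => x /=.
    by move=> Bx; exists (g x) => //=; rewrite mem_index_enum /=; apply/mem_set.
  by case=> o /= /andP[_ /set_mem Bo] e; rewrite e.
by apply: bigsetU_measurable => o _; exact: mg.
Qed.

Lemma int_finite (h : F -> R) : (\int[P]_x (h (g x))%:E = (\sum_o w o * h o)%:E)%E.
Proof.
have DT : \big[setU/set0]_(o <- enum F) (g @^-1` [set o]) = setT.
  rewrite -bigcup_seq; apply/seteqP; split => x //= _.
  by exists (g x) => //=; rewrite mem_enum.
rewrite -DT integral_bigsetU_EFin //=.
- rewrite big_enum /= -sumEFin; apply: eq_bigr => o _.
  transitivity (\int[P]_(x in g @^-1` [set o]) (cst (h o)%:E x))%E.
    by apply: eq_integral => x; rewrite inE /= => ->.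
  transitivity ((h o)%:E * P (g @^-1` [set o]))%E.
    by apply: integral_cst; exact: mg.
  by rewrite Pg -EFinM mulrC.
- exact: enum_uniq.
- by move=> o o' _ _ [x [/= <- <-]].
by rewrite DT; apply/measurable_EFinP; exact: measurable_finite.
Qed.

Lemma prob_finite (Q : pred F) : P [set x | Q (g x)] = (\sum_o w o * (Q o)%:R)%:E.
Proof.
have mQ : measurable [set x | Q (g x)].
  have := measurable_finite (fun o => (Q o)%:R) measurableT (measurable_set1 1).
  rewrite setTI (_ : _ @^-1` _ = [set x | Q (g x)]) //.
  apply/seteqP; split => x /=; first by case: (Q _) => //= /eqP; rewrite eq_sym oner_eq0.
  by move=> ->.
rewrite -int_finite -[LHS](expectation_indic P mQ) unlock.
apply: eq_integral => x _; congr EFin; rewrite indicE.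
have -> // : (x \in [set x | Q (g x)]) = Q (g x).
by apply/idP/idP; rewrite inE.
Qed.
End Finite.

Section GraphLaw.
Context (R : realType) d (T : measurableType d) (P : probability T R) (n : nat).
Context (alpha : R) (W : 'M[R]_n) (A : 'I_n -> 'I_n -> {RV P >-> bool}).
Hypothesis HA : heterogeneous_graph alpha W A.
Local Notation cfg := {ffun 'I_n * 'I_n -> bool}.
Local Notation mu := (edge_prob alpha W).

(** Bits at pairs that are not increasing are set to false, in agreement with their probability 0
    under [pedge]. *)
Definition conf (x : T) : cfg := [ffun e : 'I_n * 'I_n => (e.1 < e.2)%N && A e.1 e.2 x].

Lemma adj_conf x i j : adj (conf x) i j = A i j x.
Proof.
have [AS A0 _ _] := HA.
rewrite /adj ffunE /upair; case: (ltngtP i j) => [ij|ji|/ord_inj ->] /=.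
- by rewrite ij /= -val_eqE /= ltn_eqF.
- by rewrite ji /= -val_eqE /= gtn_eqF.
by rewrite eqxx A0.
Qed.

(** A configuration with a true bit at a pair that is not increasing is never attained; its weight
    is zero as well, which [conf_law] uses. *)
Lemma conf_preimage (o : cfg) : conf @^-1` [set o] =
  if [forall e : 'I_n * 'I_n, (e.1 < e.2)%N || ~~ o e] then
    \bigcap_(e in [set` [set e : 'I_n * 'I_n | (e.1 < e.2)%N]%SET]) (A e.1 e.2 @^-1` [set o e])
  else set0.
Proof.
apply/seteqP; split => x /=.
  move=> cx; rewrite ifT.
    by move=> e /=; rewrite inE => he; rewrite -cx ffunE he.
  by apply/forallP => e; rewrite -cx ffunE; case: (_ < _)%N.
case: ifPn => //= /forallP ho hx; apply/ffunP => e; rewrite ffunE.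
have [he|he] := boolP (e.1 < e.2)%N; last by have := ho e; rewrite (negPf he) /= => /negPf ->.
by rewrite /= (hx e) //= inE.
Qed.

Let mA e (b : bool) : measurable (A e.1 e.2 @^-1` [set b] : set T).
Proof. exact: measurable_funPTI. Qed.

Lemma conf_measurable (o : cfg) : measurable (conf @^-1` [set o]).
Proof.
rewrite conf_preimage; case: ifP => _; last exact: measurable0.
apply: fin_bigcap_measurable => [|e _]; last exact: mA.
exact: finite_finset.
Qed.

Lemma P_edge (e : 'I_n * 'I_n) (b : bool) : (e.1 < e.2)%N ->
  P (A e.1 e.2 @^-1` [set b]) = (if b then pedge mu e else 1 - pedge mu e)%:E.
Proof.
have [_ _ Ap _] := HA; move=> he.
have Pt : P (A e.1 e.2 @^-1` [set true]) = (pedge mu e)%:E.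
  by rewrite /pedge he -Ap.
case: b => //.
have -> : A e.1 e.2 @^-1` [set false] = ~` (A e.1 e.2 @^-1` [set true]).
  by apply/seteqP; split => x /=; case: (A _ _ x).
by rewrite probability_setC // Pt.
Qed.

Lemma conf_law (o : cfg) : P (conf @^-1` [set o]) = (wt (pedge mu) o)%:E.
Proof.
rewrite conf_preimage; case: ifPn => [/forallP ho|].
  have [_ _ _ AI] := HA.
  have := AI [set e : 'I_n * 'I_n | (e.1 < e.2)%N]%SET (fun e => [set o e]) (subxx _) (fun _ _ => _).
  move=> -> //.
  have -> : wt (pedge mu) o = \prod_(e : 'I_n * 'I_n | (e.1 < e.2)%N) (if o e then pedge mu e else 1 - pedge mu e).
    rewrite /wt (bigID (fun e : 'I_n * 'I_n => (e.1 < e.2)%N)) /=.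
    rewrite [X in _ * X]big1 ?mulr1 // => e he.
    by have := ho e; rewrite (negPf he) /= => /negPf ->; rewrite /pedge (negPf he) subr0.
  rewrite -prodEFin; apply: eq_big => [e|e]; first by rewrite inE.
  by rewrite inE => he; rewrite P_edge.
rewrite negb_forall => /existsP[e]; rewrite negb_or negbK => /andP[he oe].
by rewrite measure0 /wt (bigD1 e) //= oe /pedge (negPf he) mul0r.
Qed.

Lemma T_stat_conf x : T_stat A x = tstat R (conf x).
Proof.
rewrite /T_stat /= /weighted_triangles /tstat /tri.
pose g i j k : R := (deg R (conf x) i)^-1 * (deg R (conf x) j)^-1 * (deg R (conf x) k)^-1 *
   (edge R (conf x) i j * edge R (conf x) j k * edge R (conf x) k i).
have gS : sym3 g.
  split=> i j k; rewrite /g.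
    by rewrite (edgeS R _ j i) (edgeS R _ i k) (edgeS R _ k j); ring.
  by rewrite (edgeS R _ i k) (edgeS R _ k j) (edgeS R _ j i); ring.
rewrite -/(sum3 g) -sum_lt3 // => [|i k]; last by rewrite /g edge0 !mul0r mulr0.
have adjE i j : adjacency A x i j = adj (conf x) i j by rewrite mxE adj_conf.
have dE i : (degree (adjacency A x) i)%:R = deg R (conf x) i.
  by rewrite /degree /deg natr_sum; apply: eq_bigr => j _; rewrite adjE.
apply: eq_bigr => i _; apply: eq_bigr => j _; apply: eq_bigr => k _.
by rewrite !natrM !dE !adjE /g /edge !invfM mulrC.
Qed.

Lemma E_T_stat : fine 'E_P[T_stat A] = Ex (pedge mu) (tstat R (n:=n)).
Proof.
rewrite unlock.
have := int_finite conf_measurable conf_law (tstat R (n:=n)).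
under eq_integral do rewrite -T_stat_conf.
by move=> ->.
Qed.

Lemma cdf_standardized (r : R) :
  cdf (P := P) (standardized_T_stat alpha W A) r =
  (\sum_o wt (pedge mu) o * ((tstat R o - Ex (pedge mu) (tstat R (n:=n))) / v_norm mu <= r)%R%:R)%:E.
Proof.
rewrite -(prob_finite conf_measurable conf_law (fun o => (tstat R o - Ex (pedge mu) (tstat R (n:=n))) / v_norm mu <= r)).
rewrite /cdf /distribution /pushforward; congr (P _); apply/seteqP.
by split => x /=; rewrite in_itv /= /standardized_T_stat T_stat_conf E_T_stat.
Qed.
End GraphLaw.

(** * Asymptotics *)

Section Limits.
Context (R : realType).
Implicit Types (t c e : R).

Lemma powR_nat_large t M : 0 < t -> \forall n \near \oo, M <= (n%:R : R) `^ t.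
Proof.
move=> t0; near=> n.
have h : (Num.max M 0) `^ t^-1 <= n%:R.
  by near: n; exact: nbhs_infty_ger.
apply: le_trans (_ : (Num.max M 0 `^ t^-1) `^ t <= _).
  by rewrite -powRrM mulVf ?gt_eqF // powRr1 ?le_max ?lexx ?orbT.
by apply: ge0_ler_powR; rewrite ?nnegrE ?powR_ge0 // ltW.
Unshelve. all: by end_near. Qed.

Lemma powRN_nat_small t e : 0 < t -> 0 < e -> \forall n \near \oo, (n%:R : R) `^ (- t) <= e.
Proof.
move=> t0 e0; near=> n.
have h : e^-1 <= (n%:R : R) `^ t by near: n; exact: powR_nat_large.
have h0 : 0 < (n%:R : R) `^ t by apply: lt_le_trans h; rewrite invr_gt0.
by rewrite powRN -[leRHS]invrK lef_pV2 ?posrE // invr_gt0.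
Unshelve. all: by end_near. Qed.

Lemma expR_ge_pow (k : nat) (y : R) : 0 <= y -> (y / k.+1%:R) ^+ k.+1 <= expR y.
Proof.
move=> y0; rewrite -{2}(divfK (_ : k.+1%:R != 0) y); last by rewrite pnatr_eq0.
rewrite expRM_natr; apply: lerXn2r; rewrite ?nnegrE ?expR_ge0 ?divr_ge0 //.
by apply: le_trans (expR_ge1Dx _); rewrite lerDr ler01.
Qed.

Lemma exp_beats_pow t c e (a : nat) : 0 < t -> 0 < c -> 0 < e ->
  \forall n \near \oo, (n%:R : R) ^+ a * expR (- (c * (n%:R : R) `^ t)) <= e.
Proof.
move=> t0 c0 e0.
(* The exponent is taken so large that one spare power of n remains to absorb the constant
   [D / e]. *)
have [k hk] : exists k : nat, a.+1%:R <= t * k.+1%:R.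
  exists (Num.truncn (a.+1%:R / t : R)); rewrite mulrC -ler_pdivrMr //.
  exact: ltW (truncnS_gt _).
pose D : R := (k.+1%:R / c) ^+ k.+1.
have D0 : 0 < D by rewrite exprn_gt0 // divr_gt0.
near=> n.
have n1 : 1 <= (n%:R : R) by near: n; exact: nbhs_infty_ger.
have hn : D / e <= n%:R by near: n; exact: nbhs_infty_ger.
have n0 : 0 < (n%:R : R) by exact: lt_le_trans n1.
set N : R := n%:R in n1 n0 hn *.
have cn : 0 <= c * N `^ t by rewrite mulr_ge0 ?powR_ge0 // ltW.
have h1 := expR_ge_pow k cn.
have h2 : N ^+ a.+1 <= (N `^ t) ^+ k.+1.
  rewrite -[leRHS]powR_mulrn ?powR_ge0 // -powRrM -(powR_mulrn _ (ltW n0)).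
  exact: ler_powR.
have h3 : N ^+ a.+1 <= D * expR (c * N `^ t).
  apply: le_trans h2 _; rewrite -ler_pdivrMl //; apply: le_trans h1.
  by apply: le_of_eq; rewrite /D -exprVn -exprMn invf_div; congr (_ ^+ _); ring.
rewrite expRN -ler_pdivlMr ?invr_gt0 ?expR_gt0 // invrK.
have h4 : N * N ^+ a <= N * (e * expR (c * N `^ t)).
  rewrite -exprS; apply: le_trans h3 _; rewrite mulrA; apply: ler_wpM2r; first exact: expR_ge0.
  by rewrite -ler_pdivrMr.
by move: h4; rewrite ler_pM2l.
Unshelve. all: by end_near. Qed.
End Limits.

(** * The norming as the variance of the leading polynomial *)

Section Moments.
Context (R : realType) (n : nat) (mu : 'M[R]_n).
Hypothesis muS : forall i j, mu i j = mu j i.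
Hypothesis mu0 : forall i, mu i i = 0.

Lemma gammaE i j : i != j -> gamma mu i j = gamma_sum mu i j.
Proof.
move=> ij; rewrite /gamma /gamma_sum big_mkcond; apply: eq_bigr => k _.
have [->|ki] /= := eqVneq k i; first by rewrite mu0 !mul0r.
have [->|kj] /= := eqVneq k j; first by rewrite mu0 mulr0 mul0r.
by rewrite (muS j k) (muS k i) /tcoef /rinv /row_mu /mu_row !invfM; ring.
Qed.

Lemma etaE i : Defs.eta mu i = eta_sum mu i.
Proof.
rewrite /Defs.eta /eta_sum; apply: eq_bigr => k _; rewrite big_mkcond; apply: eq_bigr => l _.
have [->|lk] /= := eqVneq l k; first by rewrite mu0 mulr0 !mul0r.
by rewrite /rinv exprVn /row_mu /mu_row !invfM.
Qed.

Lemma v_sqrE : v1_sqr mu + v2_sqr mu = Ex (pedge mu) (fun o => Upoly mu (ecoef mu) (tcoef mu) o ^+ 2).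
Proof.
rewrite (Ex_Upoly2 muS mu0 (tcoefS mu) (ecoefS muS)) addrC -sum_lt3 => [|//|].
- rewrite -sum_lt2 => [|i j|i].
  + congr (_ + _); apply: eq_bigr => i _; apply: eq_bigr => j ij.
      by rewrite gammaE ?etaE // -val_eqE /= ltn_eqF.
    apply: eq_bigr => k _.
    by rewrite /evar /tcoef /rinv /mu_row /row_mu !exprMn !exprVn !invfM mulrC.
  + by rewrite (ecoefS muS) (evarS muS).
  by rewrite (evar0 mu0) mulr0.
- have [c1 c2] := tcoefS mu; split=> i j k.
    by rewrite c1 (evarS muS j i) (evarS muS i k) (evarS muS k j); ring.
  by rewrite c2 (evarS muS i k) (evarS muS k j) (evarS muS j i); ring.
by move=> i k; rewrite (evar0 mu0) !mul0r mulr0.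
Qed.
End Moments.

(** Common rate of all errors; the exponent is that of [bad_prob] with the mean degree bounded below
    by [row_lower]. *)
Definition rho (R : realType) (n : nat) (beta p : R) : R :=
  (n%:R * p)^-1 + p + n%:R ^+ 12 * expR (- (beta * (n%:R * p) / 2 / 4)).

Lemma rho_ge0 (R : realType) (n : nat) (beta p : R) : 0 <= p -> 0 <= rho n beta p.
Proof.
by move=> p0; rewrite /rho !addr_ge0 ?invr_ge0 ?mulr_ge0 ?expR_ge0.
Qed.

Section Gap.
Context (R : realType) (n : nat) (mu : 'M[R]_n) (beta p : R).
Local Notation E := (Ex (pedge mu)).
Local Notation N := (n%:R : R).
Hypothesis muS : forall i j, mu i j = mu j i.
Hypothesis mu0 : forall i, mu i i = 0.
Hypothesis mu_bnd : forall i j, i != j -> beta * p <= mu i j <= p.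
Hypothesis beta01 : 0 < beta < 1.
Hypothesis p_bnd : 0 < p <= 1 / 2.
Hypothesis n4 : (4 <= n)%N.
Hypothesis np1 : 1 <= N * p.

Let v : R := v_norm mu.
Let X := Xfull mu v.
Let Y := Xlead mu v.
Let p1 : p <= 1. Proof. by case/andP: p_bnd => _; lra. Qed.
Let mur := mu_range mu0 mu_bnd beta01 p_bnd.

Lemma v_sq : v ^+ 2 = E (fun o => Upoly mu (ecoef mu) (tcoef mu) o ^+ 2).
Proof.
rewrite /v /v_norm v_sqrE // sqr_sqrtr //.
by apply: (E_ge0 mur p1) => o; exact: sqr_ge0.
Qed.

Lemma v_gt0 : 0 < v.
Proof.
have h := variance_lower muS mu0 mu_bnd beta01 p_bnd n4.
have h0 : 0 < v ^+ 2.
  rewrite v_sq; apply: lt_le_trans h.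
  case/andP: beta01 => b0 _; have Np : 0 < N * p by apply: lt_le_trans np1.
  by apply: mulr_gt0; [apply: divr_gt0; rewrite ?ltr0n|]; rewrite ?exprn_gt0 ?invr_gt0.
rewrite lt_neqAle sqrtr_ge0 andbT; apply: contraTneq h0 => <-.
by rewrite expr0n ltxx.
Qed.

Lemma gap_L2 : E (fun o => (X o - Y o) ^+ 2) <= rem_const beta * rho n beta p.
Proof.
apply: (Xfull_lead muS mu0 mu_bnd beta01 p_bnd n4 np1 v_gt0 v_sq).
exact: (bad_prob muS mu0 mur p1 (row_lower mu0 mu_bnd beta01 p_bnd n4)).
Qed.

Lemma X_sq : E (fun o => X o ^+ 2) <= 2 + 2 * (rem_const beta * rho n beta p).
Proof.
apply: le_trans (_ : E (fun o => 2 * Y o ^+ 2 + 2 * (X o - Y o) ^+ 2) <= _).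
  apply: (leE mur p1) => o; move: (X o) (Y o) => s t.
  rewrite -subr_ge0 [leRHS](_ : _ = (s - 2 * t) ^+ 2); last by ring.
  exact: sqr_ge0.
rewrite ExD !ExZ (Xlead2 v_gt0 v_sq) mulr1 lerD2l; apply: ler_wpM2l => //.
exact: gap_L2.
Qed.

(** The Lipschitz property of [u] moves the expectation from [X] to [Y], and there it is the defect
    in Stein's identity. Both steps leave a multiple of [lam] plus a multiple of
    [rho n beta p / lam]. *)
Lemma gap_test (u f f' : R -> R) (K0 K lam : R) : 0 < lam ->
  lipschitz u K0 ->
  (forall s, u s = f' s - s * f s) ->
  (forall s t, `|f s - f t - f' t * (s - t)| <= K * (s - t) ^+ 2) ->
  (forall s t, `|f' s - f' t| <= K * `|s - t|) -> (forall s, `|f' s| <= K) ->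
  `|E (fun o => u (X o))| <=
   (K0 + 8 * K) * lam + lam^-1 * ((K0 * rem_const beta + K * stein_const beta) * rho n beta p).
Proof.
move=> lam0 lu uE tay lip bnd.
have K00 := lipschitz_ge0 lu.
have K1 : 0 <= K by apply: le_trans (bnd 0).
have S := Xlead_stein muS mu0 mu_bnd beta01 p_bnd n4 np1 v_gt0 v_sq lam0 tay lip bnd.
have p0 : 0 < p by case/andP: p_bnd.
have sc := stein_const_ge0 (proj1 (andP beta01)).
have S' : `|E (fun o => Y o * f (Y o)) - E (fun o => f' (Y o))| <=
   K * (8 * lam + lam^-1 * (stein_const beta * rho n beta p)).
  apply: le_trans S _; apply: ler_wpM2l => //; rewrite lerD2l; apply: ler_wpM2l; first by rewrite invr_ge0 ltW.
  apply: ler_wpM2l => //; rewrite /rho lerDl mulr_ge0 ?expR_ge0 // exprn_ge0 //.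
have G : E (fun o => `|X o - Y o|) <= lam + lam^-1 * (rem_const beta * rho n beta p).
  apply: le_trans (_ : E (fun o => lam + lam^-1 * (X o - Y o) ^+ 2) <= _); last first.
    rewrite ExD Ex_cst ExZ lerD2l; apply: ler_wpM2l; first by rewrite invr_ge0 ltW.
    exact: gap_L2.
  apply: (leE mur p1) => o; rewrite -[(_ - _) ^+ 2]real_normK ?num_real //.
  move: `|_| => z; rewrite -(ler_pM2l lam0) mulrDr mulrA divff ?gt_eqF // mul1r.
  have := sqr_ge0 (lam - z / 2); have := sqr_ge0 z; nra.
have U : `|E (fun o => u (X o)) - E (fun o => u (Y o))| <= K0 * (lam + lam^-1 * (rem_const beta * rho n beta p)).
  rewrite -ExB; apply: le_trans (norm_Ex (pedge01 mur p1) _) _.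
  apply: le_trans (_ : E (fun o => K0 * `|X o - Y o|) <= _).
    by apply: (leE mur p1) => o; exact: lu.
  by rewrite ExZ; apply: ler_wpM2l.
have YE : E (fun o => u (Y o)) = - (E (fun o => Y o * f (Y o)) - E (fun o => f' (Y o))).
  by rewrite opprB -ExB; apply: eq_Ex => o; rewrite uE.
rewrite -(subrK (E (fun o => u (Y o))) (E (fun o => u (X o)))).
apply: le_trans (ler_normD _ _) _; rewrite YE normrN -YE.
apply: le_trans (lerD U S') _.
by apply: le_of_eq; ring.
Qed.
End Gap.

Theorem theorem2p4 (R : realType) (alpha beta : R)
  (alpha01 : 0 < alpha < 1) (beta01 : 0 < beta < 1)
  (W : forall n : nat, 'M[R]_n)
  (HW : forall n : nat, weight_array beta (W n))
  (d : nat -> measure_display) (T : forall n : nat, measurableType (d n))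
  (P : forall n : nat, probability (T n) R)
  (A : forall n : nat, 'I_n -> 'I_n -> {RV (P n) >-> bool})
  (HA : forall n : nat, heterogeneous_graph alpha (W n) (A n)) :
  cvg_in_distribution (P := P)
    (fun n => standardized_T_stat alpha (W n) (A n))
    (normal_prob 0 1).
Proof.
case/andP: (alpha01) => a0 a1.
pose p n : R := n%:R `^ (- alpha).
pose mu n := edge_prob alpha (W n).
have muE n i j : mu n i j = p n * W n i j by rewrite mxE.
have muS n i j : mu n i j = mu n j i by rewrite !muE; case: (HW n) => -> .
have mu0 n i : mu n i i = 0 by rewrite muE; case: (HW n) => _ _ ->; rewrite mulr0.
have p0 n : 0 <= p n by exact: powR_ge0.
have mub n i j : i != j -> beta * p n <= mu n i j <= p n.
  move=> ij; case: (HW n) => _ /(_ i j ij)/andP[w1 w2] _.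
  by rewrite muE mulrC ler_wpM2l //= ler_piMr.
have p1 n : p n <= 1.
  rewrite /p; case: n => [|n]; first by rewrite powR0 // oppr_eq0 gt_eqF.
  rewrite -[leRHS](powRr0 (n.+1%:R : R)); apply: ler_powR; last by rewrite oppr_le0 ltW.
  by rewrite (ler_nat R 1).
have mu01 n i j : 0 <= mu n i j <= 1.
  have [->|/(mub n)/andP[h1 h2]] := eqVneq i j; first by rewrite mu0 lexx ler01.
  rewrite (le_trans h2) // andbT; apply: le_trans h1; rewrite mulr_ge0 //.
  by case/andP: beta01 => /ltW.
pose w n := wt (pedge (mu n)).
have w0 n o : 0 <= w n o by apply: wt_ge0; apply: (pedge01 (mu01 n)).
have w1 n : \sum_o w n o = 1.
  rewrite -[RHS](Ex_cst (pedge (mu n))) /Ex; apply: eq_bigr => o _; by rewrite mulr1.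
have npE n : (0 < n)%N -> (n%:R : R) * p n = n%:R `^ (1 - alpha).
  move=> n0; rewrite /p powRD ?powRr1 //.
  by apply/implyP => _; rewrite pnatr_eq0 -lt0n.
(* The quantitative estimates require these conditions, which hold only for large n. *)
have regime : \forall n \near \oo, [/\ 0 < p n <= 1 / 2, (4 <= n)%N & 1 <= (n%:R : R) * p n].
  near=> n.
  have n4 : (4 <= n)%N by near: n; exact: nbhs_infty_ge.
  have n0 : (0 < n)%N by exact: leq_trans n4.
  split => //.
    rewrite powR_gt0 ?ltr0n //=; near: n.
    by apply: powRN_nat_small => //; lra.
  rewrite npE //; near: n; apply: powR_nat_large; lra.
pose r n := rho n beta (p n).
have rho0 e : 0 < e -> \forall n \near \oo, r n <= e.
  move=> e0; have e3 : 0 < e / 3 by lra.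
  have b8 : 0 < beta / 8 by case/andP: beta01 => *; lra.
  have a1' : 0 < 1 - alpha by lra.
  near=> n; have n0 : (0 < n)%N by near: n; exact: nbhs_infty_gt.
  rewrite /r /rho npE // -powRN.
  have h1 : (n%:R : R) `^ (- (1 - alpha)) <= e / 3 by near: n; exact: powRN_nat_small.
  have h2 : p n <= e / 3 by near: n; exact: powRN_nat_small.
  have h3 : (n%:R : R) ^+ 12 * expR (- (beta / 8 * n%:R `^ (1 - alpha))) <= e / 3.
    by near: n; exact: exp_beats_pow.
  rewrite (_ : beta * _ / 2 / 4 = beta / 8 * n%:R `^ (1 - alpha)); last by field.
  by lra.
have rhoM C e : 0 < e -> \forall n \near \oo, C * r n <= e.
  move=> e0; have C1 : 0 < `|C| + 1 by rewrite ltr_wpDl.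
  near=> n.
  have h : r n <= e / (`|C| + 1) by near: n; apply: rho0; rewrite divr_gt0.
  apply: le_trans (_ : (`|C| + 1) * r n <= _); last by rewrite mulrC -ler_pdivlMr.
  apply: ler_wpM2r; first exact: rho_ge0.
  by apply: le_trans (ler_norm C) _; rewrite lerDl ler01.
move=> x cx; under eq_fun do rewrite (cdf_standardized (HA _)).
(* The second moment is at most 2 + 2 once the remainder term in [X_sq] is at most 1. *)
apply: (cdf_of_stein w0 w1 (C := 4)) => //.
  near=> n.
  have [pb n4 np1] : [/\ 0 < p n <= 1 / 2, (4 <= n)%N & 1 <= (n%:R : R) * p n] by near: n.
  apply: le_trans (X_sq (muS n) (mu0 n) (mub n) beta01 pb n4 np1) _.
  suff : rem_const beta * r n <= 1 by rewrite /r; lra.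
  by near: n; exact: rhoM.
move=> u K0 M M0 lu uM gmean0.
have [f [f' [K [uE tay lip bnd]]]] := stein_equation lu M0 uM gmean0.
have K00 := lipschitz_ge0 lu.
have K1 : 0 <= K by apply: le_trans (bnd 0).
apply/cvgr0Pnorm_le => e e0.
(* Independent of n: it makes the [lam] term at most e / 2, after which the rate is made small
   against this fixed value. *)
pose lam := e / 2 / (K0 + 8 * K + 1).
have Kp : 0 < K0 + 8 * K + 1 by lra.
have lam0 : 0 < lam by rewrite divr_gt0 // divr_gt0.
near=> n.
have [pb n4 np1] : [/\ 0 < p n <= 1 / 2, (4 <= n)%N & 1 <= (n%:R : R) * p n] by near: n.
apply: le_trans (gap_test (muS n) (mu0 n) (mub n) beta01 pb n4 np1 lam0 lu uE tay lip bnd) _.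
have h : (K0 * rem_const beta + K * stein_const beta) * r n <= lam * (e / 2).
  by near: n; apply: rhoM; rewrite mulr_gt0 // divr_gt0.
apply: le_trans (_ : e / 2 + e / 2 <= _); last by lra.
apply: lerD; last by rewrite ler_pdivrMl.
apply: le_trans (_ : (K0 + 8 * K + 1) * lam <= _).
  by apply: ler_wpM2r; [exact: ltW|rewrite lerDl ler01].
by rewrite /lam mulrC divfK // gt_eqF.
Unshelve. all: by end_near.
Qed.
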